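(* Let $\mathbb{D}:=\{z\in\mathbb{C}:|z|<1\}$, $v\colon\mathbb{D}\to(0,\infty)$ continuous, $(E,\|\cdot\|_E)$ a normed space over $\mathbb{C}$, and \[ \mathcal{B}v(\mathbb{D},E):=\Bigl\{f\in\mathcal{H}(\mathbb{D},E):\|f\|^E:=\|f(0)\|_E+\sup_{z\in\mathbb{D}}\|\partial_{\mathbb{C}}^Ef(z)\|_Ev(z)<\infty\Bigr\}, \] with $\mathcal{B}v(\mathbb{D}):=\mathcal{B}v(\mathbb{D},\mathbb{C})$ and $\|\cdot\|:=\|\cdot\|^{\mathbb{C}}$. Then the following assertions hold. (a) $(\mathcal{B}v(\mathbb{D},E),\|\cdot\|^E,\tau_{\mathrm{co}}^E)$ is a C-sequential Saks space and $\tau_{\mathrm{co}}^E=\tau_{\mathcal{K}_{\mathbb{D}}}^E$ on $\mathcal{B}v(\mathbb{D},E)$. (b) If $E=\mathbb{C}$, then $(\mathcal{B}v(\mathbb{D}),\|\cdot\|,\tau_{\mathrm{co}})$ is semi-Montel and $\gamma(\|\cdot\|,\tau_{\mathrm{co}})=\gamma_{\mathrm{s}}(\|\cdot\|,\tau_{\mathcal{S}})$ for $\mathcal{S}\in\{\mathcal{N}_{\mathbb{D}},\mathcal{K}_{\mathbb{D}}\}$. (c) If $E$ is a Banach space, then $\mathcal{B}v(\mathbb{D},E)=\mathcal{B}v(\mathbb{D},E)_\sigma$ and the Saks space $(\mathcal{B}v(\mathbb{D},E),\|\cdot\|^E,\tau_{\mathrm{co}}^E)$ is complete.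
   Context: $\mathcal{H}(\mathbb{D},E)$ is the space of holomorphic functions $\mathbb{D}\to E$, and $\partial_{\mathbb{C}}^Ef(z):=\lim_{h\to0,\,h\in\mathbb{C},\,h\ne0}\frac{f(z+h)-f(z)}{h}$ is the complex derivative. Saks spaces. Let $(X,\|\cdot\|)$ be a normed space and $\tau$ a locally convex Hausdorff topology on $X$ coarser than the norm topology $\tau_{\|\cdot\|}$. The mixed topology $\gamma=\gamma(\|\cdot\|,\tau)$ is the finest linear topology on $X$ that coincides with $\tau$ on $\|\cdot\|$-bounded sets and lies between $\tau$ and $\tau_{\|\cdot\|}$; it is locally convex Hausdorff. $(X,\|\cdot\|,\tau)$ is a Saks space if there is a directed system $\Gamma_\tau$ of continuous seminorms generating $\tau$ with $\|x\|=\sup_{q\in\Gamma_\tau}q(x)$ for all $x$. The submixed topology $\gamma_{\mathrm{s}}(\|\cdot\|,\tau)$ is generated by the seminorms $x\mapsto\sup_{n\in\mathbb{N}}q_n(x)a_n$ with $(q_n)_{n\in\mathbb{N}}\subset\Gamma_\tau$ and $(a_n)_{n\in\mathbb{N}}$ a real non-negative null-sequence (independent of the choice of such $\Gamma_\tau$). A Saks space is complete if $(X,\gamma)$ is complete; semi-Montel if $(X,\gamma)$ is a semi-Montel space (bounded sets are relatively compact); C-sequential if every convex sequentially open subset of $(X,\gamma)$ is open. Topologies. $\tau_{\mathrm{co}}^E$ is the (relative) topology of uniform convergence on compact subsets of $\mathbb{D}$; $\tau_{\mathrm{co}}:=\tau_{\mathrm{co}}^{\mathbb{C}}$. $\mathcal{N}_{\mathbb{D}}$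 and $\mathcal{K}_{\mathbb{D}}$ are the families of finite resp. compact subsets of $\mathbb{D}$. For $\mathcal{S}\in\{\mathcal{N}_{\mathbb{D}},\mathcal{K}_{\mathbb{D}}\}$, $\tau_{\mathcal{S}}^E$ on $\mathcal{B}v(\mathbb{D},E)$ is generated by the seminorms $q_S^E(f):=\|f(0)\|_E+\sup_{z\in S}\|\partial_{\mathbb{C}}^Ef(z)\|_Ev(z)$, $S\in\mathcal{S}$ (supremum over the empty set being $0$), and $\tau_{\mathcal{S}}:=\tau_{\mathcal{S}}^{\mathbb{C}}$. Weak version. $\mathcal{B}v(\mathbb{D},E)_\sigma:=\{f\colon\mathbb{D}\to E:e^*\circ f\in\mathcal{B}v(\mathbb{D})\text{ for all }e^*\in E^*\}$. *)

(* Defs.v *)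
From HB Require Import structures.
From mathcomp Require Import all_boot all_order all_algebra.
From mathcomp Require Import finmap complex.
From mathcomp Require Import all_classical all_reals all_analysis.

Set Implicit Arguments.
Unset Strict Implicit.
Unset Printing Implicit Defensive.

Import Order.TTheory GRing.Theory Num.Theory.
Import numFieldNormedType.Exports.

Local Open Scope classical_set_scope.
Local Open Scope ring_scope.
Local Open Scope complex_scope.

(* Several topologies live on one carrier [X], so a topology on [X] is a term
   of the structure type [Topological X], as for the library's
   [sup_topology]. *)

Definition withtop (X : choiceType) (t : Topological X) : topologicalType :=
  Topological.Pack t.

Definition coarser (X : choiceType) (s t : Topological X) : Prop :=
  @open (withtop s) `<=` @open (withtop t).

Definition same_topology (X : choiceType) (s t : Topological X) : Prop :=
  @open (withtop s) = @open (withtop t).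

Definition linear_topology (R : realType) (X : lmodType R[i])
    (t : Topological X) : Prop :=
  continuous (fun p : withtop t * withtop t =>
    ((p.1 : X) + (p.2 : X)) : withtop t) /\
  continuous (fun p : R[i]^o * withtop t =>
    (p.1 *: (p.2 : X)) : withtop t).

Definition locally_convex_topology (R : realType) (X : lmodType R[i])
    (t : Topological X) : Prop :=
  exists2 B : set_system (withtop t),
    (forall b, B b -> convex_set (b : set (convex_lmodType X))) & basis B.

Definition is_seminorm (R : realType) (X : lmodType R[i]) (q : X -> R) : Prop :=
  [/\ forall x, 0 <= q x,
      forall x y, q (x + y) <= q x + q y &
      forall (a : R[i]) x, q (a *: x) = complex.Re `|a| * q x].

Definition is_norm (R : realType) (X : lmodType R[i]) (nrm : X -> R) : Prop :=
  is_seminorm nrm /\ forall x, nrm x = 0 -> x = 0.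

Definition seminorm_space (R : realType) (X : lmodType R[i])
  (Gamma : set (X -> R)) : Type := X.

HB.instance Definition _ (R : realType) (X : lmodType R[i])
    (Gamma : set (X -> R)) := Choice.on (seminorm_space Gamma).
HB.instance Definition _ (R : realType) (X : lmodType R[i])
    (Gamma : set (X -> R)) :=
  isSubBaseTopological.Build (seminorm_space Gamma)
    [set B : set X | exists q x r,
       [/\ Gamma q, 0 < r & B = [set y | q (y - x) < r]]] id.

Definition seminorm_topology (R : realType) (X : lmodType R[i])
    (Gamma : set (X -> R)) : Topological X :=
  Topological.class (seminorm_space Gamma).

Definition norm_topology (R : realType) (X : lmodType R[i]) (nrm : X -> R) :
  Topological X := seminorm_topology [set nrm].

Definition agree_on_bounded (R : realType) (X : lmodType R[i]) (nrm : X -> R)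
    (s t : Topological X) : Prop :=
  forall B : set X, has_ubound (nrm @` B) ->
    [set U `&` B | U in @open (withtop s)] =
    [set U `&` B | U in @open (withtop t)].

Definition mixed_candidate (R : realType) (X : lmodType R[i]) (nrm : X -> R)
    (t s : Topological X) : Prop :=
  [/\ linear_topology s, agree_on_bounded nrm s t,
      coarser t s & coarser s (norm_topology nrm)].

(* The supremum of the candidates; [mixed_topologyP] shows that it is itself a
   candidate, hence the finest one. *)
Definition mixed_space (R : realType) (X : lmodType R[i]) (nrm : X -> R)
  (t : Topological X) : Type := X.

HB.instance Definition _ (R : realType) (X : lmodType R[i]) (nrm : X -> R)
    (t : Topological X) := Choice.on (mixed_space nrm t).
HB.instance Definition _ (R : realType) (X : lmodType R[i]) (nrm : X -> R)
    (t : Topological X) :=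
  isSubBaseTopological.Build (mixed_space nrm t)
    [set U : set X | exists2 s : Topological X,
       mixed_candidate nrm t s & @open (withtop s) U] id.

Definition mixed_topology (R : realType) (X : lmodType R[i]) (nrm : X -> R)
    (t : Topological X) : Topological X :=
  Topological.class (mixed_space nrm t).

Lemma mixed_cvg (R : realType) (X : lmodType R[i]) (nrm : X -> R)
    (t : Topological X) (F : set_system X) (x : X) : Filter F ->
  F --> (x : withtop (mixed_topology nrm t)) <->
  forall s, mixed_candidate nrm t s -> F --> (x : withtop s).
Proof.
move=> FF; split=> [Fx s cs A|Fx A /=].
  rewrite nbhsE => - [B [Bo Bx] BA]; apply: Fx.
  exists B; split => //; exists [set B]; last by rewrite bigcup_set1.
  move=> _ ->; exists [fset B]%fset.
    by move=> ?; rewrite inE inE => /eqP ->; exists s.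
  by rewrite set_fset1 bigcap_set1.
move=> [_ [[B sB <-] [C BC Cx] sUBA]].
rewrite nbhs_filterE; apply: filterS sUBA _; apply: (@filterS _ _ _ C).
  by move=> ? ?; exists C.
have /sB [D sD IDeC] := BC; rewrite -IDeC; apply: filter_bigI => E DE.
have := sD _ DE; rewrite inE => -[s cs Eo].
apply: (Fx s cs); rewrite nbhsE; exists E => //; split => //.
by move: Cx; rewrite -IDeC => /(_ _ DE).
Qed.

Lemma mixed_topologyP (R : realType) (X : lmodType R[i]) (nrm : X -> R)
    (t : Topological X) :
  linear_topology t -> coarser t (norm_topology nrm) ->
  mixed_candidate nrm t (mixed_topology nrm t) /\
  forall s, mixed_candidate nrm t s -> coarser s (mixed_topology nrm t).
Proof.
move=> tL tN; set M := mixed_topology nrm t.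
have ct : mixed_candidate nrm t t by split.
have sM s : mixed_candidate nrm t s -> forall (x : X) (A : set X),
    nbhs (x : withtop s) A -> nbhs (x : withtop M) A.
  move=> cs x A; have FM := @nbhs_filter (withtop M) x.
  by apply: ((mixed_cvg nrm t x FM).1 _ s cs); exact.
have Msup (F : set_system X) (x : X) : Filter F ->
    (forall s, mixed_candidate nrm t s -> F --> (x : withtop s)) ->
    F --> (x : withtop M).
  by move=> FF; apply: (mixed_cvg nrm t x FF).2.
have sup s : mixed_candidate nrm t s -> coarser s M.
  by move=> cs U; rewrite !openE => Uo x /Uo; exact: sM.
split => //; split; [split| |exact: sup|].
- move=> /= [x y]; apply: Msup => s cs A.
  have [[sadd _] _ _ _] := cs.
  move=> /(sadd (x, y)) [[/= P Q] [Px Qy] PQ].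
  by exists (P, Q) => //; split; apply: (sM s cs).
- move=> /= [a x]; apply: Msup => s cs A.
  have [[_ sscl] _ _ _] := cs.
  move=> /(sscl (a, x)) [[/= P Q] [Px Qy] PQ].
  by exists (P, Q) => //; split => //; apply: (sM s cs).
- move=> B Bb; apply/seteqP; split=> [_ [U Uo <-]|_ [U Uo <-]]; last first.
    by exists U => //; exact: sup Uo.
  pose W : set (withtop t) := [set y | B y -> U y].
  exists (interior W); first exact: open_interior.
  apply/seteqP; split=> x [xU Bx]; split => //.
    exact: (interior_subset xU).
  have FB : Filter (within B (nbhs (x : withtop t))).
    by apply: within_filter; exact: nbhs_filter.
  apply: (Msup _ x FB) => [s cs A|]; last first.
    by move: Uo; rewrite openE => /(_ x xU).
  rewrite nbhsE => -[G [Go Gx] GA].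
  have [_ /(_ B Bb) sB _ _] := cs.
  have : [set V `&` B | V in @open (withtop t)] (G `&` B).
    by rewrite -sB; exists G.
  move=> [V Vo VB]; rewrite nbhs_filterE /within /=.
  have Vx : V x by have [] : (V `&` B) x by rewrite VB.
  have : nbhs (x : withtop t) V by exact: open_nbhs_nbhs.
  apply: filterS => y Vy By; apply: GA.
  by have [] : (G `&` B) y by rewrite -VB.
- move=> U; rewrite !openE => Uo x Ux.
  have FN := @nbhs_filter (withtop (norm_topology nrm)) x.
  apply: (Msup _ x FN) => [s [_ _ _ sN] A|]; last exact: Uo.
  rewrite !nbhsE => -[B [Bo Bx] BA].
  by exists B => //; split => //; exact: sN.
Qed.

Definition directed_seminorms (R : realType) (X : lmodType R[i])
    (Gamma : set (X -> R)) : Prop :=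
  Gamma !=set0 /\
  forall p q, Gamma p -> Gamma q ->
    exists r, [/\ Gamma r, forall x, p x <= r x & forall x, q x <= r x].

Definition saks_system (R : realType) (X : lmodType R[i]) (nrm : X -> R)
    (t : Topological X) (Gamma : set (X -> R)) : Prop :=
  [/\ forall q, Gamma q -> is_seminorm q /\ continuous (q : withtop t -> R),
      directed_seminorms Gamma,
      same_topology t (seminorm_topology Gamma) &
      forall x, (nrm x)%:E = ereal_sup [set (q x)%:E | q in Gamma]].

Definition saks_space (R : realType) (X : lmodType R[i]) (nrm : X -> R)
    (t : Topological X) : Prop :=
  [/\ is_norm nrm,
      [/\ linear_topology t, locally_convex_topology t &
          hausdorff_space (withtop t)],
      coarser t (norm_topology nrm) &
      exists Gamma, saks_system nrm t Gamma].

(* The real [sup] below is over a bounded set as soon as the members of [Gamma]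
   are dominated by a common norm. *)
Definition submixed_topology (R : realType) (X : lmodType R[i])
    (Gamma : set (X -> R)) : Topological X :=
  seminorm_topology [set p : X -> R | exists (q : nat -> X -> R) (a : nat -> R),
    [/\ forall n, Gamma (q n), forall n, 0 <= a n, a @ \oo --> (0 : R) &
        p = fun x => sup [set q n x * a n | n in [set: nat]]]].

(* The submixed topology does not depend on the generating system: [s] is
   required to agree with it for every choice. *)
Definition is_submixed_topology (R : realType) (X : lmodType R[i])
    (nrm : X -> R) (t s : Topological X) : Prop :=
  saks_space nrm t /\
  forall Gamma, saks_system nrm t Gamma ->
    same_topology s (submixed_topology Gamma).

Definition sequentially_open (T : topologicalType) (U : set T) : Prop :=
  forall (u : nat -> T) (x : T), U x -> u @ \oo --> x ->
    \forall n \near \oo, U (u n).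

Definition C_sequential (R : realType) (X : lmodType R[i])
    (t : Topological X) : Prop :=
  forall U : set (withtop t), convex_set (U : set (convex_lmodType X)) ->
    sequentially_open U -> open U.

Definition vn_bounded (R : realType) (X : lmodType R[i])
    (t : Topological X) (B : set X) : Prop :=
  forall U, nbhs ((0 : X) : withtop t) U ->
    exists2 r : R, 0 < r & forall a : R[i], r%:C <= `|a| ->
      B `<=` [set a *: y | y in U].

Definition semi_montel (R : realType) (X : lmodType R[i])
    (t : Topological X) : Prop :=
  forall B : set X, vn_bounded t B -> compact (closure (B : set (withtop t))).

(* Cauchy filters are those of the uniformity of a linear topology, whose
   entourages are the [fun xy => U (xy.1 - xy.2)] for [U] a neighbourhood of
   [0]. *)
Definition complete_topology (R : realType) (X : lmodType R[i])
    (t : Topological X) : Prop :=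
  forall F : set_system (withtop t), ProperFilter F ->
    (forall U, nbhs ((0 : X) : withtop t) U ->
      exists2 A, F A & forall x y : X, A x -> A y -> U (x - y)) ->
    exists x : withtop t, F --> x.

Definition C_sequential_saks_space (R : realType) (X : lmodType R[i])
    (nrm : X -> R) (t : Topological X) : Prop :=
  saks_space nrm t /\ C_sequential (mixed_topology nrm t).

Definition semi_montel_saks_space (R : realType) (X : lmodType R[i])
    (nrm : X -> R) (t : Topological X) : Prop :=
  saks_space nrm t /\ semi_montel (mixed_topology nrm t).

Definition complete_saks_space (R : realType) (X : lmodType R[i])
    (nrm : X -> R) (t : Topological X) : Prop :=
  saks_space nrm t /\ complete_topology (mixed_topology nrm t).

Definition disc (R : realType) : set R[i]^o := [set z | `|z| < 1].
Arguments disc : clear implicits.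

Lemma disc0_subproof (R : realType) : (0 : R[i]^o) \in disc R.
Proof. by rewrite inE /disc /= normr0 ltr01. Qed.

Definition disc0 (R : realType) : disc R := SigSub (disc0_subproof R).

(* The norm of a normed module over [R[i]] takes values in [R[i]]. *)
Definition rnorm (R : realType) (E : normedModType R[i]) (x : E) : R :=
  complex.Re `|x|.

(* ['valL_0 f] extends [f] by [0] outside the disc; as the disc is open this
   affects neither differentiability nor the derivative at its points. *)
Definition holomorphic (R : realType) (E : normedModType R[i])
    (f : disc R -> E) : Prop :=
  forall z : disc R, derivable ('valL_0 f : R[i]^o -> E) (val z) 1.

Definition cderive (R : realType) (E : normedModType R[i])
    (f : disc R -> E) (z : disc R) : E :=
  'D_1 ('valL_0 f : R[i]^o -> E) (val z).

Definition bloch (R : realType) (v : disc R -> R) (E : normedModType R[i])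
    (f : disc R -> E) : Prop :=
  holomorphic f /\
  has_ubound [set rnorm (cderive f z) * v z | z in [set: disc R]].

(* The library's [sup set0 = 0] is the convention used for [S = set0]. *)
Definition bloch_seminorm (R : realType) (v : disc R -> R)
    (E : normedModType R[i]) (S : set (disc R)) (f : disc R -> E) : R :=
  rnorm (f (disc0 R)) + sup [set rnorm (cderive f z) * v z | z in S].

Definition bloch_pred (R : realType) (v : disc R -> R)
    (E : normedModType R[i]) : {pred disc R -> E} := fun f => `[< bloch v f >].
Arguments bloch_pred {R} v E.

Record bloch_space (R : realType) (v : disc R -> R) (E : normedModType R[i]) :=
  BlochSpace { bloch_fun :> disc R -> E; _ : bloch_fun \in bloch_pred v E }.
Arguments bloch_space {R} v E.

HB.instance Definition _ (R : realType) (v : disc R -> R)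
  (E : normedModType R[i]) := [isSub for @bloch_fun R v E].
HB.instance Definition _ (R : realType) (v : disc R -> R)
  (E : normedModType R[i]) := [Choice of bloch_space v E by <:].

Lemma valL0D (R : realType) (E : normedModType R[i]) (a : R[i])
    (f g : disc R -> E) :
  'valL_0 (a *: f + g) = a \*: 'valL_0 f + 'valL_0 g :> (R[i]^o -> E).
Proof.
apply/funext => z; rewrite [RHS]/= !fctE /valL_ /=.
set o := 'oinv_set_val z.
rewrite -[X in _ = _ *: oapp f 0 X + _]/o -[X in _ = _ + oapp g 0 X]/o.
by case: o => [w|] //=; rewrite scaler0 addr0.
Qed.

Lemma rnormD (R : realType) (E : normedModType R[i]) (x y : E) :
  rnorm (x + y) <= rnorm x + rnorm y.
Proof.
have := ler_normD x y; rewrite lecE => /andP[_].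
by rewrite /rnorm raddfD.
Qed.

Lemma rnorm_ge0 (R : realType) (E : normedModType R[i]) (x : E) : 0 <= rnorm x.
Proof. by have := normr_ge0 x; rewrite lecE => /andP[]. Qed.

Lemma rnormZ (R : realType) (E : normedModType R[i]) (a : R[i]) (x : E) :
  rnorm (a *: x) = complex.Re `|a| * rnorm x.
Proof.
by apply: complexI; rewrite rmorphM /= /rnorm !RRe_real ?normr_real// normrZ.
Qed.

Lemma bloch_submod_closed (R : realType) (v : disc R -> R)
  (E : normedModType R[i]) : submod_closed (bloch_pred v E).
Proof.
split=> [|a f g /asboolP[fH [M fM]] /asboolP[gH [N gN]]]; apply/asboolP.
  have valL00 : 'valL_0 (0 : disc R -> E) = cst 0 :> (R[i]^o -> E).
    by apply/funext => z; rewrite /valL_ /=; case: ('oinv_set_val z).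
  split=> [z|]; first by rewrite valL00; exact: derivable_cst.
  exists 0 => _ [z _ <-]; rewrite /cderive valL00 derive_cst /rnorm normr0.
  by rewrite mul0r.
have dfg z : cderive (a *: f + g) z = a *: cderive f z + cderive g z.
  by rewrite /cderive valL0D deriveD ?deriveZ//; exact: derivableZ.
split=> [z|].
  by rewrite valL0D; apply: derivableD => //; exact: derivableZ.
exists (`|complex.Re `|a| * M| + `|N|) => _ [z _ <-]; rewrite dfg.
have [v0|v0] := leP 0 (v z); last first.
  rewrite (@le_trans _ _ 0) ?addr_ge0//.
  by rewrite mulr_ge0_le0 ?rnorm_ge0 // ltW.
apply: (le_trans (ler_wpM2r v0 (rnormD _ _))).
rewrite mulrDl rnormZ -mulrA; apply: lerD; apply: le_trans (ler_norm _).
  apply: ler_wpM2l; last by apply: fM; exists z.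
  by have := normr_ge0 a; rewrite lecE => /andP[].
by apply: gN; exists z.
Qed.

HB.instance Definition _ (R : realType) (v : disc R -> R)
  (E : normedModType R[i]) := GRing.isSubmodClosed.Build R[i] (disc R -> E)
    (bloch_pred v E) (bloch_submod_closed v E).
HB.instance Definition _ (R : realType) (v : disc R -> R)
  (E : normedModType R[i]) :=
  [SubChoice_isSubLmodule of bloch_space v E by <:].

Definition bloch_norm (R : realType) (v : disc R -> R) (E : normedModType R[i])
    (f : bloch_space v E) : R := bloch_seminorm v setT f.
Arguments bloch_norm {R} v E f.

(* The trace on the space of the library's topology of uniform convergence on
   compact sets. *)
Definition tau_co (R : realType) (v : disc R -> R) (E : normedModType R[i]) :
    Topological (bloch_space v E) :=
  Topological.class (initial_topology
    (@bloch_fun R v E : bloch_space v E -> {family compact, disc R -> E})).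
Arguments tau_co {R} v E.

Definition tau_family (R : realType) (v : disc R -> R) (E : normedModType R[i])
    (fam : set (set (disc R))) : Topological (bloch_space v E) :=
  seminorm_topology [set (fun f : bloch_space v E => bloch_seminorm v S f)
                    | S in fam].
Arguments tau_family {R} v E fam.

Definition weak_bloch (R : realType) (v : disc R -> R) (E : normedModType R[i])
    (f : disc R -> E) : Prop :=
  forall e : {linear E -> R[i]^o}, continuous e ->
    bloch v (e \o f : disc R -> R[i]^o).
Arguments weak_bloch {R} v E f.

Definition banach (R : realType) (E : normedModType R[i]) : Prop :=
  forall F : set_system E, ProperFilter F -> cauchy F -> cvg F.

(* Main.v *)
(* A convex set is a mixed neighbourhood of [0] as soon as on every ball it
   contains a [t]-neighbourhood of [0], because its gauge is then one of the
   seminorms that are [t]-small on balls. This makes the submixed topology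
   coarser than the mixed one; the converse, for [t]-compact balls, is the
   Banach-Dieudonne argument: a seminorm is added for every integer radius,
   compactness of the balls and directedness of the system making one seminorm
   per radius enough.

   The analytic input is the Cauchy estimate [|F'(c)| <= 4 M / r] for [F] with
   locally bounded derivative. Hahn-Banach reduces it to a scalar function, and
   the mean over a circle of the real part of [(F z - F c) / (z - c)] does not
   depend on the radius. With the mean value inequality it shows that the
   compact-open topology is the one of the seminorms [q_S] for compact [S]. It
   also makes derivatives locally Lipschitz, with bounds uniform on balls of the
   Bloch space: Montel's theorem follows by ultrafilters and, weakly bounded
   sets being bounded, so does the Cauchy property of the difference quotients
   of a weakly Bloch function. *)

From HB Require Import structures.
Require Import Defs.
From mathcomp Require Import all_boot all_order all_algebra.
From mathcomp Require Import finmap complex.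
From mathcomp Require Import all_classical all_reals all_analysis.
From mathcomp Require Import ring lra.

Import Order.TTheory GRing.Theory Num.Theory.
Import numFieldNormedType.Exports.

Set Implicit Arguments.
Unset Strict Implicit.
Unset Printing Implicit Defensive.

Local Open Scope classical_set_scope.
Local Open Scope ring_scope.
Local Open Scope complex_scope.

(** * Norms and seminorms *)

(** What a Bloch function offers is a locally bounded derivative, because the weight has a positive
    lower bound on compact sets; the Cauchy estimate is therefore derived under that assumption
    alone. As [E] need not be complete, no [E]-valued function is integrated: only real functions
    obtained from norming functionals are.

    A Cauchy filter for the mixed topology need not contain a norm-bounded set, and off the balls
    the mixed topology has no direct description. Completeness thus needs two arguments beyond
    locally uniform limits. The limit has finite norm because a weighted supremum along a sequence
    of points would detect unbounded growth, and convergence for [t] improves to mixed convergence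
    because suitable mixed neighbourhoods are built from conditions that survive limits for [t]. *)

Section rnorm_theory.
Variables (R : realType) (E : normedModType R[i]).
Implicit Types x y : E.

Lemma rnormE x : (rnorm x)%:C = `|x|.
Proof. by rewrite /rnorm RRe_real ?normr_real. Qed.

Lemma rnorm_ltP x (e : R[i]) : 0 < e -> (`|x| < e) = (rnorm x < complex.Re e).
Proof.
move=> e0; rewrite -rnormE -[in LHS](RRe_real (gtr0_real e0)).
by rewrite ltcR.
Qed.

Lemma nbhs_rnormP x (A : set E) : nbhs x A <->
  exists2 r : R, 0 < r & forall y, rnorm (y - x) < r -> A y.
Proof.
split=> [|[r r0 rA]].
  move/nbhs_normP => [e /= e0 eA]; exists (complex.Re e) => [|y yx].
    by move: e0; rewrite ltcE /= => /andP[].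
  by apply: eA => /=; rewrite distrC rnorm_ltP.
apply/nbhs_normP; exists r%:C; first by rewrite /= ltcR.
by move=> y /=; rewrite distrC rnorm_ltP ?ltcR//; exact: rA.
Qed.

Lemma rnorm0 : rnorm (0 : E) = 0. Proof. by rewrite /rnorm normr0. Qed.

Lemma rnormN x : rnorm (- x) = rnorm x. Proof. by rewrite /rnorm normrN. Qed.

Lemma rnormBC x y : rnorm (x - y) = rnorm (y - x).
Proof. by rewrite /rnorm distrC. Qed.

Lemma rnorm0_eq0 x : rnorm x = 0 -> x = 0.
Proof. by move=> x0; apply/normr0_eq0; rewrite -rnormE x0. Qed.

Lemma rnorm_gt0 x : x != 0 -> 0 < rnorm x.
Proof.
move=> x0; rewrite lt_neqAle eq_sym rnorm_ge0 andbT.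
by apply: contra x0 => /eqP/rnorm0_eq0 ->.
Qed.

Lemma rnorm_is_seminorm : is_seminorm (@rnorm R E).
Proof. by split; [exact: rnorm_ge0|exact: rnormD|exact: rnormZ]. Qed.

End rnorm_theory.

Lemma Re_le_rnorm (R : realType) (z : R[i]^o) : `|complex.Re z| <= rnorm z.
Proof.
case: z => a b; rewrite /rnorm normc_def /= -sqrtr_sqr ler_sqrt ?lerDl ?sqr_ge0//.
by rewrite addr_ge0 ?sqr_ge0.
Qed.

Lemma Im_le_rnorm (R : realType) (z : R[i]^o) : `|complex.Im z| <= rnorm z.
Proof.
case: z => a b; rewrite /rnorm normc_def /= -sqrtr_sqr ler_sqrt ?lerDr ?sqr_ge0//.
by rewrite addr_ge0 ?sqr_ge0.
Qed.

Lemma rnorm_ReIm (R : realType) (z : R[i]^o) :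
  rnorm z <= `|complex.Re z| + `|complex.Im z|.
Proof.
case: z => u v; rewrite /rnorm normc_def /= -[leRHS]ger0_norm ?addr_ge0// -sqrtr_sqr.
rewrite ler_sqrt ?sqr_ge0// sqrrD !real_normK ?num_real//.
by rewrite lerD2r lerDl mulrn_wge0// mulr_ge0.
Qed.

Lemma filter_limit_le (R : realType) (E : normedModType R[i]) (T : Type)
    (U : set_system T) (h : T -> E) (l : E) (M : R) :
  ProperFilter U -> (forall e : R, 0 < e -> U [set i | rnorm (h i - l) < e]) ->
  U [set i | rnorm (h i) <= M] -> rnorm l <= M.
Proof.
move=> UF hl hM; rewrite leNgt; apply/negP => lt.
have d0 : 0 < rnorm l - M by rewrite subr_gt0.
have [i [/= i1 i2]] := filter_ex (filterI hM (hl _ d0)).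
rewrite rnormBC in i2; have := rnormD (l - h i) (h i).
by rewrite subrK; move: i1 i2; lra.
Qed.

Lemma convex_lt (R : realType) (s a b e : R) :
  0 <= s -> s <= 1 -> a < e -> b < e -> s * a + (1 - s) * b < e.
Proof.
rewrite le_eqVlt => /predU1P[<-|s0] s1 ae be; first by rewrite mul0r add0r subr0 mul1r.
by nra.
Qed.

Section seminorm_theory.
Variables (R : realType) (X : lmodType R[i]).
Implicit Types (p q : X -> R) (x y : X).

Lemma Re_normC (r : R) : complex.Re `|r%:C| = `|r|.
Proof. by rewrite normc_def /= expr0n /= addr0 sqrtr_sqr. Qed.

Lemma seminorm0 q : is_seminorm q -> q 0 = 0.
Proof. by move=> [_ _ qZ]; rewrite -(scale0r 0) qZ normr0 mul0r. Qed.

Lemma seminormN q x : is_seminorm q -> q (- x) = q x.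
Proof. by move=> [_ _ qZ]; rewrite -scaleN1r qZ normrN1 mul1r. Qed.

Lemma seminormBC q x y : is_seminorm q -> q (x - y) = q (y - x).
Proof. by move=> qs; rewrite -seminormN// opprB. Qed.

Lemma seminorm_tri q z x y : is_seminorm q -> q (x - y) <= q (x - z) + q (z - y).
Proof. by move=> [_ qD _]; rewrite -[x - y](subrKA z); exact: qD. Qed.

Lemma seminormB q x y : is_seminorm q -> q (x - y) <= q x + q y.
Proof. by move=> qs; rewrite -(seminormN y qs); case: qs. Qed.

Lemma seminormZR q (r : R) x : is_seminorm q -> q (r%:C *: x) = `|r| * q x.
Proof. by move=> [_ _ ->]; rewrite Re_normC. Qed.

(** Applying the inequality to [a^-1] and [a *: x] reverses it, so a supremum of seminorms needs
    only the easy half of homogeneity. *)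
Lemma is_seminorm_le q : (forall x, 0 <= q x) ->
  (forall x y, q (x + y) <= q x + q y) ->
  (forall (a : R[i]) x, q (a *: x) <= complex.Re `|a| * q x) -> is_seminorm q.
Proof.
move=> q0 qD qZ; split=> // a x; apply/eqP; rewrite eq_le qZ andTb.
have [->|a0] := eqVneq a 0; first by rewrite normr0 mul0r q0.
have na0 : 0 < complex.Re `|a| by exact: (@rnorm_gt0 _ R[i]^o).
rewrite -ler_pdivlMl//; have := qZ a^-1 (a *: x).
rewrite scalerA mulVf// scale1r; congr (_ <= _ * _).
by rewrite normfV -(@rnormE _ R[i]^o a) -fmorphV.
Qed.

(** Directedness is built in: each neighbourhood contains a ball of one seminorm, not only a finite
    intersection of balls. *)
Definition generated (t : Topological X) (G : set (X -> R)) :=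
  forall x (A : set X), nbhs (x : withtop t) A <->
    exists q r, [/\ G q, 0 < r & forall y, q (y - x) < r -> A y].

Lemma seminorm_cvg (G : set (X -> R)) (F : set_system X) (x : X) :
  (forall q, G q -> is_seminorm q) -> Filter F ->
  (forall q r, G q -> 0 < r -> F [set y | q (y - x) < r]) ->
  F --> (x : withtop (seminorm_topology G)).
Proof.
move=> GS FF Fx A /= [_ [[B sB <-] [C BC Cx] sUBA]].
rewrite nbhs_filterE; apply: filterS sUBA _; apply: (@filterS _ _ _ C).
  by move=> ? ?; exists C.
have /sB [D sD IDeC] := BC; rewrite -IDeC; apply: filter_bigI => E DE.
have := sD _ DE; rewrite inE => -[q [z [r [Gq r0 EE]]]].
have Ex : E x by move: Cx; rewrite -IDeC => /(_ _ DE).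
move: Ex; rewrite EE /= => qxz.
(* The subbasic balls may be centred anywhere; around [x] the radius shrinks to [r - q (x - z)]. *)
have r1 : 0 < r - q (x - z) by rewrite subr_gt0.
apply: filterS (Fx _ _ Gq r1) => y /= qyx.
by apply: (le_lt_trans (seminorm_tri x _ _ (GS _ Gq))); rewrite -ltrBrDr.
Qed.

Lemma seminorm_topology_generated G : (forall q, G q -> is_seminorm q) ->
  directed_seminorms G -> generated (seminorm_topology G) G.
Proof.
move=> GS [[q0 Gq0] Gdir] x A; split => [nA|[q [r [Gq r0 qA]]]].
  pose D := [set qr : (X -> R) * R | G qr.1 /\ 0 < qr.2].
  pose F := filter_from D (fun qr => [set y | qr.1 (y - x) < qr.2]).
  have FF : Filter F.
    apply: filter_from_filter; first by exists (q0, 1); split.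
    move=> [p a] [q b] [/= Gp a0] [/= Gq b0].
    have [m [Gm pm qm]] := Gdir _ _ Gp Gq.
    exists (m, Num.min a b); first by split => //=; rewrite lt_min a0.
    move=> y /=; rewrite lt_min => /andP[ma mb]; split.
      exact: le_lt_trans ma.
    exact: le_lt_trans mb.
  have : F --> (x : withtop (seminorm_topology G)).
    apply: seminorm_cvg => // q r Gq r0.
    by exists (q, r).
  by move=> /(_ A nA) [[q r] [/= Gq r0] qA]; exists q, r.
rewrite nbhsE; exists [set y | q (y - x) < r]; last exact: qA.
split; last by rewrite /= subrr seminorm0//; exact: GS.
exists [set [set y | q (y - x) < r]]; last by rewrite bigcup_set1.
move=> _ ->; exists [fset [set y | q (y - x) < r]]%fset.
  by move=> ?; rewrite inE inE => /eqP ->; exists q, x, r.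
by rewrite set_fset1 bigcap_set1.
Qed.

Lemma same_topology_nbhs (s t : Topological X) : same_topology s t <->
  (forall x (A : set X), nbhs (x : withtop s) A <-> nbhs (x : withtop t) A).
Proof.
split=> [st x A|st].
  have H : @open (withtop s) = @open (withtop t) := st.
  split; rewrite !nbhsE => -[B [Bo Bx] BA]; exists B => //; split => //.
    by rewrite -H.
  by rewrite H.
apply/seteqP; split=> A; rewrite !openE => Ao x /Ao.
  exact: (st x A).1.
exact: (st x A).2.
Qed.

Lemma coarser_nbhs (s t : Topological X) : coarser s t <->
  (forall x (A : set X), nbhs (x : withtop s) A -> nbhs (x : withtop t) A).
Proof.
split=> [st x A|st].
  by rewrite !nbhsE => -[B [Bo Bx] BA]; exists B => //; split => //; exact: st.
by move=> A; rewrite !openE => Ao x /Ao; exact: (st x A).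
Qed.

Lemma same_topology_generated s t G : same_topology s t ->
  generated t G -> generated s G.
Proof.
by move=> /same_topology_nbhs st tG x A; split => [/st /tG|/tG /st].
Qed.

Lemma generated_same s t G : generated s G -> generated t G ->
  same_topology s t.
Proof.
move=> sG tG; apply/same_topology_nbhs => x A.
by split=> ?; [apply/(tG x A).2/(sG x A).1|apply/(sG x A).2/(tG x A).1].
Qed.

End seminorm_theory.

Section generated_theory.
Variables (R : realType) (X : lmodType R[i]).
Variables (t : Topological X) (G : set (X -> R)).
Hypothesis GS : forall q, G q -> is_seminorm q.
Hypothesis tG : generated t G.
Implicit Types (p q : X -> R) (x y : X).

Lemma nbhs_seminorm_ball q x (r : R) : G q -> 0 < r ->
  nbhs (x : withtop t) [set y | q (y - x) < r].
Proof. by move=> Gq r0; apply/tG; exists q, r. Qed.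

Lemma generated_cvg (F : set_system X) x : Filter F ->
  (forall q r, G q -> 0 < r -> F [set y | q (y - x) < r]) ->
  F --> (x : withtop t).
Proof.
move=> FF Fx A /tG [q [r [Gq r0 qA]]].
by apply: filterS (Fx q r Gq r0) => y; exact: qA.
Qed.

Lemma generated_linear : linear_topology t.
Proof.
split=> [[x y] A /= /tG [q [r [Gq r0 qA]]]|[a x] A /= /tG [q [r [Gq r0 qA]]]].
  have r2 : 0 < r / 2 by rewrite divr_gt0.
  exists ([set z | q (z - x) < r / 2], [set z | q (z - y) < r / 2]).
    by split; exact: nbhs_seminorm_ball.
  move=> [z w] [/= zx wy]; apply: qA; rewrite opprD addrACA.
  apply: le_lt_trans (_ : q (z - x) + q (w - y) < r).
    by case: (GS Gq).
  by rewrite [r]splitr ltrD.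
have [q0 qD qZ] := GS Gq.
(* The constants fit [b *: z - a *: x = b *: (z - x) + (b - a) *: x]: the [1] in [d] keeps [|b|]
   below [a1], and the other entry of [d] bounds the second term by [r / 2]. *)
pose a1 := rnorm (a : R[i]^o) + 1.
have a10 : 0 < a1 by rewrite ltr_wpDl// rnorm_ge0.
pose d := Num.min 1 (r / 2 / (q x + 1)).
have qx1 : 0 < q x + 1 by rewrite ltr_wpDl.
have d0 : 0 < d by rewrite lt_min ltr01/= !divr_gt0.
exists ([set b : R[i]^o | rnorm (b - a) < d], [set z | q (z - x) < r / 2 / a1]).
  split; last by apply: nbhs_seminorm_ball; rewrite ?divr_gt0.
  by apply/nbhs_rnormP; exists d.
move=> [b z] [/= ba zx]; apply: qA.
have -> : b *: z - a *: x = b *: (z - x) + (b - a) *: x.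
  by rewrite scalerBr scalerBl subrKA.
apply: (le_lt_trans (qD _ _)); rewrite !qZ [r]splitr.
have bn : complex.Re `|b| <= a1.
  rewrite -[b](subrK a) (le_trans (@rnormD R R[i]^o _ _))// /a1 addrC lerD2l.
  by rewrite (le_trans (ltW ba))// /d ge_min lexx.
apply: ltr_leD.
  apply: (@le_lt_trans _ _ (a1 * q (z - x))); first exact: ler_wpM2r.
  by rewrite mulrC -ltr_pdivlMr.
apply: (@le_trans _ _ (d * q x)); first by apply: ler_wpM2r => //; exact: ltW.
apply: (@le_trans _ _ (r / 2 / (q x + 1) * (q x + 1))).
  by apply: ler_pM => //; rewrite ?(ltW d0)// ?ge_min ?lexx ?orbT// lerDl.
by rewrite divfK// gt_eqF.
Qed.

Lemma lmod_convE (k : {i01 R[i]}) x y :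
  conv k (x : convex_lmodType X) y = k%:num *: x + (1 - k%:num) *: y.
Proof. by []. Qed.

Lemma seminorm_ball_convex q x (r : R) : is_seminorm q ->
  convex_set ([set y | q (y - x) < r] : set (convex_lmodType X)).
Proof.
move=> [q0 qD qZ]; apply/convex_setW => y z /set_mem /= yx /set_mem /= zx k k0 k1.
apply/mem_set; rewrite /=.
rewrite lmod_convE.
have -> : k%:num *: y + (1 - k%:num) *: z - x =
    k%:num *: (y - x) + (1 - k%:num) *: (z - x).
  by rewrite !scalerBr addrACA -opprD -scalerDl subrKC scale1r.
apply: (le_lt_trans (qD _ _)); rewrite !qZ.
have kE : (complex.Re k%:num)%:C = k%:num by rewrite RRe_real// gtr0_real.
move: k0 k1; rewrite -kE !ltcR => k0 k1.
rewrite -(rmorph1 (real_complex R)) -rmorphB !Re_normC.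
rewrite !gtr0_norm ?subr_gt0//.
by nra.
Qed.

Lemma generated_locally_convex : locally_convex_topology t.
Proof.
exists [set B | exists q x r, [/\ G q, 0 < r & B = [set y | q (y - x) < r]]].
  by move=> _ [q [x [r [Gq r0 ->]]]]; apply: seminorm_ball_convex; exact: GS.
split=> [_ [q [x [r [Gq r0 ->]]]]|x A /tG [q [r [Gq r0 qA]]]].
  rewrite openE => y /= yx; apply/tG; exists q, (r - q (y - x)); split => //.
    by rewrite subr_gt0.
  move=> z zy; apply: (le_lt_trans (seminorm_tri y _ _ (GS Gq))).
  by rewrite -ltrBrDr.
exists [set y | q (y - x) < r]; last exact: qA.
by split; [exists q, x, r|rewrite /= subrr seminorm0//; exact: GS].
Qed.

Lemma generated_hausdorff :
  (forall x, x != 0 -> exists2 q, G q & 0 < q x) -> hausdorff_space (withtop t).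
Proof.
move=> Gsep x y xy; apply: (@subr0_eq X).
apply: contrapT => /eqP/Gsep[q Gq qxy].
have r0 : 0 < q (x - y) / 2 by rewrite divr_gt0.
have [z [/= zx zy]] := xy _ _ (nbhs_seminorm_ball x Gq r0) (nbhs_seminorm_ball y Gq r0).
have := seminorm_tri z x y (GS Gq); rewrite (@seminormBC _ _ q x z); last exact: GS.
by move=> H; have := le_lt_trans H (ltrD zx zy); rewrite -splitr ltxx.
Qed.

End generated_theory.

Definition rconvex (R : realType) (X : lmodType R[i]) (U : set X) :=
  forall x y (s : R), 0 <= s <= 1 -> U x -> U y ->
    U (s%:C *: x + (1 - s)%:C *: y).

Lemma convex_set_rconvex (R : realType) (X : lmodType R[i]) (U : set X) :
  convex_set (U : set (convex_lmodType X)) -> rconvex U.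
Proof.
move=> cU x y s /andP[s0 s1] Ux Uy.
have sC0 : 0 <= s%:C by rewrite lecR.
have sC1 : s%:C <= 1 :> R[i] by rewrite lecR.
have := cU x y (Itv01 sC0 sC1) (mem_set Ux) (mem_set Uy).
by rewrite lmod_convE /= => /set_mem; rewrite rmorphB.
Qed.

(** * Gauges of convex sets *)

Section gauge.
Variables (R : realType) (X : lmodType R[i]) (U : set X).
Hypothesis cU : rconvex U.

(** The gauge of [U] itself is in general not homogeneous for complex scalars. The largest balanced
    subset of [U] is convex when [U] is, and its gauge is a seminorm. *)
Definition balanced_core : set X :=
  [set x | forall c : R[i], complex.Re `|c| <= 1 -> U (c *: x)].

Definition gauge (x : X) : R :=
  inf [set s | 0 < s /\ balanced_core (s^-1%:C *: x)].

Hypothesis absU : forall x, exists2 s : R, 0 < s & balanced_core (s^-1%:C *: x).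

Lemma balanced_coreZ x (c : R[i]) : complex.Re `|c| <= 1 ->
  balanced_core x -> balanced_core (c *: x).
Proof.
move=> c1 Ux d d1; rewrite scalerA; apply: Ux.
have := rnormZ d (c : R[i]^o); rewrite /rnorm /= => ->.
by rewrite mulr_ile1 ?(rnorm_ge0 (_ : R[i]^o)).
Qed.

Lemma balanced_core_convex : rconvex balanced_core.
Proof.
move=> x y s s01 Ux Uy c c1; rewrite scalerDr !scalerA ![c * _]mulrC -!scalerA.
by apply: cU; [|exact: Ux|exact: Uy].
Qed.

Lemma gauge_le x (s : R) : 0 < s -> balanced_core (s^-1%:C *: x) -> gauge x <= s.
Proof. by move=> s0 Us; apply: ge_inf => //; exists 0 => a [/ltW]. Qed.

Lemma gauge_ge0 x : 0 <= gauge x.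
Proof.
apply: lb_le_inf => [|a [/ltW]//].
by have [s s0 Us] := absU x; exists s.
Qed.

Lemma gauge_lt x (s : R) : gauge x < s -> 0 < s /\ balanced_core (s^-1%:C *: x).
Proof.
move=> xs; have s0 : 0 < s := le_lt_trans (gauge_ge0 x) xs.
split=> //; have [|a [a0 Ua] as_] := inf_lt _ xs.
  by have [b b0 Ub] := absU x; exists b.
have -> : s^-1%:C *: x = (s^-1 * a)%:C *: (a^-1%:C *: x).
  by rewrite scalerA -rmorphM mulfK// gt_eqF.
apply: balanced_coreZ => //.
by rewrite Re_normC ger0_norm ?mulr_ge0 ?invr_ge0 ?ltW// mulrC ltr_pdivrMr// mul1r.
Qed.

Lemma gauge_seminorm : is_seminorm gauge.
Proof.
have gD x y : gauge (x + y) <= gauge x + gauge y.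
  have H a b : gauge x < a -> gauge y < b -> gauge (x + y) <= a + b.
    move=> /gauge_lt[a0 Ua] /gauge_lt[b0 Ub].
    apply: gauge_le; first exact: addr_gt0.
    have -> : (a + b)^-1%:C *: (x + y) = (a / (a + b))%:C *: (a^-1%:C *: x) +
        (1 - a / (a + b))%:C *: (b^-1%:C *: y).
      have ab : a + b != 0 by rewrite gt_eqF// addr_gt0.
      have -> : 1 - a / (a + b) = b / (a + b).
        by rewrite -[X in X - _](divff ab) -mulrBl addrAC subrr add0r.
      rewrite scalerDr !scalerA -!rmorphM ![_ / (a + b)]mulrC.
      by rewrite !mulfK// gt_eqF.
    apply: balanced_core_convex => //; apply/andP; split.
      by rewrite divr_ge0// ltW// addr_gt0.
    by rewrite ler_pdivrMr ?addr_gt0// mul1r lerDl ltW.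
  rewrite leNgt; apply/negP => lt.
  pose d := (gauge (x + y) - gauge x - gauge y) / 3.
  have := H (gauge x + d) (gauge y + d); rewrite /d; lra.
have gZ (c : R[i]) x : gauge (c *: x) <= complex.Re `|c| * gauge x.
  have [->|c0] := eqVneq c 0.
    rewrite scale0r normr0 mul0r leNgt; apply/negP => g0.
    have : gauge 0 <= gauge 0 / 2; last by lra.
    apply: gauge_le; first by rewrite divr_gt0.
    by have [s _ Us] := absU 0; move: Us; rewrite !scaler0.
  have nc0 : 0 < complex.Re `|c|.
    exact: (@rnorm_gt0 _ R[i]^o).
  suff H a : gauge x < a -> gauge (c *: x) <= complex.Re `|c| * a.
    rewrite -ler_pdivrMl// leNgt; apply/negP => lt.
    have [b /andP[xb bc]] : exists b, gauge x < b < (complex.Re `|c|)^-1 * gauge (c *: x).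
      by exists ((gauge x + (complex.Re `|c|)^-1 * gauge (c *: x)) / 2); rewrite !midf_lt.
    by have := H b xb; rewrite -ler_pdivrMl// leNgt bc.
  move=> /gauge_lt[a0 Ua]; apply: gauge_le; first exact: mulr_gt0.
  have -> : (complex.Re `|c| * a)^-1%:C *: (c *: x) = (c / `|c|) *: (a^-1%:C *: x).
    rewrite -(@rnormE _ R[i]^o c) /rnorm /=; move: (Normc.normc c) => n.
    rewrite !scalerA invfM rmorphM fmorphV/=.
    by congr (_ *: _); rewrite mulrAC [_^-1 * c]mulrC.
  by apply: balanced_coreZ => //; rewrite normf_div normr_id divff ?normr_eq0.
exact: is_seminorm_le gauge_ge0 gD gZ.
Qed.

Lemma gauge_lt1 x : gauge x < 1 -> U x.
Proof. by move=> /gauge_lt[_ /(_ 1)]; rewrite normr1 invr1 !scale1r; apply. Qed.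

End gauge.

Section linear_topology_theory.
Variables (R : realType) (X : lmodType R[i]) (s : Topological X).
Hypothesis sL : linear_topology s.

Lemma linear_nbhs_shift x (A : set X) :
  nbhs (x : withtop s) A <-> nbhs ((0 : X) : withtop s) [set y | A (x + y)].
Proof.
suff H u v (B : set X) : nbhs ((u + v : X) : withtop s) B ->
    nbhs (v : withtop s) [set y | B (u + y)].
  split=> nA; first by apply: H; rewrite addr0.
  have := H (- x) x [set y | A (x + y)]; rewrite addNr => /(_ nA).
  by apply: filterS => y /=; rewrite addNKr.
move=> /(sL.1 (u, v)) [[P Q] /= [Pu Qv] PQB].
apply: filterS Qv => y Qy; apply: (PQB (u, y)); split => //=.
exact: (@nbhs_singleton (withtop s)) Pu.
Qed.

Lemma linear_nbhs_half (A : set X) : nbhs ((0 : X) : withtop s) A ->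
  exists2 B : set X, nbhs ((0 : X) : withtop s) B &
    forall x y, B x -> B y -> A (x + y).
Proof.
move=> nA; have : nbhs ((0 + 0 : X) : withtop s) A by rewrite addr0.
move=> /(sL.1 (0, 0)) [[P Q] /= [P0 Q0] PQA].
by exists (P `&` Q); [exact: filterI|move=> x y [Px _] [_ Qy]; exact: (PQA (x, y))].
Qed.

End linear_topology_theory.

Lemma linear_same_topology (R : realType) (X : lmodType R[i])
    (s t : Topological X) : linear_topology s -> linear_topology t ->
  (forall A : set X, nbhs ((0 : X) : withtop s) A <-> nbhs ((0 : X) : withtop t) A) ->
  same_topology s t.
Proof.
move=> sL tL st; apply/same_topology_nbhs => x A; split.
  by move=> /(linear_nbhs_shift sL x A).1/st/(linear_nbhs_shift tL x A).2.
by move=> /(linear_nbhs_shift tL x A).1/st/(linear_nbhs_shift sL x A).2.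
Qed.

(** * The mixed topology *)

Section mixed_theory.
Variables (R : realType) (X : lmodType R[i]) (nrm : X -> R).
Variables (t : Topological X) (G : set (X -> R)).
Hypothesis nrmS : is_seminorm nrm.
Hypothesis GS : forall q, G q -> is_seminorm q.
Hypothesis Gdir : directed_seminorms G.
Hypothesis tG : generated t G.
Hypothesis Gle : forall q x, G q -> q x <= nrm x.
Implicit Types (p q : X -> R) (x y : X).

Local Notation gam := (mixed_topology nrm t).

Lemma norm_topology_generated : generated (norm_topology nrm) [set nrm].
Proof.
apply: seminorm_topology_generated => [q ->//|]; split; first by exists nrm.
by move=> p q -> ->; exists nrm.
Qed.

Lemma generated_coarser_norm : coarser t (norm_topology nrm).
Proof.
apply/coarser_nbhs => x A /tG [q [r [Gq r0 qA]]].
apply/norm_topology_generated; exists nrm, r; split => // y yx; apply: qA.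
exact: le_lt_trans (Gle _ Gq) yx.
Qed.

Lemma mixed_is_candidate : mixed_candidate nrm t gam.
Proof.
exact: (mixed_topologyP (generated_linear GS tG) generated_coarser_norm).1.
Qed.

Lemma mixed_linear : linear_topology gam.
Proof. by case: mixed_is_candidate. Qed.

Lemma mixed_finest s : mixed_candidate nrm t s -> coarser s gam.
Proof.
exact: (mixed_topologyP (generated_linear GS tG) generated_coarser_norm).2.
Qed.

Lemma coarser_mixed : coarser t gam.
Proof. by case: mixed_is_candidate. Qed.

(* The seminorms that are [t]-small on every ball generate a candidate, so
   their balls are neighbourhoods for the mixed topology. *)
Let small_on_balls p := is_seminorm p /\ forall (n : nat) (e : R), 0 < e ->
  exists q r, [/\ G q, 0 < r & forall x, nrm x <= n%:R -> q x < r -> p x < e].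

Let small_generated : generated (seminorm_topology small_on_balls) small_on_balls.
Proof.
have [[q0 Gq0] Gdir2] := Gdir.
apply: seminorm_topology_generated => [q []//|]; split.
  exists q0; split; [exact: GS|move=> n e e0].
  by exists q0, e; split.
move=> p q [[p0 pD pZ] pb] [[q0' qD qZ] qb]; exists (fun x => p x + q x); split.
- split; first split.
  + by move=> x; rewrite addr_ge0.
  + by move=> x y; rewrite addrACA lerD.
  + by move=> a x; rewrite pZ qZ mulrDr.
  move=> n e e0; have e2 : 0 < e / 2 by rewrite divr_gt0.
  have [u [r [Gu r0 ur]]] := pb n _ e2.
  have [w [r' [Gw r0' wr]]] := qb n _ e2.
  have [m [Gm um wm]] := Gdir2 _ _ Gu Gw.
  exists m, (Num.min r r'); split => //; first by rewrite lt_min r0.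
  move=> x xn; rewrite lt_min => /andP[mr mr']; rewrite [e]splitr ltrD//.
    by apply: ur => //; exact: le_lt_trans mr.
  by apply: wr => //; exact: le_lt_trans mr'.
- by move=> x; rewrite lerDl.
- by move=> x; rewrite lerDr.
Qed.

Let small_candidate : mixed_candidate nrm t (seminorm_topology small_on_balls).
Proof.
have t_small : coarser t (seminorm_topology small_on_balls).
  apply/coarser_nbhs => x A /tG [q [r [Gq r0 qA]]].
  apply/small_generated; exists q, r; split => //; split; first exact: GS.
  by move=> n e e0; exists q, e; split.
split => //.
- by apply: generated_linear small_generated => q [].
- move=> B [M BM]; apply/seteqP; split=> [_ [U Uo <-]|_ [U Uo <-]]; last first.
    by exists U => //; exact: t_small.
  pose W : set (withtop t) := [set y | B y -> U y].
  exists (interior W); first exact: open_interior.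
  apply/seteqP; split=> x [xU Bx]; split => //.
    exact: (interior_subset xU).
  move: Uo; rewrite openE => /(_ x xU) /small_generated [p [r [[ps pb] r0 pU]]].
  (* Differences of two points of [B] have norm at most [M + M], so smallness of [p] is needed on
     that ball only. *)
  have [n Mn] : exists n : nat, M + M <= n%:R.
    by exists (Num.truncn `|M + M|).+1; rewrite (le_trans (ler_norm _))// ltW// truncnS_gt.
  have [q [d [Gq d0 qd]]] := pb n r r0.
  apply/tG; exists q, d; split => // y yx By; apply: pU; apply: qd => //.
  apply: le_trans Mn; rewrite (le_trans (seminormB _ _ nrmS))// lerD//.
    by apply: BM; exists y.
  by apply: BM; exists x.
- apply/coarser_nbhs => x A /small_generated [p [r [[ps pb] r0 pA]]].
  have [q [d [Gq d0 qd]]] := pb 1%N r r0.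
  apply/norm_topology_generated; exists nrm, (Num.min 1 d); split => //.
    by rewrite lt_min ltr01.
  move=> y; rewrite lt_min => /andP[y1 yd]; apply: pA; apply: qd.
    exact: ltW.
  exact: le_lt_trans (Gle _ Gq) yd.
Qed.

Lemma mixed_nbhs0 (U : set X) : rconvex U ->
  (forall n : nat, exists q r,
    [/\ G q, 0 < r & forall x, nrm x <= n%:R -> q x < r -> U x]) ->
  nbhs ((0 : X) : withtop gam) U.
Proof.
move=> cU Ub.
(* Balls of [nrm] and [q] are balanced, so the hypothesis on [U] passes to its balanced core. *)
have core n q r : G q -> (forall x, nrm x <= n%:R -> q x < r -> U x) ->
    forall x, nrm x <= n%:R -> q x < r -> balanced_core U x.
  move=> Gq qU x xn xr c c1; have [q0 _ qZ] := GS Gq; have [n0 _ nZ] := nrmS.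
  by apply: qU; rewrite ?qZ ?nZ; [apply: le_trans xn|apply: le_lt_trans xr];
    rewrite ler_piMl.
have absU x : exists2 s : R, 0 < s & balanced_core U (s^-1%:C *: x).
  have [q [r [Gq r0 qU]]] := Ub 1%N; have [q0 _ _] := GS Gq; have [n0 _ _] := nrmS.
  (* Chosen so that [x] divided by [s] has norm at most [1] and [q]-value below [r]. *)
  pose s := nrm x + q x / r + 1.
  have s0 : 0 < s by rewrite ltr_wpDl// addr_ge0// divr_ge0// ltW.
  have qr0 : 0 <= q x / r by rewrite divr_ge0// ltW.
  exists s => //; apply: (core _ _ _ Gq qU).
    rewrite seminormZR// ger0_norm ?invr_ge0 ?(ltW s0)// ler_pdivrMl// mulr1.
    by rewrite /s -addrA lerDl addr_ge0.
  rewrite seminormZR ?ger0_norm ?invr_ge0 ?(ltW s0)//; last exact: GS.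
  rewrite ltr_pdivrMl//.
  rewrite -ltr_pdivrMr// /s -addrA addrCA ltr_pwDr ?ltxx//.
  by rewrite ltr_wpDl.
have gs := gauge_seminorm cU absU.
have gsm : small_on_balls (gauge U).
  split=> // n e e0; have e2 : 0 < e / 2 by rewrite divr_gt0.
  (* For [gauge U x <= e / 2] it suffices that [x] scaled by [2 / e] lies in the core; this scaling
     maps the ball of radius [n] into that of radius [N]. *)
  have [N nN] : exists N : nat, n%:R / (e / 2) <= N%:R.
    exists (Num.truncn (n%:R / (e / 2))).+1.
    by rewrite ltW// truncnS_gt.
  have [q [r [Gq r0 qU]]] := Ub N.
  exists q, (r * (e / 2)); split; [by []|exact: mulr_gt0|move=> x xn xr].
  apply: (@le_lt_trans _ _ (e / 2)); last by rewrite ltr_pdivrMr// mulr_natr mulr2n ltrDl.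
  apply: gauge_le => //; apply: (core _ _ _ Gq qU).
    rewrite seminormZR// ger0_norm ?invr_ge0 ?(ltW e2)// mulrC.
    by apply: le_trans nN; rewrite ler_pM2r// invr_gt0.
  rewrite seminormZR ?ger0_norm ?invr_ge0 ?(ltW e2)//; last exact: GS.
  by rewrite ltr_pdivrMl// mulrC.
move/mixed_finest/coarser_nbhs: small_candidate; apply.
apply/small_generated; exists (gauge U), 1; split => // x.
by rewrite subr0; exact: gauge_lt1.
Qed.

Lemma bounded_mixed_cvg (F : set_system X) x (M : R) : Filter F ->
  F [set y | nrm y <= M] -> nrm x <= M ->
  F --> (x : withtop t) -> F --> (x : withtop gam).
Proof.
move=> FF FM xM Fx A; rewrite nbhsE => -[U [Uo Ux] UA].
have [_ /(_ [set y | nrm y <= M]) agr _ _] := mixed_is_candidate.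
have : [set V `&` [set y | nrm y <= M] | V in @open (withtop gam)]
    (U `&` [set y | nrm y <= M]) by exists U.
rewrite agr; last by exists M => _ [y yM <-].
move=> [V Vo VU]; have Vx : V x.
  by have [] : (V `&` [set y | nrm y <= M]) x by rewrite VU.
have FV : F V by apply: Fx; exact: open_nbhs_nbhs.
apply: filterS (filterI FV FM) => y Vy; apply: UA.
by have [] : (U `&` [set y | nrm y <= M]) y by rewrite -VU.
Qed.

End mixed_theory.

(** * Saks spaces and weighted suprema *)

Definition weighted_sup (R : realType) (T : Type) (q : nat -> T -> R)
  (a : nat -> R) (x : T) : R := sup [set q n x * a n | n in [set: nat]].

Section saks_theory.
Variables (R : realType) (X : lmodType R[i]) (nrm : X -> R).
Variables (t : Topological X) (G : set (X -> R)).
Hypothesis nrmN : is_norm nrm.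
Hypothesis saksG : saks_system nrm t G.
Implicit Types (p q : X -> R) (x y : X).

Local Notation gam := (mixed_topology nrm t).

Let nrmS : is_seminorm nrm. Proof. by case: nrmN. Qed.

Lemma saks_seminorm q : G q -> is_seminorm q.
Proof. by case: saksG => GS _ _ _ /GS[]. Qed.

Lemma saks_directed : directed_seminorms G.
Proof. by case: saksG. Qed.

Lemma saks_generated : generated t G.
Proof.
case: saksG => _ _ tE _; apply: same_topology_generated tE _.
exact: seminorm_topology_generated saks_seminorm saks_directed.
Qed.

Lemma saks_le q x : G q -> q x <= nrm x.
Proof.
case: saksG => _ _ _ /(_ x) nE Gq; rewrite -lee_fin nE.
by apply: ereal_sup_ubound; exists q.
Qed.

Lemma saks_sup x (c : R) : c < nrm x -> exists2 q, G q & c < q x.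
Proof.
case: saksG => _ _ _ /(_ x) nE; rewrite -lte_fin nE => /ereal_sup_gt[_ [q Gq <-]].
by rewrite lte_fin; exists q.
Qed.

Let GS := saks_seminorm.
Let Gdir := saks_directed.
Let tG := saks_generated.
Let Gle := saks_le.

Lemma saks_system_space : saks_space nrm t.
Proof.
split; [exact: nrmN| |exact: generated_coarser_norm nrmS tG Gle|by exists G].
split; [exact: generated_linear GS tG|exact: generated_locally_convex GS tG|].
apply: (generated_hausdorff GS tG) => x x0.
have [_ n0] := nrmN; apply: saks_sup; have [n_ge0 _ _] := nrmS.
rewrite lt_neqAle n_ge0 andbT eq_sym.
by apply: contra x0 => /eqP/n0 ->.
Qed.

Let gamL : linear_topology gam := mixed_linear nrmS GS tG Gle.

Lemma saks_mixed_nbhs (x : X) (A : set X) :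
  nbhs (x : withtop t) A -> nbhs (x : withtop gam) A.
Proof. by have /coarser_nbhs := coarser_mixed nrmS GS tG Gle; apply. Qed.

(** The norm is a supremum of [t]-continuous seminorms, hence lower semicontinuous for [t]. *)
Lemma saks_ball_closed (M : R) : closed ([set x | nrm x <= M] : set (withtop t)).
Proof.
move=> x clx /=; rewrite leNgt; apply/negP => /saks_sup[q Gq qx].
have qM0 : 0 < q x - M by rewrite subr_gt0.
have [y [/= yM yx]] := clx _ (nbhs_seminorm_ball tG x Gq qM0).
have := seminorm_tri y x 0 (GS Gq); rewrite !subr0 seminormBC//; last exact: GS.
by have := le_trans (Gle y Gq) yM; move: yx; lra.
Qed.

Section weighted_sup.
Variables (q : nat -> X -> R) (a : nat -> R).
Hypothesis qS : forall n, is_seminorm (q n).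
Hypothesis qle : forall n x, q n x <= nrm x.
Hypothesis a_ge0 : forall n, 0 <= a n.
Hypothesis a_cvg0 : a @ \oo --> (0 : R).

Local Notation p := (weighted_sup q a).

Let a_bounded : exists2 A, 0 <= A & forall n, a n <= A.
Proof.
have /cvg_seq_bounded[A [_ HA]] : cvgn a by apply/cvg_ex; exists 0.
exists (`|A| + 1) => [|n]; first by rewrite addr_ge0.
apply: le_trans (ler_norm _) _; apply: HA => //.
by rewrite ltr_pwDr// ler_norm.
Qed.

Let p_has_sup x : has_sup [set q n x * a n | n in [set: nat]].
Proof.
split; first by exists (q 0 x * a 0); exists 0%N.
have [A A0 aA] := a_bounded; exists (nrm x * A) => _ [n _ <-].
by have [q0 _ _] := qS n; apply: ler_pM.
Qed.

Lemma weighted_sup_ge n x : q n x * a n <= p x.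
Proof. by apply: ub_le_sup; [have [] := p_has_sup x|exists n]. Qed.

Lemma weighted_sup_le x (c : R) : (forall n, q n x * a n <= c) -> p x <= c.
Proof.
move=> qc; apply: ge_sup; first by have [] := p_has_sup x.
by move=> _ [n _ <-].
Qed.

Lemma weighted_sup_seminorm : is_seminorm p.
Proof.
have p0 x : 0 <= p x.
  by apply: le_trans (weighted_sup_ge 0 x); rewrite mulr_ge0//; case: (qS 0).
have pZ (c : R[i]) x : p (c *: x) <= complex.Re `|c| * p x.
  apply: weighted_sup_le => n; have [_ _ ->] := qS n.
  by rewrite -mulrA ler_wpM2l ?weighted_sup_ge// (@rnorm_ge0 _ R[i]^o).
apply: is_seminorm_le p0 _ pZ => x y.
apply: weighted_sup_le => n; have [_ qD _] := qS n.
apply: (@le_trans _ _ ((q n x + q n y) * a n)); first exact: ler_wpM2r.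
by rewrite mulrDl lerD ?weighted_sup_ge.
Qed.

(** On a ball the null sequence makes all but finitely many terms small, and the remaining ones are
    [t]-continuous. The [q n] are not taken from [G], so that the lemma also serves for the
    seminorms of a coarser topology. *)
Lemma weighted_sup_nbhs (e : R) :
  (forall n (d : R), 0 < d -> nbhs ((0 : X) : withtop t) [set x | q n x < d]) ->
  0 < e -> nbhs ((0 : X) : withtop gam) [set x | p x < e].
Proof.
move=> qt e0; apply: (mixed_nbhs0 nrmS GS Gdir tG Gle).
  move=> x y s /andP[s0 s1] /= px py; have pS := weighted_sup_seminorm.
  have [_ pD _] := pS; apply: (le_lt_trans (pD _ _)).
  rewrite !seminormZR// !ger0_norm ?subr_ge0//.
  exact: convex_lt.
move=> M; have [A A0 aA] := a_bounded.
have e2 : 0 < e / 2 by rewrite divr_gt0.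
have M1 : 0 < M%:R + 1 :> R by rewrite ltr_wpDl.
have A1 : 0 < A + 1 by rewrite ltr_wpDl.
have [N _ aN] : \forall n \near \oo, a n < e / 2 / (M%:R + 1).
  by apply: (@cvgr_lt _ _ _ _ _ 0) => //; rewrite divr_gt0.
have d0 : 0 < e / 2 / (A + 1) by rewrite divr_gt0.
have : nbhs ((0 : X) : withtop t)
    [set x | forall n, (n < N)%N -> q n x < e / 2 / (A + 1)].
  elim: N {aN} => [|N IH]; first by apply: filterS filterT => x _ n.
  apply: filterS (filterI IH (qt N _ d0)) => x [xN Nx] n.
  by rewrite ltnS leq_eqVlt => /predU1P[->|/xN].
move=> /tG [u [r [Gu r0 ur]]]; exists u, r; split => // x xM xr.
apply: (@le_lt_trans _ _ (e / 2)); last by rewrite ltr_pdivrMr// mulr_natr mulr2n ltrDl.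
apply: weighted_sup_le => n; have [q0 _ _] := qS n.
have [nN|Nn] := ltnP n N.
  have /ltW qd : q n x < e / 2 / (A + 1) by apply: ur => //; rewrite subr0.
  apply: (@le_trans _ _ (e / 2 / (A + 1) * (A + 1))).
    by rewrite ler_pM// (le_trans (aA n))// lerDl.
  by rewrite divfK// gt_eqF.
have /ltW ad := aN _ Nn.
apply: (@le_trans _ _ ((M%:R + 1) * (e / 2 / (M%:R + 1)))).
  by rewrite ler_pM// (le_trans (qle n x))// (le_trans xM)// lerDl.
by rewrite mulrC divfK// gt_eqF.
Qed.

End weighted_sup.

Let G_nbhs0 q (d : R) : G q -> 0 < d -> nbhs ((0 : X) : withtop t) [set x | q x < d].
Proof.
move=> Gq d0; apply: filterS (nbhs_seminorm_ball tG 0 Gq d0) => x /=.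
by rewrite subr0.
Qed.

(* Unboundedness in norm is detected by the weighted supremum of seminorms
   almost attaining the norm along a fast growing sequence. *)
Lemma saks_mixed_bounded (B : set X) : vn_bounded gam B ->
  exists M : R, forall x, B x -> nrm x <= M.
Proof.
move=> Bb; apply: contrapT => /forallNP unb.
(* One factor [n.+1] pays for the weight [n.+1^-1], the other for the absorbing radius [r < n.+1],
   where [n] is the integer part of [r]. *)
have /choice[w wP] : forall n, exists w : X * (X -> R),
    [/\ B w.1, G w.2 & n.+1%:R ^+ 2 < w.2 w.1].
  move=> n; have := unb (n.+1%:R ^+ 2); move=> /existsNP[x /not_implyP[Bx]].
  by move=> /negP; rewrite -ltNge => /saks_sup[q Gq qx]; exists (x, q).
pose q n := (w n).2; have Gq n : G (q n) by have [] := wP n.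
have qS n : is_seminorm (q n) := GS (Gq n).
have qle n x : q n x <= nrm x := Gle x (Gq n).
have a0 (n : nat) : 0 <= n.+1%:R^-1 :> R by rewrite invr_ge0.
have qt n d : 0 < d -> nbhs ((0 : X) : withtop t) [set x | q n x < d].
  exact: G_nbhs0.
have := weighted_sup_nbhs qS qle a0 (@cvg_harmonic R) qt ltr01.
move=> /Bb[r r0 /(_ r%:C)].
have -> : `|r%:C| = r%:C :> R[i] by rewrite ger0_norm// lecR ltW.
move=> /(_ (lexx _)) Br.
have [Bw _ qw] := wP (Num.truncn r); have [y /= yp yE] := Br _ Bw.
move: qw; rewrite -yE -/(q _) seminormZR// gtr0_norm//.
have := weighted_sup_ge qS qle a0 (@cvg_harmonic R) (Num.truncn r) y.
rewrite ler_pdivrMr// => qy; have := truncnS_gt r; set N := _.+1%:R => rN.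
have N0 : 0 < N by rewrite ltr0n.
have [p0 _ _] := qS (Num.truncn r); have := p0 y.
move: qy yp; set P := weighted_sup _ _ _; set Q := q _ _ => QP P1 Q0.
have QN : Q <= N by apply: le_trans QP _; rewrite ler_piMl// ltW.
by rewrite expr2 ltNge => /negP; apply; apply: ler_pM => //; exact: ltW.
Qed.

(** The cofinal sequence [k] makes [t] first countable. A convex sequentially open set that fails
    the criterion of [mixed_nbhs0] on some ball yields a sequence in that ball that tends to [0] for
    [t], hence for the mixed topology, while its translate by [x] avoids the set. *)
Lemma saks_C_sequential (k : nat -> X -> R) : (forall n, G (k n)) ->
  (forall q, G q -> exists N : nat, forall n, (N <= n)%N -> forall x, q x <= k n x) ->
  C_sequential gam.
Proof.
move=> Gk kcof U /convex_set_rconvex cU sU; rewrite openE => x Ux.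
apply/(linear_nbhs_shift gamL); apply: (mixed_nbhs0 nrmS GS Gdir tG Gle).
  move=> y z s s01 /= Uy Uz.
  have -> : x + (s%:C *: y + (1 - s)%:C *: z) =
      s%:C *: (x + y) + (1 - s)%:C *: (x + z).
    by rewrite !scalerDr addrACA -scalerDl -rmorphD subrKC scale1r.
  exact: cU.
move=> M; apply: contrapT => /forallNP nU.
have /choice[y yP] n : exists y,
    [/\ nrm y <= M%:R, k n y < n.+1%:R^-1 & ~ U (x + y)].
  have i0 : 0 < n.+1%:R^-1 :> R by rewrite invr_gt0 ltr0n.
  have /forallNP /(_ (n.+1%:R^-1)) := nU (k n).
  move=> /not_and3P[/(_ (Gk n))//|/(_ i0)//|].
  by move=> /existsNP[y /not_implyP[yM /not_implyP[ky nUy]]]; exists y.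
have yt : y @ \oo --> ((0 : X) : withtop t).
  apply: (generated_cvg tG) => q r Gq r0; have [N kN] := kcof q Gq.
  have [K _ Kr] : \forall n \near \oo, n.+1%:R^-1 < r :> R.
    by apply: (@cvgr_lt _ _ _ _ _ 0) => //; exact: cvg_harmonic.
  exists (maxn N K) => // n /=; rewrite geq_max subr0 => /andP[Nn Kn].
  have [_ ky _] := yP n; apply: le_lt_trans (kN n Nn _) _.
  exact: lt_trans ky (Kr n Kn).
have yg : y @ \oo --> ((0 : X) : withtop gam).
  apply: (bounded_mixed_cvg nrmS GS tG Gle (F := y @ \oo) (M := M%:R) _ _ _ yt).
    by exists 0%N => // n _ /=; have [] := yP n.
  by rewrite seminorm0.
have xy : (fun n => x + y n) @ \oo --> (x : withtop gam).
  by move=> A /(linear_nbhs_shift gamL) nA; exact: (yg _ nA).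
have [N _ /(_ N (leqnn N))] := sU _ x Ux xy.
by have [_ _] := yP N.
Qed.

Section compact_balls.
Hypothesis cball : forall M : R, compact ([set x | nrm x <= M] : set (withtop t)).

Lemma compact_ball_mixed (M : R) : compact ([set x | nrm x <= M] : set (withtop gam)).
Proof.
rewrite compact_ultra => F FU FM.
have := @cball M; rewrite compact_ultra => /(_ F FU FM)[x [xM Fx]].
by exists x; split => //; exact: (bounded_mixed_cvg nrmS GS tG Gle _ FM).
Qed.

Lemma saks_semi_montel : semi_montel gam.
Proof.
move=> B /saks_mixed_bounded[M BM].
have sub : closure (B : set (withtop gam)) `<=` [set x | nrm x <= M].
  move=> x clx; apply: saks_ball_closed => A /saks_mixed_nbhs /clx[y [By Ay]].
  by exists y; split => //; exact: BM.
apply: subclosed_compact (compact_ball_mixed (M := M)) sub.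
exact: closed_closure.
Qed.

End compact_balls.

End saks_theory.

(** If no single [O i] covers [K], the sets [K] minus [O i] generate a proper filter on [K], and a
    cluster point of it in [K] lies in no [O i]. *)
Lemma compact_directed (T : topologicalType) (K : set T) (I : Type) (D : set I)
    (O : I -> set T) : compact K -> D !=set0 ->
  (forall i, D i -> open (O i)) ->
  (forall i j, D i -> D j -> exists2 k, D k & O i `|` O j `<=` O k) ->
  (forall x, K x -> exists2 i, D i & O i x) ->
  exists2 i, D i & K `<=` O i.
Proof.
move=> Kc D0 Oo Odir Kcov; apply: contrapT => nK.
have nKO i : D i -> (K `\` O i) !=set0.
  move=> Di; apply/set0P/negP => /eqP /subsets_disjoint KO; apply: nK.
  by exists i => // x Kx; apply: contrapT => nOx; have := KO x; apply.
pose F := filter_from D (fun i => K `\` O i).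
have FF : ProperFilter F.
  apply: filter_from_proper => //; apply: filter_from_filter => // i j Di Dj.
  have [k Dk sub] := Odir i j Di Dj; exists k => // x [Kx nOx].
  by split; split => // Ox; apply: nOx; apply: sub; [left|right].
have FK : F K by have [i Di] := D0; exists i => // x [].
have [x [Kx clx]] := Kc F FF FK.
have [i Di Oix] := Kcov x Kx.
have FKO : F (K `\` O i) by exists i.
by have [y [[_ nOy] Oy]] := clx _ _ FKO (open_nbhs_nbhs (conj (Oo i Di) Oix)).
Qed.

(** * Cauchy filters for the mixed topology *)

Section submixed_theory.
Variables (R : realType) (X : lmodType R[i]) (nrm : X -> R).
Variables (t : Topological X) (G : set (X -> R)).
Hypothesis nrmN : is_norm nrm.
Hypothesis saksG : saks_system nrm t G.
Implicit Types (p q : X -> R) (x y : X).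

Local Notation gam := (mixed_topology nrm t).

Let nrmS : is_seminorm nrm. Proof. by case: nrmN. Qed.
Let GS := saks_seminorm saksG.
Let Gdir := saks_directed saksG.
Let tG := saks_generated saksG.
Let Gle := saks_le saksG.
Let gamL : linear_topology gam := mixed_linear nrmS GS tG Gle.

Lemma mixed_open_ball (U : set X) (M : R) : @open (withtop gam) U ->
  exists2 V : set X, @open (withtop t) V & forall y, nrm y <= M -> V y <-> U y.
Proof.
move=> Uo; have [_ /(_ [set y | nrm y <= M]) agr _ _] :=
  mixed_is_candidate nrmS GS tG Gle.
have : [set V `&` [set y | nrm y <= M] | V in @open (withtop gam)]
    (U `&` [set y | nrm y <= M]) by exists U.
rewrite agr; last by exists M => _ [y yM <-].
move=> [V Vo VU]; exists V => // y yM; split=> [Vy|Uy].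
  by have [] : (U `&` [set y | nrm y <= M]) y by rewrite -VU.
by have [] : (V `&` [set y | nrm y <= M]) y by rewrite VU.
Qed.

Lemma mixed_nbhs_ball (W : set X) (M : R) : 0 <= M ->
  nbhs ((0 : X) : withtop gam) W ->
  exists V : set X, [/\ @open (withtop t) V, V 0 &
    forall y, nrm y <= M -> V y -> W y].
Proof.
move=> M0; rewrite nbhsE => -[U [Uo U0] UW].
have [V Vo VU] := @mixed_open_ball U M Uo; exists V; split => //.
  by apply/VU; rewrite ?seminorm0.
by move=> y yM /(VU y yM); exact: UW.
Qed.

(* The mixed neighbourhood [W 0] contains every [u] that for each [n] is close to
   some [b n] of norm at most [n], because [u] is then the telescoping sum of the
   [b n.+1 - b n]. Unlike membership in [W 0], this property of [u] passes to
   limits for [t]. *)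
Lemma mixed_cauchy_cvg (F : set_system X) x : ProperFilter F ->
  (forall U, nbhs ((0 : X) : withtop gam) U ->
    exists2 A, F A & forall y z : X, A y -> A z -> U (y - z)) ->
  F --> (x : withtop t) -> F --> (x : withtop gam).
Proof.
move=> FF Fc Fx A /(linear_nbhs_shift gamL) nW.
have /choice[h hP] (B : set X) : exists C : set X,
    nbhs ((0 : X) : withtop gam) B -> nbhs ((0 : X) : withtop gam) C /\
    forall y z, C y -> C z -> B (y + z).
  have [/(linear_nbhs_half gamL)[C C0 CB]|nB] := pselect (nbhs ((0 : X) : withtop gam) B).
    by exists C.
  by exists setT.
(* [W n.+1 + W n.+1] lies in [W n], so a finite telescoping sum with terms in [W 1], [W 2] and so on
   ends up in [W 0]. *)
pose W n := iter n h [set y | A (x + y)].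
have W0 n : nbhs ((0 : X) : withtop gam) (W n).
  by elim: n => // n IH; have [] := hP _ IH.
have WD n y z : W n.+1 y -> W n.+1 z -> W n (y + z).
  by have [_] := hP _ (W0 n); apply.
have /choice[qr qrP] n : exists qr : (X -> R) * R, [/\ G qr.1, 0 < qr.2 &
    forall y, nrm y <= n%:R + n%:R -> qr.1 y < qr.2 -> W n y].
  have [|V [Vo V0 VW]] := @mixed_nbhs_ball (W n) (n%:R + n%:R) _ (W0 n).
    by rewrite addr_ge0.
  have /tG[q [r [Gq r0 qV]]] := open_nbhs_nbhs (conj Vo V0).
  exists (q, r); split => // y yn qy; apply: VW => //.
  by apply: qV; rewrite subr0.
pose q n := (qr n).1; pose r n := (qr n).2.
have Gq n : G (q n) by have [] := qrP n.
have r0 n : 0 < r n by have [] := qrP n.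
have qD n y z : q n (y + z) <= q n y + q n z by have [] := GS (Gq n).
(* The second condition, at [n.+1], allows [b n] and [b n.+1] to be compared by the same seminorm
   [q n.+1]. *)
pose V n : set X := [set y | q n y < r n / 4 /\ q n.+1 y < r n.+1 / 4].
have V0 n : nbhs ((0 : X) : withtop t) (V n).
  have d0 m : 0 < r m / 4 by rewrite divr_gt0.
  apply: filterS (filterI (nbhs_seminorm_ball tG 0 (Gq n) (d0 n))
    (nbhs_seminorm_ball tG 0 (Gq n.+1) (d0 n.+1))) => y /=.
  by rewrite subr0.
pose W' := [set y | forall n : nat, exists2 b, nrm b <= n%:R & V n (y - b)].
have nW' : nbhs ((0 : X) : withtop gam) W'.
  apply: (mixed_nbhs0 nrmS GS Gdir tG Gle).
    move=> y z s /andP[s0 s1] /= yW zW n.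
    have [b bn [yb1 yb2]] := yW n; have [c cn [zc1 zc2]] := zW n.
    exists (s%:C *: b + (1 - s)%:C *: c).
      have [_ nD _] := nrmS; apply: le_trans (nD _ _) _.
      rewrite !seminormZR// !ger0_norm ?subr_ge0//.
      by nra.
    rewrite opprD addrACA -!scalerBr.
    split; apply: le_lt_trans (qD _ _ _) _.
      rewrite !seminormZR ?ger0_norm ?subr_ge0//; try exact: GS.
      exact: convex_lt.
    rewrite !seminormZR ?ger0_norm ?subr_ge0//; try exact: GS.
    exact: convex_lt.
  move=> M; have : nbhs ((0 : X) : withtop t) [set y | forall n, (n < M)%N -> V n y].
    elim: M => [|M IH]; first by apply: filterS filterT => y _ n.
    apply: filterS (filterI IH (V0 M)) => y [yM My] n.
    by rewrite ltnS leq_eqVlt => /predU1P[->|/yM].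
  move=> /tG[p [e [Gp e0 pe]]]; exists p, e; split => // y yM py n.
  have [nM|Mn] := ltnP n M.
    exists 0; first by rewrite seminorm0.
    by rewrite subr0; apply: pe => //; rewrite subr0.
  exists y; first by rewrite (le_trans yM)// ler_nat.
  by rewrite subrr; split; rewrite seminorm0 ?divr_gt0//; exact: GS.
have [B FB BW'] := Fc _ nW'.
apply: filterS (FB) => y By; rewrite -[y](subrKC x); set u := y - x.
have /choice[b bP] (n : nat) : exists b,
    [/\ nrm b <= n%:R, q n (u - b) < r n / 2 & q n.+1 (u - b) < r n.+1 / 2].
  have d0 m : 0 < r m / 4 by rewrite divr_gt0.
  have FV : F [set z | V n (z - x)].
    apply: Fx; apply: filterS (filterI (nbhs_seminorm_ball tG x (Gq n) (d0 n))
      (nbhs_seminorm_ball tG x (Gq n.+1) (d0 n.+1))) => z /=.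
    by [].
  (* The Cauchy property says nothing about [x] itself: a [z] in [B] that is [t]-close to [x],
     chosen anew for each [n], stands in for it, and two quarters of the radius make a half. *)
  have [z [Bz [zx1 zx2]]] := filter_ex (filterI FB FV).
  have [c cn [c1 c2]] := BW' _ _ By Bz n; exists c.
  have uE : u - c = (y - z - c) + (z - x).
    by rewrite [RHS]addrAC subrKA.
  split => //; rewrite uE; apply: le_lt_trans (qD _ _ _) _.
    by move: c1 zx1; lra.
  by move: c2 zx2; lra.
pose N := (Num.truncn (nrm u)).+1.
have uN : nrm u <= N%:R by rewrite ltW// truncnS_gt.
(* From [N] on the approximation is [u] itself, which makes the telescoping sum finite. At the other
   end [c 0] has norm at most [0], hence is [0]. *)
pose c n := if (n < N)%N then b n else u.
have cn n : (n <= N)%N -> nrm (c n) <= n%:R.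
  rewrite /c leq_eqVlt => /predU1P[->|->]; first by rewrite ltnn.
  by have [] := bP n.
have c1 n : q n (u - c n) < r n / 2.
  rewrite /c; case: ifP => _; first by have [] := bP n.
  by rewrite subrr seminorm0 ?divr_gt0//; exact: GS.
have c2 n : q n.+1 (u - c n) < r n.+1 / 2.
  rewrite /c; case: ifP => _; first by have [] := bP n.
  by rewrite subrr seminorm0 ?divr_gt0//; exact: GS.
have tel k : (k <= N)%N -> W (N - k)%N (u - c (N - k)%N).
  elim: k => [_|k IH kN].
    by rewrite subn0 /c ltnn subrr; exact: (@nbhs_singleton (withtop gam)).
  have kE : (N - k)%N = (N - k.+1).+1 by rewrite subnS prednK// subn_gt0.
  have := IH (ltnW kN); rewrite kE; set m := (N - k.+1)%N => Wm.
  have -> : u - c m = (c m.+1 - c m) + (u - c m.+1) by rewrite [RHS]addrC subrKA.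
  have mN : (m.+1 <= N)%N by rewrite -kE leq_subr.
  apply: WD => //; have [_ _] := qrP m.+1; apply.
    apply: le_trans (seminormB _ _ nrmS) _.
    by rewrite lerD ?cn// (le_trans (cn _ (ltnW mN)))// ler_nat.
  have -> : c m.+1 - c m = (u - c m) - (u - c m.+1).
    by rewrite opprB [RHS]addrC subrKA.
  apply: le_lt_trans (seminormB _ _ (GS (Gq m.+1))) _.
  by have := c1 m.+1; have := c2 m; rewrite /r /q; lra.
have := tel N (leqnn N); rewrite subnn.
have -> : c 0%N = 0; last by rewrite subr0.
have [_] := nrmN; apply; apply/eqP; rewrite eq_le; have := cn 0%N (leq0n _).
by rewrite mulr0n => ->; have [n0 _ _] := nrmS; rewrite n0.
Qed.

End submixed_theory.

(** * A Banach-Dieudonne theorem for mixed topologies *)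

Section banach_dieudonne.
Variables (R : realType) (X : lmodType R[i]) (nrm : X -> R).
Variables (t t' : Topological X) (G G' : set (X -> R)).
Hypothesis nrmN : is_norm nrm.
Hypothesis saksG : saks_system nrm t G.
Hypothesis saksG' : saks_system nrm t' G'.
Hypothesis t't : coarser t' t.
Hypothesis cball : forall M : R, compact ([set x | nrm x <= M] : set (withtop t)).
Implicit Types (p q : X -> R) (x y : X).

Local Notation gam := (mixed_topology nrm t).

Let nrmS : is_seminorm nrm. Proof. by case: nrmN. Qed.
Let GS := saks_seminorm saksG.
Let tG := saks_generated saksG.
Let Gle := saks_le saksG.
Let gamL : linear_topology gam := mixed_linear nrmS GS tG Gle.

Let sub : set (X -> R) := [set p | exists (q : nat -> X -> R) (a : nat -> R),
    [/\ forall n, G' (q n), forall n, 0 <= a n, a @ \oo --> (0 : R) &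
        p = weighted_sup q a]].

Let subS p : sub p -> is_seminorm p.
Proof.
move=> [q [a [Gq a0 ac ->]]]; apply: (weighted_sup_seminorm (nrm := nrm)) => //.
  by move=> n; exact: (saks_seminorm saksG' (Gq n)).
by move=> n x; exact: (saks_le saksG' x (Gq n)).
Qed.

Lemma cvg_interleave (a b : nat -> R) (l : R) :
  a @ \oo --> l -> b @ \oo --> l ->
  (fun n => if odd n then b n./2 else a n./2) @ \oo --> l.
Proof.
move=> /cvgrPdist_lt al /cvgrPdist_lt bl; apply/cvgrPdist_lt => e e0.
have [N _ aN] := al e e0; have [M _ bM] := bl e e0.
exists (maxn N M).*2 => // n /= NMn.
have : (maxn N M <= n./2)%N by rewrite -(doubleK (maxn N M)) half_leq.
by rewrite geq_max => /andP[Nn Mn]; case: ifP => _; [exact: bM|exact: aN].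
Qed.

(** Interleaving two sequences of seminorms together with their weights gives a weighted supremum
    above both. *)
Let sub_directed : directed_seminorms sub.
Proof.
have [[q0 Gq0] _] := saks_directed saksG'.
split.
  exists (weighted_sup (fun=> q0) (fun=> 0)), (fun=> q0), (fun=> 0).
  by split => //; exact: cvg_cst.
move=> _ _ [q [a [Gq a0 ac ->]]] [u [b [Gu b0 bc ->]]].
pose w n := if odd n then u n./2 else q n./2.
pose c n := if odd n then b n./2 else a n./2.
have Gw n : G' (w n) by rewrite /w; case: ifP.
have c0 n : 0 <= c n by rewrite /c; case: ifP.
have cc : c @ \oo --> (0 : R) by exact: cvg_interleave.
have GS' (v : nat -> X -> R) : (forall n, G' (v n)) -> forall n, is_seminorm (v n).
  by move=> Gv n; exact: (saks_seminorm saksG' (Gv n)).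
have Gle' (v : nat -> X -> R) : (forall n, G' (v n)) -> forall n x, v n x <= nrm x.
  by move=> Gv n x; exact: (saks_le saksG' x (Gv n)).
exists (weighted_sup w c).
split; first by exists w, c.
  move=> x; apply: (weighted_sup_le (GS' _ Gq) (Gle' _ Gq) a0 ac) => n.
  have := weighted_sup_ge (GS' _ Gw) (Gle' _ Gw) c0 cc n.*2 x.
  by rewrite /w /c odd_double doubleK.
move=> x /=; apply: (weighted_sup_le (GS' _ Gu) (Gle' _ Gu) b0 bc) => n.
have := weighted_sup_ge (GS' _ Gw) (Gle' _ Gw) c0 cc n.*2.+1 x.
by rewrite /w /c /= odd_double /= uphalf_double.
Qed.

Let sub_generated : generated (submixed_topology G') sub.
Proof. exact: seminorm_topology_generated subS sub_directed. Qed.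

Let G'_nbhs q x (r : R) : G' q -> 0 < r -> nbhs (x : withtop t) [set y | q (y - x) < r].
Proof.
move=> Gq r0; have /coarser_nbhs := t't; apply.
exact: (nbhs_seminorm_ball (saks_generated saksG')).
Qed.

Let G'_open q (c : R) : G' q -> @open (withtop t) [set x | c < q x].
Proof.
move=> Gq; rewrite openE => x /= cx.
have r0 : 0 < q x - c by rewrite subr_gt0.
apply: filterS (G'_nbhs x Gq r0) => y /= yx.
have qS := saks_seminorm saksG' Gq.
by have := seminorm_tri y x 0 qS; rewrite !subr0 seminormBC//; move: yx; lra.
Qed.

(** The part [K] of [C] and the ball that lies outside [V] is compact, and the open sets [c < q x]
    cover it because the norm is the supremum of [G']. They are directed, so one pair [(q, c)] is
    enough. [D] holds the admissible bounds: all positive numbers at the first use, a single integer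
    afterwards. *)
Let select (C : set X) (D : set R) (M : R) (V : set X) :
  closed (C : set (withtop t)) -> @open (withtop t) V -> D !=set0 ->
  (forall c d, D c -> D d -> D (Num.min c d)) ->
  (forall x, C x -> nrm x <= M -> ~ V x -> exists2 c, D c & c < nrm x) ->
  exists q c, [/\ G' q, D c &
    forall x, C x -> nrm x <= M -> q x <= c -> V x].
Proof.
move=> Cc Vo [c0 Dc0] Dmin CV.
pose K : set (withtop t) := C `&` [set x | nrm x <= M] `&` ~` V.
have Kc : compact K.
  apply: subclosed_compact (cball (M := M)) _; last by move=> x [[]].
  apply: closedI; last exact: open_closedC.
  by apply: closedI => //; exact: saks_ball_closed saksG _.
have [[q0 Gq0] G'dir] := saks_directed saksG'.
have [||||[q c] [/= Gq Dc] KO] := @compact_directed _ K _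
    [set qc : (X -> R) * R | G' qc.1 /\ D qc.2]
    (fun qc => [set x | qc.2 < qc.1 x]) Kc.
- by exists (q0, c0).
- by move=> [q c] [/= Gq _]; exact: G'_open.
- move=> [q c] [u d] [/= Gq Dc] [/= Gu Dd].
  have [w [Gw qw uw]] := G'dir _ _ Gq Gu.
  exists (w, Num.min c d); first by split => //=; exact: Dmin.
  move=> x /= [cx|dx]; rewrite gt_min; apply/orP.
    by left; exact: lt_le_trans cx (qw x).
  by right; exact: lt_le_trans dx (uw x).
- move=> x [[Cx xM] nVx]; have [c Dc /(saks_sup saksG')[q Gq cq]] := CV x Cx xM nVx.
  by exists (q, c).
exists q, c; split => // x Cx xM qx; apply: contrapT => nVx.
have : K x by [].
by move/KO; rewrite /= ltNge qx.
Qed.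

Lemma mixed_submixed : same_topology gam (submixed_topology G').
Proof.
apply: linear_same_topology => //; first exact: generated_linear subS sub_generated.
move=> A; split; last first.
  move=> /sub_generated[p [e [[q [a [Gq a0 ac ->]]] e0 pA]]].
  have qS n : is_seminorm (q n) := saks_seminorm saksG' (Gq n).
  have qle n x : q n x <= nrm x := saks_le saksG' x (Gq n).
  have qt n (d : R) : 0 < d -> nbhs ((0 : X) : withtop t) [set x | q n x < d].
    by move=> d0; apply: filterS (G'_nbhs 0 (Gq n) d0) => x /=; rewrite subr0.
  apply: filterS (weighted_sup_nbhs nrmN saksG qS qle a0 ac qt e0) => x px.
  by apply: pA; rewrite subr0.
rewrite nbhsE => -[U [Uo U0] UA].
have /choice[V VP] (n : nat) : exists V : set X, @open (withtop t) V /\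
    forall y, nrm y <= n%:R -> V y <-> U y.
  by have [V Vo VU] := mixed_open_ball nrmN saksG n%:R Uo; exists V.
have nrm_gt0 x : ~ U x -> 0 < nrm x.
  move=> nUx; have [n0 _ _] := nrmS; rewrite lt_neqAle n0 andbT eq_sym.
  by apply/eqP => x0; apply: nUx; have [_ /(_ _ x0) ->] := nrmN.
have [q0 [d [Gq0 d0 q0U]]] : exists q d, [/\ G' q, 0 < d &
    forall x, nrm x <= 1 -> q x <= d -> U x].
  have [Vo VU] := VP 1%N.
  have [|||x _ x1 nVx|q [d [Gq d0 qV]]] :=
      @select setT [set d | 0 < d] 1 (V 1%N) _ Vo.
  - exact: closedT.
  - by exists 1 => /=.
  - by move=> c e /= c0 e0; rewrite lt_min c0.
  - have /nrm_gt0 nx : ~ U x by move=> Ux; apply/nVx/(VU x x1).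
    by exists (nrm x / 2); rewrite /= ?divr_gt0// ltr_pdivrMr// mulr_natr mulr2n ltrDl.
  - by exists q, d; split => // x x1 qx; apply/(VU x x1)/qV.
(* The inverses of these bounds are the null sequence of the weighted supremum; at [0], where [n]
   has no inverse, the positive [d] is used. *)
pose c n := if n is 0 then d else n%:R : R.
have c_gt0 n : 0 < c n by case: n => [//|n]; rewrite /c ltr0n.
(* A good list settles the ball whose radius is its length. The bounds are non-strict, so those
   already imposed cut out a closed set, as [select] requires. *)
pose good (h : seq (X -> R)) := (forall k, (k < size h)%N -> G' (nth q0 h k)) /\
  forall x, nrm x <= (size h)%:R ->
    (forall k, (k < size h)%N -> nth q0 h k x <= c k) -> U x.
have /choice[nxt nxtP] (h : seq (X -> R)) : exists q,
    (0 < size h)%N -> good h -> good (rcons h q).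
  have [[h0 [hG hU]]|nh] := pselect ((0 < size h)%N /\ good h); last first.
    by exists q0 => h0 gh; case: nh.
  have [Vo VU] := VP (size h).+1.
  (* A point that obeys the old bounds and lies outside [U] has norm above [size h], because [h] is
     good. The new seminorm can therefore take the bound [size h]. *)
  have [|||x hx xM nVx|q [d' [Gq -> qV]]] :=
      @select [set x | forall k, (k < size h)%N -> nth q0 h k x <= c k]
        [set (size h)%:R] (size h).+1%:R (V (size h).+1) _ Vo.
  - have -> : [set x | forall k, (k < size h)%N -> nth q0 h k x <= c k] =
        \bigcap_(k in [set k | (k < size h)%N]) ~` [set x | c k < nth q0 h k x].
      apply/seteqP; split=> x xc k /=; last by move=> /xc /negP; rewrite -leNgt.
      by move=> /xc; rewrite leNgt => /negP.
    apply: closed_bigI => k kh; apply: open_closedC; apply: G'_open.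
    exact: hG.
  - by exists (size h)%:R.
  - by move=> _ _ -> ->; rewrite minxx.
  - exists (size h)%:R => //; rewrite ltNge; apply/negP => xh.
    by apply: nVx; apply/(VU x xM); exact: hU.
  exists q => _ _; split=> [k|x]; rewrite size_rcons.
    by move=> _; rewrite nth_rcons; case: ifP => [/hG//|_]; case: ifP.
  move=> xM hx; apply/(VU x xM)/qV => //= [k kh|].
    by have := hx k (ltnW kh); rewrite nth_rcons kh.
  have := hx (size h) (ltnSn _); rewrite nth_rcons ltnn eqxx /c.
  by case: (size h) h0.
pose hs n := iter n (fun h => rcons h (nxt h)) [:: q0].
have size_hs n : size (hs n) = n.+1 by elim: n => //= n IH; rewrite size_rcons IH.
have good_hs n : good (hs n).
  elim: n => [|n IH]; last by apply: nxtP => //; rewrite size_hs.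
  by split=> [[]//|x x1 /(_ 0%N) qx]; apply: q0U => //; exact: qx.
pose q n := nth q0 (hs n) n.
have nth_hs n k : (k <= n)%N -> nth q0 (hs n) k = q k.
  elim: n => [|n IH]; first by rewrite leqn0 => /eqP ->.
  rewrite leq_eqVlt => /predU1P[-> //|kn].
  by rewrite /= nth_rcons size_hs kn IH.
have Gq n : G' (q n) by have [+ _] := good_hs n; apply; rewrite size_hs.
have c_cvg : (fun n => (c n)^-1) @ \oo --> (0 : R).
  rewrite -(cvg_shiftS (fun n => (c n)^-1)); exact: cvg_harmonic.
have ci0 n : 0 <= (c n)^-1 by rewrite invr_ge0 ltW.
have qS n : is_seminorm (q n) := saks_seminorm saksG' (Gq n).
have qle n x : q n x <= nrm x := saks_le saksG' x (Gq n).
apply/sub_generated; exists (weighted_sup q (fun n => (c n)^-1)), 1.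
split => //; first by exists q, (fun n => (c n)^-1).
move=> x; rewrite subr0 => px; apply: UA.
pose N := Num.truncn (nrm x).
have [_] := good_hs N; apply; rewrite size_hs; first by rewrite ltW// truncnS_gt.
move=> k; rewrite ltnS => kN; rewrite nth_hs//.
have := weighted_sup_ge qS qle ci0 c_cvg k x.
by move=> /le_lt_trans /(_ px); rewrite ltr_pdivrMr// mul1r => /ltW.
Qed.

End banach_dieudonne.

(** * The complex Hahn-Banach theorem *)

Section hahn_banach.
Variables (R : realType) (X : lmodType R[i]) (N : X -> R).
Hypothesis NS : is_seminorm N.

(* Real-linear functionals on subspaces are represented by their graphs. *)
Let closed_graph (A : set (X * R)) :=
  forall (a : R) u w, A u -> A w -> A (a%:C *: u.1 + w.1, a * u.2 + w.2).

Let dominated (A : set (X * R)) := forall u, A u -> u.2 <= N u.1.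

Let extend (A : set (X * R)) x1 (c : R) : set (X * R) :=
  [set w | exists u (s : R), A u /\ w = (u.1 + s%:C *: x1, u.2 + s * c)].

Let extend_closed A x1 c : closed_graph A -> closed_graph (extend A x1 c).
Proof.
move=> cA a _ _ [u [s [Au ->]]] [w [r [Aw ->]]] /=.
exists (a%:C *: u.1 + w.1, a * u.2 + w.2), (a * s + r); split; first exact: cA.
congr (_, _) => /=.
  by rewrite scalerDr scalerA -rmorphM addrACA -scalerDl -rmorphD.
by rewrite mulrDr mulrDl addrACA mulrA.
Qed.

Let extend_dominated A x1 : closed_graph A -> dominated A -> A (0, 0) ->
  exists c, dominated (extend A x1 c).
Proof.
move=> cA dA A0.
have key u w : A u -> A w -> u.2 - N (u.1 - x1) <= N (w.1 + x1) - w.2.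
  move=> Au Aw; have := dA _ (cA 1 _ _ Au Aw); rewrite /= scale1r mul1r => uw.
  have [_ ND _] := NS; have := ND (u.1 - x1) (w.1 + x1).
  by rewrite addrACA addNr addr0; move: uw; lra.
pose S := [set u.2 - N (u.1 - x1) | u in A].
have S0 : S !=set0 by exists (0 - N (0 - x1)), (0, 0).
have Sub : has_ubound S.
  by exists (N (0 + x1) - 0) => _ [u Au <-]; exact: (key u (0, 0)).
have cge u : A u -> u.2 - N (u.1 - x1) <= sup S.
  by move=> Au; apply: ub_le_sup => //; exists u.
have cle w : A w -> sup S <= N (w.1 + x1) - w.2.
  by move=> Aw; apply: ge_sup => // _ [u Au <-]; exact: key.
have AZ (a : R) u : A u -> A (a%:C *: u.1, a * u.2).
  by move=> Au; have := cA a _ _ Au A0; rewrite /= !addr0.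
exists (sup S) => _ [u [s [Au ->]]] /=.
have [s0|s0|->] := ltgtP s 0; last by rewrite scale0r mul0r !addr0; exact: dA.
  have := cge _ (AZ (- s)^-1 _ Au) => /=.
  have -> : (- s)^-1%:C *: u.1 - x1 = (- s)^-1%:C *: (u.1 + s%:C *: x1).
    rewrite scalerDr scalerA -rmorphM invrN mulNr mulVf ?lt_eqF//.
    by rewrite rmorphN1 scaleN1r.
  have ms : 0 < - s by rewrite oppr_gt0.
  rewrite seminormZR// gtr0_norm ?invr_gt0// -mulrBr ler_pdivrMl//.
  by lra.
have := cle _ (AZ s^-1 _ Au) => /=.
have -> : s^-1%:C *: u.1 + x1 = s^-1%:C *: (u.1 + s%:C *: x1).
  by rewrite scalerDr scalerA -rmorphM mulVf ?gt_eqF// scale1r.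
rewrite seminormZR// gtr0_norm ?invr_gt0// -mulrBr ler_pdivlMl//.
by lra.
Qed.

Lemma real_hahn_banach x0 : exists g : X -> R,
  [/\ forall (a : R) x y, g (a%:C *: x + y) = a * g x + g y,
      forall x, g x <= N x & g x0 = N x0].
Proof.
pose good A := [/\ closed_graph A, dominated A & A (x0, N x0)].
pose P A := A = set0 \/ good A.
have good0 A : good A -> A (0, 0).
  move=> [cA _ Ax0]; have := cA (-1) _ _ Ax0 Ax0.
  by rewrite /= rmorphN1 scaleN1r mulN1r !addNr.
have [F FP Ftot|A [PA Amax]] := @Zorn_bigcup _ P.
  have [[B [FB gB]]|nB] := pselect (exists B, F B /\ good B); last first.
    left; apply/seteqP; split=> // w [B FB Bw].
    by have [B0|gB] := FP _ FB; [rewrite B0 in Bw|case: nB; exists B].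
  right; split; last by have [_ _ Bx0] := gB; exists B.
    move=> a u w [C FC Cu] [D FD Dw].
    wlog: C D a u w FC FD Cu Dw / C `<=` D => [H|CD].
      have [CD|DC] := Ftot _ _ FC FD; first exact: H CD.
      have gC : good C by case: (FP _ FC) => // C0; rewrite C0 in Cu.
      exists C => //; have [cC _ _] := gC; apply: cC => //; exact: DC.
    have gD : good D by case: (FP _ FD) => // D0; rewrite D0 in Dw.
    by exists D => //; have [cD _ _] := gD; apply: cD => //; exact: CD.
  move=> u [C FC Cu].
  have gC : good C by case: (FP _ FC) => // C0; rewrite C0 in Cu.
  by have [_ dC _] := gC; exact: dC.
have gA : good A.
  (* A maximal [A] is not empty, since the graph of [s x0 |-> s N x0] would be strictly larger. *)
  case: PA => // A0; pose L := [set w | exists s : R, w = (s%:C *: x0, s * N x0)].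
  have gL : good L.
    split=> [a _ _ [s ->] [r ->]|_ [s ->] /=|].
    - exists (a * s + r) => /=; rewrite scalerA -rmorphM -scalerDl -rmorphD.
      by rewrite mulrDl mulrA.
    - rewrite seminormZR//; apply: ler_wpM2r; last exact: ler_norm.
      by case: NS.
    - by exists 1; rewrite scale1r mul1r.
  case: (Amax L); last by right.
  rewrite A0; split => // L0; have [_ _ /L0] := gL.
  by [].
have tot x : exists r, A (x, r).
  apply: contrapT => /forallNP nAx.
  have [cA dA Ax0] := gA.
  have [c dB] := extend_dominated x cA dA (good0 _ gA).
  have AB : A `<=` extend A x c.
    by move=> [y r] Ay; exists (y, r), 0; rewrite scale0r mul0r !addr0.
  apply: (Amax (extend A x c)); last first.
    by right; split => //; [exact: extend_closed|exact: AB].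
  split => // BA; apply: (nAx c); apply: BA.
  exists (0, 0), 1; split; first exact: good0.
  by rewrite scale1r mul1r !add0r.
have [g gP] := choice tot; have [cA dA Ax0] := gA.
(* Both [(0, r - s)] and [(0, s - r)] lie in [A], so domination by [N 0 = 0] makes the graph
   single-valued. *)
have uniq x r s : A (x, r) -> A (x, s) -> r = s.
  move=> Ar As; have := dA _ (cA (-1) _ _ Ar As); have := dA _ (cA (-1) _ _ As Ar).
  rewrite /= rmorphN1 scaleN1r !mulN1r addNr seminorm0//.
  by move=> H1 H2; apply/eqP; rewrite eq_le; apply/andP; split; lra.
exists g; split=> [a x y|x|]; last exact: uniq (gP _) Ax0.
  exact: uniq (gP _) (cA a _ _ (gP x) (gP y)).
exact: (dA (x, g x)).
Qed.

(** [g] is the real part of the complex functional [f x = g x - i g (i x)], and rotating [x] by the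
    phase [c] turns [|e x|] into a value of [g]. At [x0] the real part already has the largest
    modulus allowed, [N x0], so the imaginary part vanishes. *)
Lemma hahn_banach x0 : exists e : {linear X -> R[i]^o},
  (forall x, rnorm (e x) <= N x) /\ e x0 = (N x0)%:C.
Proof.
have [g [gL gN gx0]] := real_hahn_banach x0.
have gD x y : g (x + y) = g x + g y by have := gL 1 x y; rewrite scale1r mul1r.
have g0 : g 0 = 0 by have := gD 0 0; rewrite addr0; lra.
have gZ (a : R) x : g (a%:C *: x) = a * g x.
  by have := gL a x 0; rewrite g0 !addr0.
pose f (x : X) : R[i]^o := (g x +i* - g ('i%C *: x))%C.
have fL : linear f.
  move=> [a b] x y.
  have cE (z : X) : (a +i* b)%C *: z = a%:C *: z + b%:C *: ('i%C *: z).
    rewrite scalerA -scalerDl; congr (_ *: _).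
    by apply/eqP; rewrite eq_complex /=; apply/andP; split; apply/eqP; lra.
  have iE (z : X) : 'i%C *: ('i%C *: z) = (-1)%:C *: z.
    by rewrite scalerA -expr2 sqr_i rmorphN1.
  have g1 : g ((a +i* b)%C *: x) = a * g x + b * g ('i%C *: x).
    by rewrite cE gD !gZ.
  have g2 : g ('i%C *: ((a +i* b)%C *: x)) = a * g ('i%C *: x) - b * g x.
    rewrite scalerA [ 'i%C * _]mulrC -scalerA cE iE gD !gZ; lra.
  rewrite /f gD g1 scalerDr gD g2.
  by apply/eqP; rewrite eq_complex /=; apply/andP; split; apply/eqP; lra.
pose e : {linear X -> R[i]^o} := HB.pack_for {linear X -> R[i]^o} f
  (GRing.isLinear.Build _ _ _ _ f fL).
have eN x : rnorm (e x) <= N x.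
  have [->|ex0] := eqVneq (e x) 0; first by rewrite rnorm0; case: NS.
  pose c : R[i] := (e x)^-1 * `|e x|.
  have cn : complex.Re `|c| = 1.
    by rewrite /c normrM normfV normr_id mulVf// normr_eq0.
  have : rnorm (e x) = g (c *: x).
    have -> : g (c *: x) = complex.Re (e (c *: x)) by [].
    rewrite linearZ; congr complex.Re.
    rewrite -[RHS]/((e x : R[i])^-1 * `|e x : R[i]| * (e x : R[i])).
    by rewrite mulrAC mulVf// mul1r.
  by move=> ->; apply: le_trans (gN _) _; have [_ _ ->] := NS; rewrite cn mul1r.
exists e; split => //.
have Re0 : complex.Re (e x0) = N x0 by [].
have := eN x0; rewrite /rnorm normc_def /=; set w := - g _ => wN.
have w0 : w = 0.
  have N0 : 0 <= N x0 by case: NS.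
  have : g x0 ^+ 2 + w ^+ 2 <= N x0 ^+ 2.
    rewrite -(@ler_sqrt _ (_ + _)) ?sqr_ge0// sqrtr_sqr ger0_norm//.
  rewrite gx0 gerDl => w2; apply/eqP; rewrite -sqrf_eq0 eq_le w2.
  exact: sqr_ge0.
by apply/eqP; rewrite eq_complex /= -/w w0 gx0 !eqxx.
Qed.

End hahn_banach.

(** * Cauchy estimates for vector-valued functions *)

Section bounded_derivative_ftc.
Variables (R : realType).
Notation mu := (@lebesgue_measure R).

Lemma continuous_itv_integrable (f : R -> R) (a b : R) :
  continuous f -> mu.-integrable `[a, b] (EFin \o f).
Proof.
move=> cf; apply: continuous_compact_integrable; first exact: segment_compact.
exact: continuous_subspaceT.
Qed.

Lemma is_derive_continuous (f df : R -> R) :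
  (forall x : R, is_derive x 1 f (df x)) -> continuous f.
Proof.
by move=> fd x; apply: differentiable_continuous; apply/derivable1_diffP;
  have [] := fd x.
Qed.

(* The derivative of [c |-> \int f (x + c)] at [0] is computed both under the
   integral sign and through an antiderivative of [f]. *)
Lemma bounded_derivative_FTC2 (f df : R -> R) (L T : R) : 0 < T ->
  (forall x : R, is_derive x 1 f (df x)) -> (forall x, `|df x| <= L) ->
  \int[mu]_(x in `[0, T]) df x = f T - f 0.
Proof.
move=> T0 fd dL; have cf := is_derive_continuous fd.
(* The base point [-2] leaves room for shifts by [c] in []-1, 1[], also at the left end of
   [[0, T]]. *)
pose P (x : R) := \int[mu]_(s in `[(-2)%R, x]) f s.
have dP (x : R) : -2 < x -> is_derive x 1 P (f x).
  move=> x2; have [||||dPx PE] := @continuous_FTC1_closed R f (-2) x (x + 1).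
  - by rewrite ltrDl.
  - exact: continuous_itv_integrable.
  - exact: x2.
  - exact: cf.
  by apply: (DeriveDef dPx); rewrite -derive1E; exact: PE.
pose F (c x : R) := f (x + c).
have dF (c x : R) : is_derive c 1 (F ^~ x) (df (x + c)).
  have -> : F ^~ x = f \o shift x by apply/funext => s; rewrite /F /= addrC.
  have := @is_derive1_comp R f (shift x) c _ 1 (fd (c + x)) (is_derive_shift c 1 x).
  by rewrite mulr1 addrC.
have d1F c x : partial1of2 F c x = df (x + c).
  by rewrite partial1of2E; exact: derive_val.
have cF c : continuous (F c).
  apply: (@is_derive_continuous _ (fun x => df (x + c))) => x.
  have := @is_derive1_comp R f (shift c) x _ 1 (fd (x + c)) (is_derive_shift x 1 c).
  by rewrite mulr1.
have IF c : -1 < c < 1 -> \int[mu]_(x in `[0, T]) F c x = P (T + c) - P c.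
  move=> /andP[c1 c2].
  have dQ (x : R) : -1 < x -> is_derive x 1 (P \o shift c) (f (x + c)).
    move=> x1; have xc : -2 < x + c by lra.
    have := @is_derive1_comp R P (shift c) x _ 1 (dP _ xc) (is_derive_shift x 1 c).
    by rewrite mulr1.
  have cQ (x : R) : -1 < x -> {for x, continuous (P \o shift c)}.
    move=> x1; apply: differentiable_continuous; apply/derivable1_diffP.
    by have [] := dQ x x1.
  rewrite /Rintegral (@continuous_FTC2 _ (F c) (P \o shift c))//.
  - by rewrite /= add0r.
  - exact: continuous_subspaceT.
  - split.
    + move=> x; rewrite in_itv/= => /andP[x0 _].
      by have [] : is_derive x 1 (P \o shift c) (f (x + c)); [apply: dQ; lra|].
    + by apply: cvg_at_right_filter; apply: cQ; lra.
    + by apply: cvg_at_left_filter; apply: cQ; lra.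
  - move=> x; rewrite in_itv/= => /andP[x0 _]; rewrite derive1E.
    by apply: derive_val; apply: dQ; lra.
have L0 : 0 <= L by apply: le_trans (dL 0).
have i0 : `]-1, 1[%classic (0 : R) by rewrite /= in_itv/= ltrN10 ltr01.
have := @differentiation_under_integral R _ _ mu F `[0, T] (measurable_itv _) 0 (-1) 1 i0.
move=> /(_ _ _ (cst L)) H; rewrite [LHS](_ : _ = \int[mu]_(y in `[0, T]) (partial1of2 F) 0 y); last first.
  by apply: eq_Rintegral => x _; rewrite d1F addr0.
rewrite -H; last first.
- by move=> c x _ _; rewrite d1F.
- apply: continuous_itv_integrable; exact: cst_continuous.
- by [].
- by move=> c x _ _; have [] := dF c x.
- by move=> c _; exact: continuous_itv_integrable.
rewrite derive1E; have dE : is_derive (0 : R) 1 ((P \o shift T) - P) (f T - f 0).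
  apply: is_deriveB; last by apply: dP; lra.
  have T2 : -2 < 0 + T by lra.
  have := @is_derive1_comp R P (shift T) 0 _ 1 (dP _ T2) (is_derive_shift 0 1 T).
  by rewrite mulr1 add0r.
rewrite -[RHS](@derive_val _ _ _ _ _ _ _ dE); apply: near_eq_derive.
near=> c; rewrite IF; first by rewrite !fctE /= (addrC T).
near: c; apply: near_in_itvoo; rewrite in_itv/=; lra.
Unshelve. all: by end_near. Qed.

End bounded_derivative_ftc.

(** Without division by [h] the estimate also holds at [h = 0], so full neighbourhoods replace
    punctured ones. *)
Lemma is_derive_near (K : numFieldType) (V : normedModType K) (f : K^o -> V)
    (x : K^o) (d : V) : is_derive x 1 f d <->
  forall e : K, 0 < e -> \forall h \near (0 : K^o),
    `|f (h + x) - f x - h *: d| <= e * `|h|.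
Proof.
have normE (h : K) : h != 0 -> `|f (h + x) - f x - h *: d| =
    `|h| * `|d - h^-1 *: (f (h *: (1 : K^o) + x) - f x)|.
  move=> h0; rewrite -normrZ scalerBr scalerA divff// scale1r.
  by rewrite [h *: (1 : K^o)]mulr1 distrC.
split=> [[fd <-] e e0|H].
  have /cvgrPdist_le/(_ e e0) := fd : h^-1 *: (f (h *: (1 : K^o) + x) - f x)
    @[h --> (0 : K^o)^'] --> 'D_1 f x.
  rewrite near_withinE; apply: filterS => h hd.
  have [->|h0] := eqVneq h 0; first by rewrite add0r subrr scale0r subr0 !normr0 mulr0.
  have -> : `|f (h + x) - f x - h *: 'D_1 f x| =
      `|h| * `|'D_1 f x - h^-1 *: (f (h *: (1 : K^o) + x) - f x)|.
    rewrite -normrZ scalerBr scalerA divff// scale1r.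
    by rewrite [h *: (1 : K^o)]mulr1 distrC.
  by rewrite mulrC ler_wpM2r// hd.
have cv : h^-1 *: (f (h *: (1 : K^o) + x) - f x) @[h --> (0 : K^o)^'] --> d.
  apply/cvgrPdist_le => e e0; rewrite near_withinE.
  apply: filterS (H e e0) => h hd h0.
  by move: hd; rewrite normE// mulrC ler_pM2r// normr_gt0.
by split; [apply/cvg_ex; exists d|exact/cvg_lim].
Qed.

Section complex_derivative.
Variables (R : realType) (E : normedModType R[i]).
Implicit Types (F : R[i]^o -> E).

Lemma is_derive_rnormP F (z : R[i]^o) d : is_derive z 1 F d <->
  forall e : R, 0 < e -> exists2 r : R, 0 < r & forall h : R[i]^o,
    rnorm h < r -> rnorm (F (h + z) - F z - h *: d) <= e * rnorm h.
Proof.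
split=> [/is_derive_near H e e0|H].
  have /H/nbhs_rnormP[r r0 rH] : 0 < e%:C by rewrite ltcR.
  exists r => // h hr; rewrite -lecR rmorphM !rnormE; apply: rH.
  by rewrite subr0.
apply/is_derive_near => e e0.
have eE : (complex.Re e)%:C = e by rewrite RRe_real// gtr0_real.
have /H[r r0 rH] : 0 < complex.Re e by rewrite -ltcR eE.
apply/nbhs_rnormP; exists r => // h; rewrite subr0 => /rH hH.
by rewrite -eE -!rnormE -rmorphM lecR.
Qed.

Lemma is_derive_linear (V : normedModType R[i]) (l : {linear E -> V}) (C : R)
    F (z : R[i]^o) d : (forall x, rnorm (l x) <= C * rnorm x) ->
  is_derive z 1 F d -> is_derive z 1 (l \o F : R[i]^o -> V) (l d).
Proof.
move=> lC Fd; apply/is_derive_near => e e0.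
have eE : (complex.Re e)%:C = e by rewrite RRe_real// gtr0_real.
have C0 : 0 < `|C| + 1 by rewrite ltr_wpDl.
have e'0 : 0 < complex.Re e / (`|C| + 1) by rewrite divr_gt0// -ltcR eE.
have /is_derive_rnormP/(_ _ e'0)[r r0 rH] := Fd.
apply/nbhs_rnormP; exists r => // h; rewrite subr0 => /rH hH.
rewrite /= -linearB -linearZ -linearB -eE -!rnormE -rmorphM lecR.
apply: le_trans (lC _) _.
apply: (@le_trans _ _ ((`|C| + 1) * (complex.Re e / (`|C| + 1) * rnorm h))).
  apply: le_trans (ler_wpM2l (ltW C0) hH); apply: ler_wpM2r.
    exact: rnorm_ge0.
  by rewrite (le_trans (ler_norm _))// lerDl.
by rewrite mulrA mulrCA divff ?mulr1// gt_eqF.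
Qed.

End complex_derivative.

(** This chain rule passes from a complex derivative to a real one: [l] stands for the real or
    imaginary part of a functional of norm at most [1], and the curve is a segment, a radius or a
    circle. *)
Lemma is_derive_curve (R : realType) (E : normedModType R[i]) (l : E -> R)
    (F : R[i]^o -> E) (a b : R -> R) (t da db : R) (d : E) :
  (forall x y, l (x - y) = l x - l y) -> (forall x, `|l x| <= rnorm x) ->
  (forall (s : R) x, l (s%:C *: x) = s * l x) ->
  is_derive t 1 a da -> is_derive t 1 b db ->
  is_derive ((a t +i* b t)%C : R[i]^o) 1 F d ->
  is_derive t 1 (fun s => l (F (a s +i* b s)%C)) (l ((da +i* db)%C *: d)).
Proof.
move=> lB ln lZ /is_derive_near ad /is_derive_near bd /is_derive_rnormP Fd.
apply/is_derive_near => e e0.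
(* A Lipschitz constant for the curve at [t]: the [2] absorbs the remainders of [a] and [b], each at
   most [|h|] thanks to the [1] in [e2]. *)
pose D := `|da| + `|db| + 2.
have D0 : 0 < D by rewrite /D ltr_wpDl// addr_ge0.
have e10 : 0 < e / 2 / D by rewrite !divr_gt0.
have d10 : 0 < rnorm d + 1 by rewrite ltr_wpDl ?rnorm_ge0.
pose e2 := Num.min 1 (e / 4 / (rnorm d + 1)).
have e20 : 0 < e2 by rewrite lt_min ltr01 !divr_gt0.
have [r r0 rF] := Fd _ e10.
have rD0 : 0 < r / D by rewrite divr_gt0.
near=> h.
have hr : `|h| < r / D.
  near: h; apply/nbhs_ballP; exists (r / D) => //= y.
  by rewrite /ball /= sub0r normrN.
have ha : `|a (h + t) - a t - h *: da| <= e2 * `|h| by near: h; exact: ad.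
have hb : `|b (h + t) - b t - h *: db| <= e2 * `|h| by near: h; exact: bd.
pose k : R[i]^o := ((a (h + t) - a t) +i* (b (h + t) - b t))%C.
have e2le1 : e2 * `|h| <= `|h| by rewrite ler_piMl// /e2 ge_min lexx.
have kD : rnorm k <= D * `|h|.
  apply: le_trans (rnorm_ReIm _) _.
  have := ler_normD (a (h + t) - a t - h *: da) (h *: da).
  have := ler_normD (b (h + t) - b t - h *: db) (h *: db).
  rewrite !subrK !normrZ /D; move: ha hb e2le1.
  by move: (`|_|) (`|_|) (e2 * _) => x1 x2 x3; lra.
have kr : rnorm k < r.
  by apply: le_lt_trans kD _; rewrite mulrC -ltr_pdivlMr.
have kE : k + (a t +i* b t)%C = (a (h + t) +i* b (h + t))%C.
  by apply/eqP; rewrite eq_complex /= !subrK !eqxx.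
have := rF k kr; rewrite kE => Fk.
have -> : l (F (a (h + t) +i* b (h + t))%C) - l (F (a t +i* b t)%C) -
    h *: l ((da +i* db)%C *: d) =
    l ((F (a (h + t) +i* b (h + t))%C - F (a t +i* b t)%C - k *: d) +
       (k - h%:C * (da +i* db)%C) *: d).
  have -> : h *: l ((da +i* db)%C *: d) = l ((h : R)%:C *: ((da +i* db)%C *: d)).
    by rewrite lZ.
  by rewrite -!lB; congr l; rewrite scalerBl -scalerA subrKA.
apply: le_trans (ln _) _; apply: le_trans (rnormD _ _) _.
rewrite [e]splitr mulrDl; apply: lerD.
  apply: le_trans Fk _; apply: le_trans (ler_wpM2l _ kD) _; first exact: ltW.
  by rewrite mulrA divfK// gt_eqF.
rewrite rnormZ.
have -> : k - h%:C * (da +i* db)%C =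
    ((a (h + t) - a t - h * da) +i* (b (h + t) - b t - h * db))%C.
  by apply/eqP; rewrite eq_complex /= !mul0r subr0 addr0 !eqxx.
have := rnorm_ReIm ((a (h + t) - a t - h * da) +i* (b (h + t) - b t - h * db))%C.
rewrite /rnorm => /(ler_wpM2r (rnorm_ge0 d)) /le_trans; apply.
apply: (@le_trans _ _ ((e2 * `|h| + e2 * `|h|) * (rnorm d + 1))).
  apply: ler_pM; rewrite ?addr_ge0 ?rnorm_ge0 ?lerD//.
  by rewrite lerDl.
rewrite -mulrDr mulrAC.
have : e2 * (rnorm d + 1) <= e / 4 by rewrite -ler_pdivlMr// /e2 ge_min lexx orbT.
move=> /(ler_wpM2r (normr_ge0 h)); lra.
Unshelve. all: by end_near. Qed.

Section mean_value.
Variables (R : realType) (E : normedModType R[i]).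

Lemma ReZR (s : R) (z : R[i]) : complex.Re (s%:C * z) = s * complex.Re z.
Proof. by case: z => a b; rewrite /= mul0r subr0. Qed.

Lemma ImZR (s : R) (z : R[i]) : complex.Im (s%:C * z) = s * complex.Im z.
Proof. by case: z => a b; rewrite /= mul0r addr0. Qed.

Lemma is_derive_affine (a b t : R) : is_derive t 1 (fun s : R => a + s * b) b.
Proof.
apply: (is_derive_eq (is_deriveD (is_derive_cst a t 1)
  (is_deriveM (is_derive_id t 1) (is_derive_cst b t 1)))).
by rewrite add0r scaler0 add0r [_ *: _]mulr1.
Qed.

(** A functional norming [F z - F w] reduces the claim to the real mean value theorem on the segment
    from [w] to [z], which stays in the ball. *)
Lemma mean_value_ball (F dF : R[i]^o -> E) (c : R[i]^o) (r M : R) :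
  (forall z, rnorm (z - c) < r -> is_derive z 1 F (dF z)) ->
  (forall z, rnorm (z - c) < r -> rnorm (dF z) <= M) ->
  forall z w, rnorm (z - c) < r -> rnorm (w - c) < r ->
  rnorm (F z - F w) <= M * rnorm (z - w).
Proof.
move=> Fd dM z w zr wr.
have [e [eN eFzw]] := hahn_banach (@rnorm_is_seminorm R E) (F z - F w).
pose l x := complex.Re (e x).
have lB x y : l (x - y) = l x - l y by rewrite /l linearB raddfB.
have ln x : `|l x| <= rnorm x by apply: le_trans (Re_le_rnorm _) (eN x).
have lZ (s : R) x : l (s%:C *: x) = s * l x.
  by rewrite /l linearZ; exact: ReZR.
pose g (t : R) : R[i]^o := ((complex.Re w + t * complex.Re (z - w)) +i*
   (complex.Im w + t * complex.Im (z - w)))%C.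
have gE t : g t = w + t%:C *: (z - w).
  rewrite /g; case: (z - w) => x y; case: (w) => a b.
  have -> : t%:C *: (x +i* y)%C = ((t * x) +i* (t * y))%C :> R[i]^o.
    by apply/eqP; rewrite eq_complex /= !mul0r subr0 addr0 !eqxx.
  by [].
have gr t : 0 <= t <= 1 -> rnorm (g t - c) < r.
  move=> /andP[t0 t1]; rewrite gE.
  have -> : w + t%:C *: (z - w) - c = t%:C *: (z - c) + (1 - t)%:C *: (w - c).
    rewrite rmorphB scalerBl scale1r addrCA -scalerBr.
    by rewrite opprB addrA subrK addrAC addrC.
  apply: le_lt_trans (rnormD _ _) _; rewrite !rnormZ !Re_normC !ger0_norm ?subr_ge0//.
  exact: convex_lt.
have gd (t : R) : 0 <= t <= 1 ->
    is_derive t 1 (fun s => l (F (g s))) (l ((z - w) *: dF (g t))).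
  move=> t01; have := is_derive_curve lB ln lZ
    (is_derive_affine (complex.Re w) (complex.Re (z - w)) t)
    (is_derive_affine (complex.Im w) (complex.Im (z - w)) t) (Fd _ (gr t t01)).
  by congr is_derive; congr (l (_ *: _)); case: (z - w).
have [||t t01 H] := @MVT_segment R (fun s => l (F (g s)))
    (fun t => l ((z - w) *: dF (g t))) 0 1 ler01.
- by move=> t; rewrite in_itv/= => /andP[t0 t1]; apply: gd; rewrite !ltW.
- apply: derivable_within_continuous => t; rewrite in_itv/= => t01.
  by have [] := gd t t01.
move: H; rewrite subr0 mulr1 -lB !gE scale0r addr0 scale1r subrKC {1}/l eFzw /= => ->.
apply: le_trans (ler_norm _) _; apply: le_trans (ln _) _.
rewrite rnormZ mulrC; apply: ler_wpM2r; first exact: (@rnorm_ge0 _ R[i]^o).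
by apply: dM; rewrite -gE; apply: gr; move: t01; rewrite in_itv.
Qed.

End mean_value.

Section cauchy_estimate.
Variables (R : realType) (E : normedModType R[i]).
Notation mu := (@lebesgue_measure R).

Let circ (c : R[i]^o) (s x : R) : R[i]^o :=
  ((complex.Re c + s * cos x) +i* (complex.Im c + s * sin x))%C.

Let circE c s x : circ c s x = ((s * cos x) +i* (s * sin x))%C + c.
Proof. by case: c => a b; apply/eqP; rewrite eq_complex /= ![_ + s * _]addrC !eqxx. Qed.

Let rnorm_circ c s x : rnorm (circ c s x - c) = `|s|.
Proof.
rewrite circE addrK /rnorm normc_def /= !exprMn -mulrDr cos2Dsin2 mulr1.
by rewrite sqrtr_sqr.
Qed.

(* With [p + i q = e (F (c + s e^(ix)))], the functions
   [(p cos x + q sin x) / s] and [(q cos x - p sin x) / s^2] have the same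
   partial derivative, in [s] and in [x] respectively; the latter is periodic
   in [x], so the integral of the former over a circle does not depend on
   [s]. *)
Let cauchy_estimate0 (F dF : R[i]^o -> E) (c : R[i]^o) (r L M : R) :
  (forall z, rnorm (z - c) < r -> is_derive z 1 F (dF z)) ->
  (forall z, rnorm (z - c) < r -> rnorm (dF z) <= L) ->
  (forall z, rnorm (z - c) < r -> rnorm (F z) <= M) -> F c = 0 ->
  forall s, 0 < s < r -> s * rnorm (dF c) <= 2 * M.
Proof.
move=> Fd dL FM Fc s2 /andP[s20 s2r]; have r0 : 0 < r := lt_trans s20 s2r.
have [e [eN ec]] := hahn_banach (@rnorm_is_seminorm R E) (dF c).
pose lr x := complex.Re (e x); pose li x := complex.Im (e x).
have lrB x y : lr (x - y) = lr x - lr y by rewrite /lr linearB raddfB.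
have liB x y : li (x - y) = li x - li y by rewrite /li linearB raddfB.
have lrn x : `|lr x| <= rnorm x by apply: le_trans (Re_le_rnorm _) (eN x).
have lin x : `|li x| <= rnorm x by apply: le_trans (Im_le_rnorm _) (eN x).
have lrZ (s : R) x : lr (s%:C *: x) = s * lr x.
  by rewrite /lr linearZ; exact: ReZR.
have liZ (s : R) x : li (s%:C *: x) = s * li x.
  by rewrite /li linearZ; exact: ImZR.
have lrM (a b : R) x : lr ((a +i* b)%C *: x) = a * lr x - b * li x.
  by rewrite /lr linearZ /li; case: (e x).
have liM (a b : R) x : li ((a +i* b)%C *: x) = a * li x + b * lr x.
  by rewrite /li linearZ /lr; case: (e x).
pose p s x := lr (F (circ c s x)); pose q s x := li (F (circ c s x)).
pose u s x := lr (dF (circ c s x)); pose w s x := li (dF (circ c s x)).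
have Fcirc s x : `|s| < r -> is_derive (circ c s x) 1 F (dF (circ c s x)).
  by move=> sr; apply: Fd; rewrite rnorm_circ.
have ps (s x : R) : `|s| < r ->
    is_derive s 1 (p ^~ x) (cos x * u s x - sin x * w s x).
  move=> sr; rewrite -lrM.
  exact: (is_derive_curve lrB lrn lrZ (is_derive_affine _ _ _) (is_derive_affine _ _ _)
    (Fcirc s x sr)).
have qs (s x : R) : `|s| < r ->
    is_derive s 1 (q ^~ x) (cos x * w s x + sin x * u s x).
  move=> sr; rewrite -liM.
  exact: (is_derive_curve liB lin liZ (is_derive_affine _ _ _) (is_derive_affine _ _ _)
    (Fcirc s x sr)).
have dcos (a s x : R) : is_derive x 1 (fun x => a + s * cos x) (- (s * sin x)).
  apply: (is_derive_eq (is_deriveD (is_derive_cst a x 1)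
    (is_deriveM (is_derive_cst s x 1) (is_derive_cos x)))).
  by rewrite add0r scaler0 addr0 -mulrN.
have dsin (a s x : R) : is_derive x 1 (fun x => a + s * sin x) (s * cos x).
  apply: (is_derive_eq (is_deriveD (is_derive_cst a x 1)
    (is_deriveM (is_derive_cst s x 1) (is_derive_sin x)))).
  by rewrite add0r scaler0 addr0.
have px (s x : R) : `|s| < r ->
    is_derive x 1 (p s) (- (s * sin x) * u s x - s * cos x * w s x).
  move=> sr; rewrite -lrM.
  exact: (is_derive_curve lrB lrn lrZ (dcos _ _ _) (dsin _ _ _) (Fcirc s x sr)).
have qx (s x : R) : `|s| < r ->
    is_derive x 1 (q s) (- (s * sin x) * w s x + s * cos x * u s x).
  move=> sr; rewrite -liM.
  exact: (is_derive_curve liB lin liZ (dcos _ _ _) (dsin _ _ _) (Fcirc s x sr)).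
pose W s x := (p s x * cos x + q s x * sin x) / s.
pose V s x := (q s x * cos x - p s x * sin x) / s ^+ 2.
pose D s x := (s * u s x - (p s x * cos x + q s x * sin x)) / s ^+ 2.
have cs x : cos x * cos x = 1 - sin x * sin x :> R.
  by have := cos2Dsin2 x; rewrite !expr2; lra.
have Ws (s x : R) : 0 < s < r -> is_derive s 1 (W ^~ x) (D s x).
  move=> /andP[s0 sr].
  have sr' : `|s| < r by rewrite gtr0_norm.
  have psx := ps s x sr'; have qsx := qs s x sr'.
  have sV : is_derive s 1 (fun y : R => y^-1) (- s ^- 2).
    have s_neq0 : id s != 0 by rewrite gt_eqF.
    have := is_deriveV s_neq0 (is_derive_id s 1).
    by rewrite /= [_ *: _]mulr1.
  apply: (is_derive_eq (is_deriveM (is_deriveD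
    (is_deriveM psx (is_derive_cst (cos x) s 1))
    (is_deriveM qsx (is_derive_cst (sin x) s 1))) sV)).
  rewrite /GRing.scale /= /D !fctE /=.
  rewrite !mulr0 !add0r; have -> : cos x * (cos x * u s x - sin x * w s x) +
      sin x * (cos x * w s x + sin x * u s x) = u s x.
    have -> : forall a b c d : R, a * (a * c - b * d) + b * (a * d + b * c) =
        (a * a + b * b) * c by move=> *; ring.
    by rewrite cs subrK mul1r.
  by field; rewrite gt_eqF.
have Vx (s x : R) : 0 < s < r -> is_derive x 1 (V s) (D s x).
  move=> /andP[s0 sr].
  have sr' : `|s| < r by rewrite gtr0_norm.
  have pxx := px s x sr'; have qxx := qx s x sr'.
  apply: (is_derive_eq (is_deriveM (is_deriveB (is_deriveM qxx (is_derive_cos x))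
    (is_deriveM pxx (is_derive_sin x))) (is_derive_cst (s ^- 2) x 1))).
  rewrite /GRing.scale /= /D !fctE /=.
  rewrite mulr0 add0r [RHS]mulrC; congr (_ * _).
  rewrite -[X in _ = X * _ - _]mulr1.
  have -> : forall a b c d f g : R, c * - b + a * (- (s * b) * d + s * a * f) -
      (g * a + b * (- (s * b) * f - s * a * d)) =
      s * ((a * a + b * b) * f) - (g * a + c * b) by move=> *; ring.
  by rewrite cs subrK mul1r mulr1.
have pq_le s x : 0 < s < r -> `|p s x * cos x + q s x * sin x| <= 2 * M.
  move=> /andP[s0 sr]; apply: le_trans (ler_normD _ _) _; rewrite !normrM.
  have Fs : rnorm (F (circ c s x)) <= M by apply: FM; rewrite rnorm_circ gtr0_norm.
  have pM : `|p s x| <= M := le_trans (lrn _) Fs.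
  have qM : `|q s x| <= M := le_trans (lin _) Fs.
  have := cos_max x; have := sin_max x => sx cx.
  rewrite mulr_natl mulr2n; apply: lerD; rewrite -[leRHS]mulr1; exact: ler_pM.
pose C s := \int[mu]_(x in `[0, pi *+ 2]) W s x.
have M0 : 0 <= M by apply: le_trans (FM c _); rewrite ?rnorm_ge0// subrr rnorm0.
have cW (s : R) : 0 < s < r -> continuous (W s).
  move=> sr x; have sr' : `|s| < r by case/andP: sr => s0 sr; rewrite gtr0_norm.
  have pxx := px s x sr'; have qxx := qx s x sr'.
  have [Wd _] : is_derive x 1 (W s) _ := is_deriveM
    (is_deriveD (is_deriveM pxx (is_derive_cos x)) (is_deriveM qxx (is_derive_sin x)))
    (is_derive_cst s^-1 x 1).
  by apply: differentiable_continuous; exact/derivable1_diffP.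
have iW (s : R) : 0 < s < r -> mu.-integrable `[0, pi *+ 2] (EFin \o W s).
  by move=> sr; apply: continuous_itv_integrable; exact: cW.
have dC (s : R) : 0 < s < r -> is_derive s 1 C 0.
  move=> /andP[s0 sr].
  have sI : `]s / 2, r[%classic s by rewrite /= in_itv/= sr andbT ltr_pdivrMr// mulr_natr mulr2n ltrDl.
  have I0 t : `]s / 2, r[%classic t -> 0 < t < r.
    by rewrite /= in_itv/= => /andP[st ->]; rewrite andbT (lt_trans _ st)// divr_gt0.
  (* Away from the singularity at radius [0], on []s / 2, r[], the constant [B] dominates the
     derivative under the integral sign. *)
  pose B := (r * L + 2 * M) / (s / 2) ^+ 2.
  have L0 : 0 <= L by apply: le_trans (dL c _); rewrite ?rnorm_ge0// subrr rnorm0.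
  have B0 : 0 <= B.
    by rewrite divr_ge0 ?exprn_ge0 ?divr_ge0 ?addr_ge0 ?mulr_ge0// ltW.
  have DB t x : s / 2 < t -> t < r -> `|D t x| <= B.
    move=> st tr; have t0 : 0 < t by apply: lt_trans st; rewrite divr_gt0.
    have tr' : 0 < t < r by rewrite t0.
    rewrite /D /B normrM; apply: ler_pM => //.
      apply: le_trans (ler_normB _ _) _; apply: lerD; last exact: pq_le.
      rewrite normrM gtr0_norm//; apply: ler_pM; rewrite ?(ltW t0) ?(ltW tr)//.
      apply: le_trans (lrn _) _; apply: dL.
      by rewrite rnorm_circ gtr0_norm.
    have s2_0 : 0 < s / 2 by rewrite divr_gt0.
    rewrite normfV gtr0_norm ?exprn_gt0// lef_pV2 ?posrE ?exprn_gt0//.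
    by rewrite lerXn2r// ?nnegrE ltW.
  have DE t x : `]s / 2, r[%classic t -> partial1of2 W t x = D t x.
    by move=> /I0 t0; rewrite partial1of2E; have [] := Ws t x t0.
  have := @cvg_differentiation_under_integral R _ _ mu W `[0, pi *+ 2]
    (measurable_itv _) s (s / 2) r sI (fun t tI => iW t (I0 t tI)).
  have dW t x : `]s / 2, r[%classic t -> `[0, pi *+ 2]%classic x -> derivable (W ^~ x) t 1.
    by move=> /I0 t0 _; have [] := Ws t x t0.
  have iB : mu.-integrable `[0, pi *+ 2] (EFin \o cst B).
    by apply: continuous_itv_integrable; exact: cst_continuous.
  have WB t x : `]s / 2, r[%classic t -> `[0, pi *+ 2]%classic x ->
      `|partial1of2 W t x| <= cst B x.
    by move=> tI _; rewrite DE//; move: tI; rewrite /= in_itv/= => /andP[st tr]; exact: DB.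
  move=> /(_ dW (cst B) (fun=> B0) iB WB) H.
  have s_lt : s / 2 < s by rewrite ltr_pdivrMr// mulr_natr mulr2n ltrDl.
  have int0 : \int[mu]_(x in `[0, pi *+ 2]) partial1of2 W s x = 0.
    transitivity (\int[mu]_(x in `[0, pi *+ 2]) D s x).
      by apply: eq_Rintegral => x _; rewrite DE.
    have pi2 : 0 < pi *+ 2 :> R by rewrite mulr2n addr_gt0// pi_gt0.
    have Vs (x : R) : is_derive x 1 (V s) (D s x) by apply: Vx; rewrite s0.
    (* [dF] is not known to be continuous, hence the fundamental theorem for bounded derivatives.
       [V s] takes equal values at both ends of the period. *)
    rewrite (bounded_derivative_FTC2 pi2 Vs (fun x => DB s x s_lt sr)).
    by rewrite /V /p /q /circ cos2pi sin2pi cos0 sin0 subrr.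
  rewrite int0 in H.
  have {}H : h^-1 *: (C (h *: (1 : R^o) + s) - C s) @[h --> (0 : R^o)^'] --> (0 : R^o).
    suff -> : (fun h : R^o => h^-1 *: (C (h *: (1 : R^o) + s) - C s)) =
      (fun h => h^-1 *: (C (h + s) - C s)) by [].
    by apply/funext => h; rewrite [h *: (1 : R^o)]mulr1.
  by split; [apply/cvg_ex; exists 0|exact/cvg_lim].
have Ccst s : 0 < s < s2 -> C s2 = C s.
  move=> /andP[s0 ss].
  have I0 t : s <= t -> t <= s2 -> 0 < t < r.
    by move=> st ts; rewrite (lt_le_trans s0 st)/= (le_lt_trans ts s2r).
  have [||t _ H] := @MVT_segment R C (cst 0) s s2 (ltW ss).
  - by move=> t; rewrite in_itv/= => /andP[st ts]; apply: dC; apply: I0; exact: ltW.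
  - apply: derivable_within_continuous => t; rewrite in_itv/= => /andP[st ts].
    by have [] := dC t (I0 t st ts).
  by apply/eqP; rewrite -subr_eq0 H /= mul0r.
set N := rnorm (dF c); rewrite leNgt; apply/negP => MN.
(* On a circle shrinking to [c] the function [W] is close to [N], and on the circle of radius [s2]
   it is at most [2 * M / s2]. As the means agree, a quarter of the gap is small enough for a
   contradiction. *)
pose eps := (N - 2 * M / s2) / 4.
have eps0 : 0 < eps by rewrite divr_gt0// subr_gt0 ltr_pdivrMr// [N * _]mulrC.
have Fdc : is_derive c 1 F (dF c) by apply: Fd; rewrite subrr rnorm0.
have [d d0 dP] := (is_derive_rnormP _ _ _).1 Fdc eps eps0.
pose s1 := Num.min d s2 / 2.
have ds0 : 0 < Num.min d s2 by rewrite lt_min d0.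
have s10 : 0 < s1 by rewrite divr_gt0.
have s1d : s1 < Num.min d s2 by rewrite ltr_pdivrMr// mulr_natr mulr2n ltrDl.
have s12 : 0 < s1 < s2 by rewrite s10 (lt_le_trans s1d)// ge_min lexx orbT.
have s1r : 0 < s1 < r by case/andP: s12 => -> /lt_trans ->.
have s2r' : 0 < s2 < r by rewrite s20.
have W1 x : N - 2 * eps <= W s1 x.
  pose h : R[i]^o := ((s1 * cos x) +i* (s1 * sin x))%C.
  have hn : rnorm h = s1 by rewrite -(addrK c h) -circE rnorm_circ gtr0_norm.
  have := dP h; rewrite hn => /(_ (lt_le_trans s1d _)).
  rewrite ge_min lexx => /(_ isT); rewrite Fc subr0 -circE => rem.
  have pr : `|p s1 x - s1 * cos x * N| <= eps * s1.
    apply: le_trans rem; apply: le_trans (lrn _); rewrite lrB lrM.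
    by rewrite {2}/lr {1}/li ec /= mulr0 subr0.
  have qr : `|q s1 x - s1 * sin x * N| <= eps * s1.
    apply: le_trans rem; apply: le_trans (lin _); rewrite liB liM.
    by rewrite {2}/li {1}/lr ec /= mulr0 add0r.
  rewrite /W ler_pdivlMr//.
  have -> : p s1 x * cos x + q s1 x * sin x = s1 * N +
      ((p s1 x - s1 * cos x * N) * cos x + (q s1 x - s1 * sin x * N) * sin x).
    have key (a b f g n t : R) : a * f + b * g = - (t * n * (1 - (f * f + g * g))) +
      (t * n + ((a - t * f * n) * f + (b - t * g * n) * g)) by ring.
    by rewrite [LHS](key _ _ _ _ N s1) cs subrK subrr mulr0 oppr0 add0r.
  have := ler_normD ((p s1 x - s1 * cos x * N) * cos x) ((q s1 x - s1 * sin x * N) * sin x).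
  rewrite !normrM => H.
  have {}H := le_trans H (lerD (ler_pM (normr_ge0 _) (normr_ge0 _) pr (cos_max x))
    (ler_pM (normr_ge0 _) (normr_ge0 _) qr (sin_max x))).
  have := lerNnormlW H; move: (_ * cos x + _) => X; lra.
have W2 x : W s2 x <= 2 * M / s2.
  rewrite /W ler_pM2r ?invr_gt0//; apply: le_trans (ler_norm _) _; exact: pq_le.
have cst_int (a : R) : \int[mu]_(x in `[0, pi *+ 2]) (cst a) x = a * (pi *+ 2).
  rewrite Rintegral_cst//=; congr (_ * _).
  rewrite lebesgue_measure_itv/= lte_fin mulr2n addr_gt0 ?pi_gt0//=.
  by rewrite subr0.
have icst (a : R) : mu.-integrable `[0, pi *+ 2] (EFin \o cst a).
  by apply: continuous_itv_integrable; exact: cst_continuous.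
have C1 : (N - 2 * eps) * (pi *+ 2) <= C s1.
  by rewrite -cst_int; apply: le_Rintegral => //; first [exact: icst|exact: iW|by move=> x _; exact: W1].
have C2 : C s2 <= 2 * M / s2 * (pi *+ 2).
  by rewrite -cst_int; apply: le_Rintegral => //; first [exact: icst|exact: iW|by move=> x _; exact: W2].
have pi2 : 0 < pi *+ 2 :> R by rewrite mulr2n addr_gt0// pi_gt0.
have := le_trans C1 (le_trans _ C2); rewrite (Ccst s1 s12) => /(_ (lexx _)).
rewrite ler_pM2r//; move: eps0; rewrite /eps; lra.
Qed.

(** The [4] is [2] for the two terms of [p cos x + q sin x], times [2] for passing to [F - F c],
    which vanishes at [c]. Radii [s < r] come first, and [r] is their limit. Of [L] only finiteness
    matters, for domination under the integral sign. *)
Lemma cauchy_estimate (F dF : R[i]^o -> E) (c : R[i]^o) (r L M : R) :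
  (forall z, rnorm (z - c) < r -> is_derive z 1 F (dF z)) ->
  (forall z, rnorm (z - c) < r -> rnorm (dF z) <= L) ->
  (forall z, rnorm (z - c) < r -> rnorm (F z) <= M) ->
  0 < r -> rnorm (dF c) <= 4 * M / r.
Proof.
move=> Fd dL FM r0.
have H s : 0 < s < r -> s * rnorm (dF c) <= 4 * M.
  move=> sr; have := @cauchy_estimate0 (fun z => F z - F c) dF c r L (2 * M).
  rewrite mulrA -natrM; apply=> //.
  - move=> z zr; have := Fd z zr => Fz.
    by apply: is_derive_eq; rewrite subr0.
  - move=> z zr; rewrite mulr_natl mulr2n.
    apply: le_trans (rnormD _ _) _; rewrite rnormN lerD ?FM//.
    by rewrite subrr rnorm0.
  - by rewrite subrr.
rewrite ler_pdivlMr// mulrC leNgt; apply/negP => lt.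
have N0 : 0 < rnorm (dF c).
  have M0 : 0 <= M by apply: le_trans (FM c _); rewrite ?rnorm_ge0// subrr rnorm0.
  have : 0 < r * rnorm (dF c) by apply: le_lt_trans lt; rewrite mulr_ge0.
  by rewrite pmulr_rgt0.
have a_r : 4 * M / rnorm (dF c) < r by rewrite ltr_pdivrMr.
have M0 : 0 <= 4 * M / rnorm (dF c).
  rewrite divr_ge0 ?rnorm_ge0// mulr_ge0//.
  by apply: le_trans (FM c _); rewrite ?rnorm_ge0// subrr rnorm0.
pose s := (4 * M / rnorm (dF c) + r) / 2.
have /andP[s1 s2] : 4 * M / rnorm (dF c) < s < r by rewrite /s !midf_lt.
have := H s; rewrite s2 (le_lt_trans M0 s1) -ler_pdivlMr// leNgt s1.
by move=> /(_ isT).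
Qed.

End cauchy_estimate.

(** * Consequences of the Cauchy estimate *)

Section holomorphic_consequences.
Variables (R : realType) (E : normedModType R[i]).
Implicit Types (F dF : R[i]^o -> E) (c : R[i]^o).

Lemma is_derive_translate F (a z : R[i]^o) d :
  is_derive (a + z) 1 F d -> is_derive z 1 (fun h => F (a + h)) d.
Proof.
move=> /is_derive_near H; apply/(is_derive_near (fun h => F (a + h))) => e /H.
by apply: filterS => h; rewrite addrCA.
Qed.

(** Instead of a second derivative, the Cauchy estimate is applied at [0] to
    [h |-> F (z + h) - F (w + h)], which the mean value inequality bounds by [M * rnorm (z - w)] on
    radius [r / 2]. *)
Lemma derivative_lipschitz F dF c (r M : R) :
  (forall z, rnorm (z - c) < r -> is_derive z 1 F (dF z)) ->
  (forall z, rnorm (z - c) < r -> rnorm (dF z) <= M) ->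
  forall z w, rnorm (z - c) < r / 2 -> rnorm (w - c) < r / 2 ->
  rnorm (dF z - dF w) <= 8 * M / r * rnorm (z - w).
Proof.
move=> Fd dM z w zr wr.
have r2 : 0 < r / 2 by apply: le_lt_trans zr; exact: rnorm_ge0.
have hr u h : rnorm (u - c) < r / 2 -> rnorm (h - 0) < r / 2 -> rnorm (u + h - c) < r.
  move=> ur; rewrite subr0 => hr; rewrite addrAC.
  by apply: le_lt_trans (rnormD _ _) _; rewrite [r]splitr ltrD.
pose G (h : R[i]^o) := F (z + h) - F (w + h).
pose dG (h : R[i]^o) := dF (z + h) - dF (w + h).
have -> : dF z - dF w = dG 0 by rewrite /dG (addr0 z) (addr0 w).
have Gd (h : R[i]^o) : rnorm (h - 0) < r / 2 -> is_derive h 1 G (dG h).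
  move=> h2; have zd := is_derive_translate (Fd _ (hr _ _ zr h2)).
  have wd := is_derive_translate (Fd _ (hr _ _ wr h2)).
  exact: (is_deriveB zd wd).
have dGM (h : R[i]^o) : rnorm (h - 0) < r / 2 -> rnorm (dG h) <= M + M.
  move=> h2; apply: le_trans (rnormD _ _) _; rewrite rnormN.
  by apply: lerD; apply: dM; exact: hr.
have GM (h : R[i]^o) : rnorm (h - 0) < r / 2 -> rnorm (G h) <= M * rnorm (z - w).
  move=> h2; have := mean_value_ball Fd dM (hr _ _ zr h2) (hr _ _ wr h2).
  have -> // : z + h - (w + h) = z - w.
  by rewrite opprD addrACA subrr addr0.
have := cauchy_estimate Gd dGM GM r2.
move: (rnorm (dG 0)) (rnorm (z - w)) => a b.
have -> // : 4 * (M * b) / (r / 2) = 8 * M / r * b.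
by rewrite invf_div; ring.
Qed.

(** By the Lipschitz bound, [z |-> F z - z *: dF c] has derivative at most
    [8 * M / r * (2 * rnorm h)] on the ball of radius [2 * rnorm h] around [c]. The factor [2] puts
    [h + c] inside this open ball, and [r / 4] keeps the ball within radius [r / 2]. *)
Lemma second_order F dF c (r M : R) :
  (forall z, rnorm (z - c) < r -> is_derive z 1 F (dF z)) ->
  (forall z, rnorm (z - c) < r -> rnorm (dF z) <= M) ->
  forall h, rnorm h < r / 4 ->
  rnorm (F (h + c) - F c - h *: dF c) <= 16 * M / r * rnorm h ^+ 2.
Proof.
move=> Fd dM h hr.
have [->|h0] := eqVneq h 0.
  by rewrite add0r subrr scale0r subr0 !rnorm0 expr0n /= mulr0.
have nh0 : 0 < rnorm h := rnorm_gt0 h0.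
have r0 : 0 < r by have := lt_trans nh0 hr; lra.
have h2r z : rnorm (z - c) < 2 * rnorm h -> rnorm (z - c) < r / 2.
  by move=> zh; apply: lt_trans zh _; move: hr; lra.
have r2r z : rnorm (z - c) < r / 2 -> rnorm (z - c) < r.
  by move=> zh; apply: lt_trans zh _; move: r0; lra.
have M0 : 0 <= M by apply: le_trans (dM c _); rewrite ?rnorm_ge0// subrr rnorm0.
have := @mean_value_ball R E (fun z => F z - z *: dF c) (fun z => dF z - dF c) c
  (2 * rnorm h) (8 * M / r * (2 * rnorm h)) _ _ (h + c) c.
rewrite !addrK subrr rnorm0.
have -> : F (h + c) - (h + c) *: dF c - (F c - c *: dF c) =
    F (h + c) - F c - h *: dF c.
  by rewrite opprB scalerDl opprD -!addrA addKr [- (h *: _) + _]addrC.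
move=> H; apply: le_trans (H _ _ _ _) _.
- move=> z zh; have Fz := Fd z (r2r _ (h2r _ zh)).
  have lz : is_derive z 1 (fun z : R[i]^o => z *: dF c) (dF c).
    apply/is_derive_near => e e0; apply: filterS filterT => k _.
    by rewrite -scalerBl addrK subrr normr0 mulr_ge0// ltW.
  exact: is_deriveB.
- move=> z zh; apply: le_trans (derivative_lipschitz Fd dM (h2r _ zh) _) _.
    by rewrite subrr rnorm0; move: r0; lra.
  apply: ler_wpM2l; last exact: ltW.
  by rewrite divr_ge0 ?mulr_ge0// ltW.
- by move: nh0; lra.
- by move: nh0; lra.
by rewrite expr2 le_eqVlt; apply/orP; left; apply/eqP; ring.
Qed.

(** The index [i0] fixes the radius [d] before [h] is known. The index [i], close to the limit at
    the two points [c] and [h + c], is chosen afterwards, and the mean value inequality for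
    [F i - F i0] links the two. *)
Lemma uniform_limit_derive (T : Type) (U : set_system T) (F dF : T -> R[i]^o -> E)
    (G dG : R[i]^o -> E) (c : R[i]^o) (r : R) : ProperFilter U -> 0 < r ->
  (forall i z, rnorm (z - c) < r -> is_derive z 1 (F i) (dF i z)) ->
  (forall e : R, 0 < e ->
    U [set i | forall z, rnorm (z - c) < r -> rnorm (dF i z - dG z) <= e]) ->
  (forall z, rnorm (z - c) < r -> forall e : R, 0 < e ->
    U [set i | rnorm (F i z - G z) <= e]) ->
  is_derive c 1 G (dG c).
Proof.
move=> UF r0 Fd dFG FG; apply/is_derive_rnormP => e e0.
have e8 : 0 < e / 8 by rewrite divr_gt0.
have [i0 i0P] := filter_ex (dFG _ e8).
have cr : rnorm (c - c) < r by rewrite subrr rnorm0.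
have [d d0 dP] := (is_derive_rnormP _ _ _).1 (Fd i0 c cr) _ e8.
exists (Num.min d r) => [|h]; first by rewrite lt_min d0.
rewrite lt_min => /andP[hd hr].
have [->|h0] := eqVneq h 0.
  by rewrite add0r subrr scale0r subr0 !rnorm0 mulr0.
have nh0 : 0 < rnorm h := rnorm_gt0 h0.
have hcr : rnorm (h + c - c) < r by rewrite addrK.
have eh0 : 0 < e / 8 * rnorm h by rewrite mulr_gt0.
have [i [[iP ih] ic]] := filter_ex (filterI (filterI (dFG _ e8)
  (FG _ hcr _ eh0)) (FG _ cr _ eh0)).
have mv : rnorm (F i (h + c) - F i0 (h + c) - (F i c - F i0 c)) <=
    (e / 8 + e / 8) * rnorm h.
  have := @mean_value_ball R E (fun z => F i z - F i0 z)
    (fun z => dF i z - dF i0 z) c r (e / 8 + e / 8) _ _ (h + c) c hcr cr.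
  rewrite addrK; apply=> z zr.
    have Fi := Fd i z zr; have Fi0 := Fd i0 z zr; exact: is_deriveB.
  rewrite -(subrKA (dG z)); apply: le_trans (rnormD _ _) _.
  by rewrite lerD ?iP// rnormBC i0P.
have -> : G (h + c) - G c - h *: dG c =
    (F i (h + c) - F i0 (h + c) - (F i c - F i0 c)) +
    (F i c - G c) + (G (h + c) - F i (h + c)) +
    (F i0 (h + c) - F i0 c - h *: dF i0 c) + h *: (dF i0 c - dG c).
  rewrite scalerBr; move: (F i _) (F i _) (F i0 _) (F i0 _) (G _) (G _) (h *: _) (h *: _).
  move=> a b f g x y v u.
  rewrite -[RHS]addrA subrKA opprB -[X in _ = X + _ + _]addrA subrKA.
  rewrite [X in _ = X + _]addrC addrA subrKA [RHS]addrAC.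
  rewrite -[g - f - u]addrA subrKA [- f - u]addrC (addrA y (- u)) subrKA.
  by rewrite addrAC.
have tri a1 a2 a3 a4 a5 : rnorm (a1 + a2 + a3 + a4 + a5 : E) <=
    rnorm a1 + rnorm a2 + rnorm a3 + rnorm a4 + rnorm a5.
  by do 4 (rewrite (le_trans (rnormD _ _))// lerD2r).
apply: le_trans (tri _ _ _ _ _) _.
have last_le : rnorm (h *: (dF i0 c - dG c)) <= e / 8 * rnorm h.
  by rewrite rnormZ mulrC ler_wpM2r ?i0P// (@rnorm_ge0 _ R[i]^o).
have := lerD (lerD (lerD (lerD mv ic) _) (dP h hd)) last_le.
rewrite /= rnormBC in ih; move=> /(_ _ _ ih) /le_trans; apply.
have : 0 < e * rnorm h by rewrite mulr_gt0.
lra.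
Qed.

End holomorphic_consequences.

(** * Weakly bounded sets *)

Section bounded_ultrafilter.
Variable R : realType.

Lemma fmap_ultra (T S : Type) (f : T -> S) (U : set_system T) :
  UltraFilter U -> UltraFilter (f @ U).
Proof.
move=> UU; split=> [|G GF fUG]; first exact: fmap_proper_filter.
apply/seteqP; split=> // A GA.
have [//|UnA] := in_ultra_setVsetC (f @^-1` A) UU.
by have [x []] := filter_ex (filterI GA (fUG (~` A) UnA)).
Qed.

Lemma ultra_bounded_real (T : Type) (U : set_system T) (f : T -> R) (M : R) :
  UltraFilter U -> U [set i | `|f i| <= M] ->
  exists l : R, forall e : R, 0 < e -> U [set i | `|f i - l| < e].
Proof.
move=> UU UM.
have fM : U (f @^-1` `[- M, M]%classic).
  apply: filterS UM => i fi; have : `|f i| <= M by exact: fi.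
  by rewrite ler_norml /= in_itv.
have := @segment_compact R (- M) M; rewrite compact_ultra.
move=> /(_ (f @ U) (fmap_ultra f UU) fM)[l [_ fl]].
exists l => e e0; have Ul : U (f @^-1` ball l e).
  by apply: fl; exact: nbhsx_ballx.
by apply: filterS Ul => i; rewrite /ball /= distrC.
Qed.

Lemma ultra_bounded_complex (T : Type) (U : set_system T) (f : T -> R[i]^o) (M : R) :
  UltraFilter U -> U [set i | rnorm (f i) <= M] ->
  exists l : R[i]^o, forall e : R, 0 < e -> U [set i | rnorm (f i - l) < e].
Proof.
move=> UU UM.
have [|a aP] := @ultra_bounded_real T U (fun i => complex.Re (f i)) M UU.
  by apply: filterS UM => i /=; exact/le_trans/Re_le_rnorm.
have [|b bP] := @ultra_bounded_real T U (fun i => complex.Im (f i)) M UU.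
  by apply: filterS UM => i /=; exact/le_trans/Im_le_rnorm.
exists (a +i* b)%C => e e0; have e2 : 0 < e / 2 by rewrite divr_gt0.
apply: filterS (filterI (aP _ e2) (bP _ e2)) => i /= [ai bi].
apply: le_lt_trans (rnorm_ReIm _) _.
by rewrite [e]splitr ltrD// ?raddfB.
Qed.

End bounded_ultrafilter.

Section dual_space.
Variables (R : realType) (E : normedModType R[i]).

Lemma bounded_linear_continuous (e : {linear E -> R[i]^o}) (C : R) :
  (forall x, rnorm (e x) <= C * rnorm x) -> continuous e.
Proof.
move=> eC x A /nbhs_rnormP[r r0 rA]; apply/nbhs_rnormP.
have C0 : 0 < `|C| + 1 by rewrite ltr_wpDl.
exists (r / (`|C| + 1)) => [|y yx]; first by rewrite divr_gt0.
apply: rA; rewrite -linearB; apply: le_lt_trans (eC _) _.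
apply: (@le_lt_trans _ _ ((`|C| + 1) * rnorm (y - x))).
  rewrite ler_wpM2r ?rnorm_ge0//; apply: le_trans (ler_norm _) _.
  by rewrite lerDl.
by rewrite mulrC -ltr_pdivlMr.
Qed.

Lemma continuous_linear_bound (e : {linear E -> R[i]^o}) : continuous e ->
  exists2 C : R, 0 < C & forall x, rnorm (e x) <= C * rnorm x.
Proof.
move=> ce; have /ce : nbhs (e 0) [set w : R[i]^o | rnorm w < 1].
  by apply/nbhs_rnormP; exists 1 => // w; rewrite linear0 subr0.
move=> /nbhs_rnormP[d d0 dP]; exists (2 / d) => [|x]; first by rewrite divr_gt0.
have [->|x0] := eqVneq x 0; first by rewrite linear0 !rnorm0 mulr0.
have nx : 0 < rnorm x := rnorm_gt0 x0.
pose k := d / 2 / rnorm x; have k0 : 0 < k by rewrite !divr_gt0.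
have : rnorm (e (k%:C *: x)) < 1.
  apply: dP; rewrite subr0 rnormZ Re_normC gtr0_norm// divfK ?gt_eqF//.
  by rewrite ltr_pdivrMr// mulr_natr mulr2n ltrDl.
rewrite linearZ rnormZ Re_normC gtr0_norm// mulrC -ltr_pdivlMr// => /ltW.
by move=> /le_trans; apply; rewrite div1r /k !invf_div mulrC.
Qed.

(* A gliding hump: the functional [e] is the sum of [+-3^-n g n] with [g n]
   norming for [x n], the sign being chosen so that the partial sum does not
   decrease at [x n]. *)
Lemma weakly_bounded (S : set E) :
  (forall e : {linear E -> R[i]^o}, (forall x, rnorm (e x) <= 2 * rnorm x) ->
    exists M : R, forall x, S x -> rnorm (e x) <= M) ->
  exists M : R, forall x, S x -> rnorm x <= M.
Proof.
move=> wb; apply: contrapT => /forallNP unb.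
(* The hump at [x n] has size at least [3^-n rnorm (x n)] and the tail takes away at most half of
   it, which leaves more than [n]. *)
have /choice[x xP] (n : nat) : exists x, S x /\ 2 * n%:R * 3 ^+ n < rnorm x.
  have := unb (2 * n%:R * 3 ^+ n); move=> /existsNP[x /not_implyP[Sx /negP]].
  by rewrite -ltNge; exists x.
have /choice[g gP] (n : nat) : exists g : {linear E -> R[i]^o},
    (forall y, rnorm (g y) <= rnorm y) /\ g (x n) = (rnorm (x n))%:C.
  exact: hahn_banach (@rnorm_is_seminorm R E) (x n).
pose h n (y : E) : R[i]^o := (3 ^- n)%:C *: g n y.
have p3 n : 0 < 3 ^- n :> R by rewrite invr_gt0 exprn_gt0 ?ltr0n.
have hle n y : rnorm (h n y) <= 3 ^- n * rnorm y.
  rewrite /h rnormZ Re_normC gtr0_norm//; apply: ler_wpM2l; first exact: ltW.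
  by have [] := gP n.
pose P := fix P (n : nat) : E -> R[i]^o := if n is m.+1 then fun y =>
  (if 3 ^- m * rnorm (x m) <= rnorm (P m (x m) + h m (x m))
   then P m y + h m y else P m y - h m y) else fun=> 0.
have PS n y : P n.+1 y = if 3 ^- n * rnorm (x n) <= rnorm (P n (x n) + h n (x n))
    then P n y + h n y else P n y - h n y by [].
have PL n a y z : P n (a *: y + z) = a *: P n y + P n z.
  have hL m : h m (a *: y + z) = a *: h m y + h m z.
    by rewrite /h linearP scalerDr !scalerA [_ * a]mulrC.
  elim: n => [|n IH]; first by rewrite /= scaler0 addr0.
  rewrite !PS; case: ifP => _; rewrite IH hL; first by rewrite scalerDr addrACA.
  by rewrite scalerBr opprD addrACA.
have Pstep n y : rnorm (P n.+1 y - P n y) <= 3 ^- n * rnorm y.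
  rewrite PS; case: ifP => _; rewrite addrAC subrr add0r ?rnormN; exact: hle.
(* Since [2 h = (P + h) - (P - h)], one of the two candidates has at [x n] at least the norm of [h],
   namely [3^-n rnorm (x n)]. *)
have hump n : 3 ^- n * rnorm (x n) <= rnorm (P n.+1 (x n)).
  rewrite PS; case: ifPn => //; rewrite -ltNge => lt.
  have hx : rnorm (h n (x n)) = 3 ^- n * rnorm (x n).
    rewrite /h (gP n).2 rnormZ Re_normC gtr0_norm//; congr (_ * _).
    by rewrite /rnorm Re_normC ger0_norm// (@rnorm_ge0 R E).
  have := rnormD (P n (x n) + h n (x n)) (- (P n (x n) - h n (x n))).
  rewrite rnormN opprB [P n (x n) + h n (x n) in X in X <= _]addrC addrACA subrr addr0 -mulr2n.
  have -> : rnorm (h n (x n) *+ 2) = 2 * (3 ^- n * rnorm (x n)).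
    by rewrite -scaler_nat rnormZ -hx -(rmorph_nat (real_complex R)) Re_normC normr_nat.
  by move: lt; lra.
have Ptail n m y : (n <= m)%N ->
    rnorm (P m y - P n y) <= 3 / 2 * (3 ^- n - 3 ^- m) * rnorm y.
  elim: m => [|m IH]; first by rewrite leqn0 => /eqP ->; rewrite !subrr rnorm0 mulr0 mul0r.
  rewrite leq_eqVlt => /predU1P[->|nm]; first by rewrite !subrr rnorm0 mulr0 mul0r.
  rewrite -(subrKA (P m y)); apply: le_trans (rnormD _ _) _.
  apply: le_trans (lerD (Pstep m y) (IH nm)) _; rewrite -mulrDl.
  apply: ler_wpM2r; first exact: rnorm_ge0.
  rewrite exprS invfM; move: (3 ^- n) (3 ^- m) => a b; lra.
have Pt n m y : (n <= m)%N -> rnorm (P m y - P n y) <= 3 / 2 * 3 ^- n * rnorm y.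
  move=> nm; apply: le_trans (Ptail _ _ y nm) _; apply: ler_wpM2r; first exact: rnorm_ge0.
  by rewrite ler_pM2l// lerBlDr lerDl ltW.
(* Along an ultrafilter finer than [\oo], boundedness of the partial sums already gives a limit, and
   estimates valid for all large [n] pass to it. *)
have [U [UU Uoo]] := @ultraFilterLemma _ (nbhs (\oo : set_system nat)) _.
have Pb y : U [set n | rnorm (P n y) <= 3 / 2 * rnorm y].
  apply: Uoo; exists 0%N => // n _ /=.
  by have := Pt 0%N n y (leq0n _); rewrite /= subr0 expr0 invr1 mulr1.
have /choice[f fP] y : exists l : R[i]^o, forall d : R, 0 < d ->
    U [set n | rnorm (P n y - l) < d].
  exact: ultra_bounded_complex (Pb y).
have UP : ProperFilter U by exact: ultra_proper.
have flim y (l : R[i]^o) (M : R) : U [set n | rnorm (P n y - l) <= M] ->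
    rnorm (f y - l) <= M.
  move=> Ul; apply: (filter_limit_le UP _ Ul) => d /(fP y).
  by apply: filterS => n /=; rewrite opprB subrKA.
have fL : linear f.
  move=> a y z; apply: (@subr0_eq R[i]^o); apply: rnorm0_eq0.
  apply/eqP; rewrite eq_le rnorm_ge0 andbT; apply/ler_addgt0Pr => d d0; rewrite add0r.
  have a0 : 0 < complex.Re `|a| + 1 by rewrite ltr_wpDl// (@rnorm_ge0 R R[i]^o).
  have d2 : 0 < d / 2 by rewrite divr_gt0.
  have da : 0 < d / 2 / (complex.Re `|a| + 1) by rewrite divr_gt0.
  apply: flim; apply: filterS (filterI (fP y _ da) (fP z _ d2)) => n /= [yn zn].
  rewrite PL opprD addrACA -scalerBr; apply: le_trans (rnormD _ _) _.
  rewrite rnormZ [d]splitr; apply: lerD; last exact: ltW.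
  apply: le_trans (_ : (complex.Re `|a| + 1) * rnorm (P n y - f y) <= _).
    by apply: ler_wpM2r; [exact: rnorm_ge0|rewrite lerDl].
  by rewrite mulrC -ler_pdivlMr// ltW.
pose e : {linear E -> R[i]^o} := HB.pack_for {linear E -> R[i]^o} f
  (GRing.isLinear.Build _ _ _ _ f fL).
have [|M MP] := wb e.
  move=> y; have := flim y 0 (3 / 2 * rnorm y); rewrite subr0 => H.
  apply: (@le_trans _ _ (3 / 2 * rnorm y)).
    by apply: H; apply: filterS (Pb y) => n /=; rewrite subr0.
  by apply: ler_wpM2r; [exact: rnorm_ge0|lra].
pose n := (Num.truncn `|M|).+1.
have := MP _ (xP n).1; have := (xP n).2.
have : rnorm (f (x n) - P n.+1 (x n)) <= 3 / 2 * 3 ^- n.+1 * rnorm (x n).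
  by apply: flim; apply: Uoo; exists n.+1 => // m /=; exact: Pt.
have := hump n; have := rnormD (f (x n)) (- (f (x n) - P n.+1 (x n))).
rewrite rnormN subKr => H1 H2 H3 H4 H5.
have {}H5 : rnorm (f (x n)) <= M := H5.
have Mn : M < n%:R.
  by apply: le_lt_trans (ler_norm _) _; exact: truncnS_gt.
have {}H4 : 2 * n%:R < 3 ^- n * rnorm (x n).
  by rewrite [ltRHS]mulrC ltr_pdivlMr ?exprn_gt0 ?ltr0n.
move: H3; rewrite exprS invfM.
have -> : 3 / 2 * (3^-1 * 3 ^- n) * rnorm (x n) = 3 ^- n * rnorm (x n) / 2.
  by move: (3 ^- n) => a; field.
by move: H1 H2 H4 H5 Mn; lra.
Qed.

End dual_space.

(** * Bloch spaces *)

Section disc_topology.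
Variable R : realType.
Implicit Types z w : disc R.

Lemma disc_lt1 z : rnorm (val z : R[i]^o) < 1.
Proof.
have : `|val z : R[i]^o| < 1 by exact: set_mem (valP z).
by rewrite (rnorm_ltP _ ltr01).
Qed.

Definition disc_point (z : R[i]^o) (z1 : rnorm z < 1) : disc R :=
  SigSub (mem_set (etrans (rnorm_ltP z ltr01) z1) : z \in disc R).

Lemma nbhs_discP z (A : set (disc R)) : nbhs z A <->
  exists2 r : R, 0 < r &
    forall w, rnorm ((val w : R[i]^o) - val z) < r -> A w.
Proof.
split=> [|[r r0 rA]].
  rewrite nbhsE => -[B [[V Vo <-] Vz] BA].
  have /nbhs_rnormP[r r0 rV] : nbhs (val z : R[i]^o) V by exact: open_nbhs_nbhs.
  by exists r => // w wz; apply: BA; exact: rV.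
have cv : {for z, continuous (set_val : disc R -> R[i]^o)}.
  exact: (@initial_continuous (disc R) R[i]^o set_val).
have nV : nbhs (val z : R[i]^o) [set y | rnorm (y - val z) < r].
  by apply/nbhs_rnormP; exists r.
have nz : nbhs z (set_val @^-1` [set y : R[i]^o | rnorm (y - val z) < r]) := cv _ nV.
by apply: filterS nz => w; exact: rA.
Qed.

Definition cdisc (rho : R) : set (disc R) := [set z | rnorm (val z : R[i]^o) <= rho].

Lemma cdisc_compact rho : rho < 1 -> compact (cdisc rho).
Proof.
move=> rho1; rewrite compact_ultra => U UU Urho.
have [|l lP] := @ultra_bounded_complex R _ U (fun z => val z) rho UU.
  by apply: filterS Urho.
have UP : ProperFilter U by exact: ultra_proper.
have lrho : rnorm l <= rho := filter_limit_le UP lP Urho.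
have l1 : rnorm l < 1 := le_lt_trans lrho rho1.
exists (disc_point l1); split => // A /nbhs_discP[r r0 rA].
by apply: filterS (lP r r0) => w; exact: rA.
Qed.

Lemma compact_cdisc (K : set (disc R)) : compact K ->
  exists2 rho, 0 < rho < 1 & K `<=` cdisc rho.
Proof.
move=> Kc; have [|rho _|rho1 rho2 /= h1 h2|z Kz|rho rho01 Krho] := @compact_directed _ K _
    [set rho : R | 0 < rho < 1]
    (fun rho => [set z : disc R | rnorm (val z : R[i]^o) < rho]) Kc.
- by exists (1 / 2) => /=; lra.
- rewrite openE => z /= zr; apply/nbhs_discP.
  exists (rho - rnorm (val z : R[i]^o)) => [|w wz]; first by rewrite subr_gt0.
  rewrite /= -[val w](subrK (val z)); apply: le_lt_trans (rnormD _ _) _.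
  by rewrite -ltrBrDr.
- have [le|/ltW le] := leP rho1 rho2.
    by exists rho2 => // z /= [/lt_le_trans|//]; exact.
  by exists rho1 => // z /= [//|/lt_le_trans]; exact.
- exists ((1 + rnorm (val z : R[i]^o)) / 2).
    by have := disc_lt1 z; have := rnorm_ge0 (val z : R[i]^o); move=> /=; lra.
  by have := disc_lt1 z => /=; lra.
- by exists rho => // z /Krho /ltW.
Qed.

Lemma compact_lower_bound (v : disc R -> R) (K : set (disc R)) :
  continuous v -> (forall z, 0 < v z) -> compact K ->
  exists2 m : R, 0 < m & forall z, K z -> m < v z.
Proof.
move=> cv v0 Kc; have [|m _|m1 m2 /= h1 h2|z Kz|m m0 Km] := @compact_directed _ K _
    [set m : R | 0 < m] (fun m => [set z : disc R | m < v z]) Kc.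
- by exists 1 => /=.
- by move/continuousP: cv => /(_ _ (@open_gt _ m)).
- have [le|/ltW le] := leP m1 m2.
    by exists m1 => // z /= [//|]; exact: le_lt_trans.
  by exists m2 => // z /= [|//]; exact: le_lt_trans.
- by exists (v z / 2) => /=; have := v0 z; lra.
- by exists m.
Qed.

Lemma compact_upper_bound (v : disc R -> R) (K : set (disc R)) :
  continuous v -> compact K ->
  exists2 M : R, 0 < M & forall z, K z -> v z < M.
Proof.
move=> cv Kc; have [|m _|m1 m2 /= h1 h2|z Kz|m m0 Km] := @compact_directed _ K _
    [set m : R | 0 < m] (fun m => [set z : disc R | v z < m]) Kc.
- by exists 1 => /=.
- by move/continuousP: cv => /(_ _ (@open_lt _ m)).
- have [le|/ltW le] := leP m1 m2.
    by exists m2 => // z /= [/lt_le_trans|//]; exact.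
  by exists m1 => // z /= [//|/lt_le_trans]; exact.
- by exists (`|v z| + 1) => /=; [rewrite ltr_wpDl|rewrite ltr_pwDr// ler_norm].
- by exists m.
Qed.

End disc_topology.

Section extension.
Variables (R : realType) (E : normedModType R[i]).
Implicit Types (f g : disc R -> E).

Notation ext f := ('valL_0 f : R[i]^o -> E).

Lemma ext_val f z : ext f (val z) = f z.
Proof. exact: (congr1 (@^~ z) (valLK 0 f)). Qed.

Lemma ext_disc f (z : R[i]^o) (z1 : rnorm z < 1) : ext f z = f (disc_point z1).
Proof. by rewrite -ext_val. Qed.

Lemma is_derive_ext f (G : R[i]^o -> E) (z : R[i]^o) d : rnorm z < 1 ->
  (forall w, f w = G (val w)) -> is_derive z 1 G d -> is_derive z 1 (ext f) d.
Proof.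
move=> z1 fG; apply: near_eq_is_derive; apply/nbhs_rnormP.
exists (1 - rnorm z) => [|w wz]; first by rewrite subr_gt0.
have w1 : rnorm w < 1.
  by rewrite -[w](subrK z); apply: le_lt_trans (rnormD _ _) _; rewrite -ltrBrDr.
by rewrite (ext_disc _ w1) fG.
Qed.

Lemma holomorphic_is_derive f (z : R[i]^o) : holomorphic f -> rnorm z < 1 ->
  is_derive z 1 (ext f) ('D_1 (ext f) z).
Proof.
by move=> fh z1; apply: DeriveDef => //; exact: (fh (disc_point z1)).
Qed.

Lemma is_derive_holomorphic f (dG : R[i]^o -> E) :
  (forall z : R[i]^o, rnorm z < 1 -> is_derive z 1 (ext f) (dG z)) ->
  holomorphic f /\ forall z, cderive f z = dG (val z).
Proof.
by move=> fd; split=> z; have [] := fd (val z) (disc_lt1 z).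
Qed.

End extension.

Lemma generated_continuous (R : realType) (X : lmodType R[i])
    (t : Topological X) (G : set (X -> R)) q :
  (forall q, G q -> is_seminorm q) -> generated t G -> G q ->
  continuous (q : withtop t -> R).
Proof.
move=> GS tG Gq x; apply/cvgrPdist_lt => e e0.
apply: filterS (nbhs_seminorm_ball tG x Gq e0) => y /= yx.
apply: le_lt_trans yx; have qS := GS _ Gq.
have := seminorm_tri y x 0 qS; have := seminorm_tri x y 0 qS.
rewrite !subr0 (@seminormBC _ _ _ x y qS) ler_norml => H1 H2.
by apply/andP; split; lra.
Qed.

(** * The seminorms of a Bloch space *)

Section bloch_seminorms.
Variables (R : realType) (v : disc R -> R) (E : normedModType R[i]).
Hypothesis v_continuous : continuous v.
Hypothesis v_gt0 : forall z, 0 < v z.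
Local Notation B := (bloch_space v E).
Notation ext f := ('valL_0 f : R[i]^o -> E).
Implicit Types (f g : B) (S : set (disc R)).

Lemma bloch_spaceP f : bloch v f.
Proof. by case: f => f /= /asboolP. Qed.

Lemma bloch_is_derive f (z : R[i]^o) : rnorm z < 1 ->
  is_derive z 1 (ext f) ('D_1 (ext f) z).
Proof. by apply: holomorphic_is_derive; case: (bloch_spaceP f). Qed.

Lemma bloch_funD f g z : (f + g) z = f z + g z. Proof. by []. Qed.
Lemma bloch_funZ a f z : (a *: f) z = a *: f z. Proof. by []. Qed.
Lemma bloch_funB f g z : (f - g) z = f z - g z. Proof. by []. Qed.

Lemma dext_linear a f g (z : R[i]^o) : rnorm z < 1 ->
  'D_1 (ext (a *: f + g)%R) z = a *: 'D_1 (ext f) z + 'D_1 (ext g) z.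
Proof.
move=> z1; have fz := bloch_is_derive f z1; have gz := bloch_is_derive g z1.
have afg : is_derive z 1 (a \*: ext f + ext g) (a *: 'D_1 (ext f) z + 'D_1 (ext g) z).
  by apply: is_deriveD.
have fgE w : (a *: f + g : B) w = (a \*: ext f + ext g) (val w).
  by rewrite bloch_funD bloch_funZ -[f w]ext_val -[g w]ext_val.
by have [] := is_derive_ext z1 fgE afg.
Qed.

Lemma dextB f g (z : R[i]^o) : rnorm z < 1 ->
  'D_1 (ext (f - g)%R) z = 'D_1 (ext f) z - 'D_1 (ext g) z.
Proof.
move=> z1; have := dext_linear (-1) g f z1; rewrite !scaleN1r.
by rewrite addrC [RHS]addrC.
Qed.

Lemma cderive_linear a f g z :
  cderive (a *: f + g)%R z = a *: cderive f z + cderive g z.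
Proof. exact: dext_linear (disc_lt1 z). Qed.

Lemma cderiveD f g z : cderive (f + g)%R z = cderive f z + cderive g z.
Proof. by have := cderive_linear 1 f g z; rewrite !scale1r. Qed.

Lemma cderive0 z : cderive (0 : B) z = 0.
Proof. by have := cderive_linear (-1) 0 0 z; rewrite scaler0 addr0 scaleN1r addNr. Qed.

Lemma cderiveZ a f z : cderive (a *: f)%R z = a *: cderive f z.
Proof. by have := cderive_linear a f 0 z; rewrite !addr0 cderive0 addr0. Qed.

Let sup_bounded f S : has_ubound [set rnorm (cderive f z) * v z | z in S].
Proof.
have [_ [M MP]] := bloch_spaceP f; exists M => _ [z Sz <-].
by apply: MP; exists z.
Qed.

Let wder_ge0 f z : 0 <= rnorm (cderive f z) * v z.
Proof. by rewrite mulr_ge0 ?rnorm_ge0// ltW. Qed.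

Lemma bloch_seminorm_ge0 f S : rnorm (f (disc0 R)) <= bloch_seminorm v S f.
Proof.
rewrite /bloch_seminorm lerDl; have [->|/set0P[z Sz]] := eqVneq S set0.
  by rewrite image_set0 sup0.
apply: le_trans (wder_ge0 f z) _; apply: ub_le_sup; first exact: sup_bounded.
by exists z.
Qed.

Lemma bloch_seminorm_ge f S z : S z ->
  rnorm (f (disc0 R)) + rnorm (cderive f z) * v z <= bloch_seminorm v S f.
Proof.
move=> Sz; rewrite lerD2l; apply: ub_le_sup; first exact: sup_bounded.
by exists z.
Qed.

Lemma bloch_seminorm_le f S (c : R) : rnorm (f (disc0 R)) <= c ->
  (forall z, S z -> rnorm (f (disc0 R)) + rnorm (cderive f z) * v z <= c) ->
  bloch_seminorm v S f <= c.
Proof.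
move=> f0 fS; rewrite /bloch_seminorm; have [->|/set0P[z Sz]] := eqVneq S set0.
  by rewrite image_set0 sup0 addr0.
rewrite addrC -lerBrDr; apply: ge_sup.
  by exists (rnorm (cderive f z) * v z), z.
by move=> _ [w Sw <-]; rewrite lerBrDr addrC; exact: fS.
Qed.

Lemma bloch_seminormS f S T : S `<=` T ->
  bloch_seminorm v S f <= bloch_seminorm v T f.
Proof.
move=> ST; apply: bloch_seminorm_le; first exact: bloch_seminorm_ge0.
by move=> z /ST; exact: bloch_seminorm_ge.
Qed.

Lemma bloch_is_seminorm S : is_seminorm (fun f : B => bloch_seminorm v S f).
Proof.
have qZ (a : R[i]) f : bloch_seminorm v S (a *: f) <=
    complex.Re `|a| * bloch_seminorm v S f.
  have a0 : 0 <= complex.Re `|a| by exact: (@rnorm_ge0 R R[i]^o).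
  apply: bloch_seminorm_le => [|z Sz]; rewrite bloch_funZ rnormZ.
    by apply: ler_wpM2l => //; exact: bloch_seminorm_ge0.
  rewrite cderiveZ rnormZ -mulrA -mulrDr; apply: ler_wpM2l => //.
  exact: bloch_seminorm_ge.
apply: is_seminorm_le => // [f|f g].
  by apply: le_trans (bloch_seminorm_ge0 f S); exact: rnorm_ge0.
apply: bloch_seminorm_le => [|z Sz]; rewrite bloch_funD.
  by apply: le_trans (rnormD _ _) _; apply: lerD; exact: bloch_seminorm_ge0.
apply: le_trans (lerD (bloch_seminorm_ge f Sz) (bloch_seminorm_ge g Sz)).
rewrite addrACA lerD ?rnormD// -mulrDl cderiveD; apply: ler_wpM2r.
  exact: ltW.
exact: rnormD.
Qed.

Lemma bloch_norm_is_norm : is_norm (bloch_norm v E).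
Proof.
split=> [|f f0]; first exact: bloch_is_seminorm.
have f00 : rnorm (f (disc0 R)) = 0.
  apply/eqP; rewrite eq_le rnorm_ge0 andbT -f0; exact: bloch_seminorm_ge0.
have df0 z : rnorm (cderive f z) = 0.
  have := @bloch_seminorm_ge f setT z I; rewrite [X in _ <= X]f0 f00 add0r.
  rewrite pmulr_lle0// => H; apply/eqP; rewrite eq_le H; exact: rnorm_ge0.
apply: val_inj; apply/funext => z; apply: rnorm0_eq0.
apply/eqP; rewrite eq_le rnorm_ge0 andbT.
(* With derivative bound [0] on the unit disc, the mean value inequality makes [f] constant, equal
   to its value at the centre. *)
have := @mean_value_ball R E (ext f) ('D_1 (ext f)) 0 1 0 _ _ (val z) 0.
rewrite !subr0 rnorm0 mul0r => H.
move: H; rewrite ext_val.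
have -> : ext f 0 = f (disc0 R) by rewrite -ext_val.
rewrite (rnorm0_eq0 f00) subr0; apply => [w|w||//].
- by rewrite subr0; exact: bloch_is_derive.
- by rewrite subr0 => w1; have := df0 (disc_point w1) => ->.
- exact: disc_lt1.
Qed.

Definition bloch_system (fam : set (set (disc R))) : set (B -> R) :=
  [set (fun f : B => bloch_seminorm v S f) | S in fam].

Lemma bloch_system_seminorm fam q : bloch_system fam q -> is_seminorm q.
Proof. by move=> [S _ <-]; exact: bloch_is_seminorm. Qed.

Lemma bloch_system_directed (fam : set (set (disc R))) : fam set0 ->
  (forall S T, fam S -> fam T -> fam (S `|` T)) -> directed_seminorms (bloch_system fam).
Proof.
move=> f0 fU; split; first by exists (fun f : B => bloch_seminorm v set0 f), set0.
move=> _ _ [S fS <-] [T fT <-].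
exists (fun f : B => bloch_seminorm v (S `|` T) f); split.
- by exists (S `|` T) => //; exact: fU.
- by move=> f; apply: bloch_seminormS; exact: subsetUl.
- by move=> f; apply: bloch_seminormS; exact: subsetUr.
Qed.

(** Singletons already recover the norm as a supremum, and the empty set contributes the value at
    [0]; so the families of finite and of compact sets are treated alike. *)
Lemma bloch_saks_system (t : Topological B) (fam : set (set (disc R))) :
  fam set0 -> (forall z, fam [set z]) ->
  (forall S T, fam S -> fam T -> fam (S `|` T)) ->
  generated t (bloch_system fam) ->
  saks_system (bloch_norm v E) t (bloch_system fam).
Proof.
move=> f0 f1 fU tG; have GS := @bloch_system_seminorm fam.
have Gdir := bloch_system_directed f0 fU; split => //.
- by move=> q Gq; split; [exact: GS|exact: generated_continuous GS tG Gq].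
- exact: generated_same tG (seminorm_topology_generated GS Gdir).
move=> f; apply/eqP; rewrite eq_le; apply/andP; split; last first.
  apply: ge_ereal_sup => _ [_ [S fS <-] <-]; rewrite lee_fin.
  exact: bloch_seminormS.
have le0 : ((rnorm (f (disc0 R)))%:E <=
    ereal_sup [set (q f)%:E | q in bloch_system fam])%E.
  apply: (@le_trans _ _ (bloch_seminorm v set0 f)%:E).
    by rewrite lee_fin; exact: bloch_seminorm_ge0.
  by apply: ereal_sup_ubound; exists (fun f : B => bloch_seminorm v set0 f) => //; exists set0.
have le1 z : ((rnorm (f (disc0 R)) + rnorm (cderive f z) * v z)%:E <=
    ereal_sup [set (q f)%:E | q in bloch_system fam])%E.
  apply: (@le_trans _ _ (bloch_seminorm v [set z] f)%:E).
    by rewrite lee_fin; exact: bloch_seminorm_ge.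
  by apply: ereal_sup_ubound; exists (fun f : B => bloch_seminorm v [set z] f) => //; exists [set z].
move: le0 le1; case: (ereal_sup _) => [r|_ _|//]; last by rewrite leey.
rewrite !lee_fin => le0 le1; apply: bloch_seminorm_le => // z _.
by have := le1 z; rewrite lee_fin.
Qed.

(** The weight is bounded below by a positive constant on [cdisc rho]. This is the local bound on
    derivatives that the Cauchy estimate requires. *)
Lemma bloch_derivative_bound (rho : R) : rho < 1 -> exists2 C : R, 0 < C &
  forall f (z : R[i]^o), rnorm z <= rho ->
    rnorm ('D_1 (ext f) z) <= C * bloch_seminorm v (cdisc rho) f.
Proof.
move=> rho1; have [m m0 mv] := compact_lower_bound v_continuous v_gt0 (cdisc_compact rho1).
exists m^-1 => [|f z zrho]; first by rewrite invr_gt0.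
have z1 : rnorm z < 1 := le_lt_trans zrho rho1.
have zr : cdisc rho (disc_point z1) by [].
rewrite ler_pdivlMl//; apply: le_trans (bloch_seminorm_ge f zr).
have -> : cderive f (disc_point z1) = 'D_1 (ext f) z by [].
rewrite mulrC; apply: (@le_trans _ _ (rnorm ('D_1 (ext f) z) * v (disc_point z1))).
  by rewrite ler_wpM2l ?rnorm_ge0// ltW// mv.
by rewrite lerDr rnorm_ge0.
Qed.

Lemma bloch_value_bound (rho : R) : 0 < rho < 1 -> exists2 C : R, 0 < C &
  forall f (z : R[i]^o), rnorm z < rho ->
    rnorm (ext f z) <= C * bloch_seminorm v (cdisc rho) f.
Proof.
move=> /andP[rho0 rho1]; have [C C0 CP] := bloch_derivative_bound rho1.
exists (1 + C) => [|f z zrho]; first by rewrite addr_gt0.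
set q := bloch_seminorm _ _ _.
have q0 : 0 <= q by apply: le_trans (bloch_seminorm_ge0 f _); exact: rnorm_ge0.
have fd (w : R[i]^o) : rnorm (w - 0) < rho -> is_derive w 1 (ext f) ('D_1 (ext f) w).
  by rewrite subr0 => wr; apply: bloch_is_derive; exact: lt_trans wr rho1.
have dfC (w : R[i]^o) : rnorm (w - 0) < rho -> rnorm ('D_1 (ext f) w) <= C * q.
  by rewrite subr0 => /ltW; exact: CP.
have zr : rnorm (z - 0) < rho by rewrite subr0.
have r00 : rnorm ((0 : R[i]^o) - 0) < rho by rewrite subr0 rnorm0.
have := mean_value_ball fd dfC zr r00; rewrite subr0 => H.
have e0 : ext f 0 = f (disc0 R) by rewrite -ext_val.
rewrite -[ext f z](subrK (ext f 0)) mulrDl mul1r addrC.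
apply: le_trans (rnormD _ _) _; apply: lerD.
  by rewrite e0; exact: bloch_seminorm_ge0.
apply: le_trans H _; rewrite ler_piMr ?mulr_ge0 ?(ltW C0)//.
by rewrite ltW// (lt_trans zrho).
Qed.

End bloch_seminorms.

(** * The compact-open topology on Bloch spaces *)

Section compact_open.
Variables (R : realType) (v : disc R -> R) (E : normedModType R[i]).
Hypothesis v_continuous : continuous v.
Hypothesis v_gt0 : forall z, 0 < v z.
Local Notation B := (bloch_space v E).
Notation ext f := ('valL_0 f : R[i]^o -> E).
Implicit Types (f g : B) (S K : set (disc R)).

Lemma entourage_rnormP (P : set (E * E)) : entourage P <->
  exists2 e : R, 0 < e & forall x y, rnorm (x - y) < e -> P (x, y).
Proof.
rewrite -entourage_ballE; split=> [[e /= e0 eP]|[e e0 eP]].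
  exists (complex.Re e) => [|x y xy]; first by move: e0; rewrite ltcE => /andP[].
  by apply: eP; rewrite /= -ball_normE /= (rnorm_ltP _ e0).
exists e%:C; first by rewrite /= ltcR.
move=> [x y] /=; rewrite -ball_normE /= => xy; apply: eP.
by rewrite rnorm_ltP ?ltcR in xy.
Qed.

Lemma tau_coP f (A : set B) : nbhs (f : withtop (tau_co v E)) A <->
  exists K (e : R), [/\ compact K, 0 < e &
    forall g, (forall z, K z -> rnorm (g z - f z) < e) -> A g].
Proof.
split=> [|[K [e [Kc e0 eA]]]].
  rewrite nbhsE => -[W [[V Vo <-] Vf] VA].
  pose D := [set Ke : set (disc R) * R | compact Ke.1 /\ 0 < Ke.2].
  pose F := filter_from D (fun Ke => [set g : B | forall z, Ke.1 z -> rnorm (g z - f z) < Ke.2]).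
  have FF : Filter F.
    apply: filter_from_filter; first by exists (set0, 1); split => //; exact: compact0.
    move=> [K a] [L b] [/= Kc a0] [/= Lc b0]; exists (K `|` L, Num.min a b).
      by split; [exact: compactU|rewrite lt_min a0].
    move=> g /= gKL; split=> z zS.
      by have := gKL z (or_introl zS); rewrite lt_min => /andP[].
    by have := gKL z (or_intror zS); rewrite lt_min => /andP[].
  have : (@bloch_fun R v E : B -> {family compact, disc R -> E}) @ F -->
      (bloch_fun f : {family compact, disc R -> E}).
    apply/fam_cvgP => K Kc P /uniform_nbhs[Q [/entourage_rnormP[e e0 eQ] QP]].
    exists (K, e); first by [].
    move=> g /= gK; apply: QP => z Kz; apply: eQ.
    by rewrite rnormBC; exact: gK.
  move=> /(_ V (open_nbhs_nbhs (conj Vo Vf))) [[K e] [/= Kc e0] KV].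
  by exists K, e; split => // g gK; apply: VA; exact: KV.
have cont : {for (f : withtop (tau_co v E)), continuous
    (@bloch_fun R v E : withtop (tau_co v E) -> {family compact, disc R -> E})}.
  exact: (@initial_continuous B {family compact, disc R -> E} (@bloch_fun R v E)).
have nV : nbhs (bloch_fun f : {family compact, disc R -> E})
    [set h | forall z, K z -> rnorm (h z - f z) < e].
  have : {uniform K, nbhs (bloch_fun f : {family compact, disc R -> E}) --> bloch_fun f}.
    by move: K Kc {eA}; apply/fam_cvgP; exact: cvg_id.
  apply; apply/uniform_nbhs; exists [set xy | rnorm (xy.1 - xy.2) < e]; split.
    by apply/entourage_rnormP; exists e.
  by move=> h /= hK z /hK; rewrite rnormBC.
have nf := cont _ nV.
move: nf; apply: (@filterS _ (nbhs (f : withtop (tau_co v E)))) => g gK; exact: eA.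
Qed.

Lemma tau_co_generated : generated (tau_co v E) (bloch_system (v := v) (@compact (disc R))).
Proof.
move=> f A; split=> [/tau_coP[K [e [Kc e0 eA]]]|[_ [r [[S Sc <-] r0 rA]]]].
  have [rho rho01 Krho] := compact_cdisc Kc; have /andP[rho0 rho1] := rho01.
  pose s := (rho + 1) / 2; have s01 : 0 < s < 1 by rewrite /s; apply/andP; split; lra.
  have rs : rho < s by rewrite /s; lra.
  have [C C0 CP] := bloch_value_bound E v_continuous v_gt0 s01.
  exists (fun f : B => bloch_seminorm v (cdisc s) f), (e / C); split.
  - by exists (cdisc s) => //; apply: cdisc_compact; case/andP: s01.
  - by rewrite divr_gt0.
  move=> g gf; apply: eA => z Kz; rewrite -bloch_funB -ext_val.
  apply: le_lt_trans (CP _ _ _) _; first exact: le_lt_trans (Krho _ Kz) rs.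
  by rewrite mulrC -ltr_pdivlMr.
have [rho rho01 Srho] := compact_cdisc Sc; have /andP[rho0 rho1] := rho01.
pose d := (1 - rho) / 2; have d0 : 0 < d by rewrite /d; lra.
have s1 : rho + d < 1 by rewrite /d; lra.
have [M M0 MP] := compact_upper_bound v_continuous (cdisc_compact rho1).
(* The [1] accounts for the value at [0], and [4 / d * M] for the Cauchy estimate on radius [d]
   times the upper bound [M] of the weight. *)
pose k := 1 + 4 / d * M.
have k0 : 0 < k.
  have : 0 < 4 / d * M by rewrite mulr_gt0// divr_gt0.
  by rewrite /k; lra.
pose e := r / 2 / k; have e0 : 0 < e by rewrite !divr_gt0.
apply/tau_coP; exists (cdisc (rho + d)), e; split => //; first exact: cdisc_compact.
move=> g gf; apply: rA.
apply: (@le_lt_trans _ _ (r / 2)); last by rewrite ltr_pdivrMr// mulr_natr mulr2n ltrDl.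
have kE : e + 4 * e / d * M = r / 2.
  have -> : e + 4 * e / d * M = e * k by rewrite /k; ring.
  by rewrite /e divfK// gt_eqF.
have hval z : cdisc (rho + d) z -> rnorm ((g - f : B) z) <= e.
  by move=> zd; apply/ltW; exact: gf.
have h0 : rnorm ((g - f : B) (disc0 R)) <= e.
  by apply: hval; rewrite /cdisc /= rnorm0; lra.
apply: bloch_seminorm_le => // [|z Sz].
  apply: le_trans h0 _; rewrite -kE lerDl; apply: mulr_ge0; last exact: ltW.
  by apply: divr_ge0; [apply: mulr_ge0; last exact: ltW|exact: ltW].
rewrite -kE lerD//.
(* [C] supplies the local boundedness of the derivative under which the Cauchy estimate holds; the
   size comes from [e]. *)
have [C C0 CP] := bloch_derivative_bound E v_continuous v_gt0 s1.
have zrho : rnorm (val z : R[i]^o) <= rho by exact: Srho.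
have ball_in (w : R[i]^o) : rnorm (w - val z) < d -> rnorm w < rho + d.
  move=> wz; rewrite -[w](subrK (val z)); apply: le_lt_trans (rnormD _ _) _.
  by rewrite addrC; exact: ler_ltD.
have hd (w : R[i]^o) : rnorm (w - val z) < d ->
    is_derive w 1 (ext (g - f : B)) ('D_1 (ext (g - f : B)) w).
  by move=> wz; apply: bloch_is_derive; exact: lt_trans (ball_in _ wz) s1.
have hdC (w : R[i]^o) : rnorm (w - val z) < d -> rnorm ('D_1 (ext (g - f : B)) w) <=
    C * bloch_seminorm v (cdisc (rho + d)) (g - f : B).
  by move=> wz; apply: CP; exact/ltW/ball_in.
have hM (w : R[i]^o) : rnorm (w - val z) < d -> rnorm (ext (g - f : B) w) <= e.
  move=> wz; have w1 := lt_trans (ball_in _ wz) s1; rewrite (ext_disc _ w1).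
  by apply: hval; exact/ltW/ball_in.
have := cauchy_estimate hd hdC hM d0 => H.
apply: ler_pM; [exact: rnorm_ge0|exact: ltW|exact: H|].
by apply/ltW/MP.
Qed.

Lemma compact_family : [/\ @compact (disc R) set0, forall z, @compact (disc R) [set z] &
  forall S T, @compact (disc R) S -> compact T -> compact (S `|` T)].
Proof. by split=> [|z|S T]; [exact: compact0|exact: compact_set1|exact: compactU]. Qed.

Lemma tau_co_saks_system :
  saks_system (bloch_norm v E) (tau_co v E) (bloch_system (v := v) (@compact (disc R))).
Proof.
have [c0 c1 cU] := compact_family.
exact: bloch_saks_system tau_co_generated.
Qed.

Lemma tau_family_generated (fam : set (set (disc R))) : fam set0 ->
  (forall S T, fam S -> fam T -> fam (S `|` T)) ->
  generated (tau_family v E fam) (bloch_system (v := v) fam).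
Proof.
move=> f0 fU; apply: seminorm_topology_generated.
  by move=> q; exact: bloch_system_seminorm.
exact: bloch_system_directed.
Qed.

Lemma tau_co_same : same_topology (tau_co v E) (tau_family v E (@compact (disc R))).
Proof.
have [c0 c1 cU] := compact_family.
exact: generated_same tau_co_generated (tau_family_generated c0 cU).
Qed.

(** Every compact subset of the disc lies in the closed discs of radius [n / n.+1] for all large
    [n], which provides the cofinal sequence of seminorms. *)
Lemma tau_co_C_sequential : C_sequential (mixed_topology (bloch_norm v E) (tau_co v E)).
Proof.
have n1 n : n%:R / n.+1%:R < 1 :> R.
  by rewrite ltr_pdivrMr ?ltr0n// mul1r ltr_nat.
pose k n (f : B) := bloch_seminorm v (cdisc (n%:R / n.+1%:R)) f.
have kG n : bloch_system (v := v) (@compact (disc R)) (k n).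
  by exists (cdisc (n%:R / n.+1%:R)) => //; exact: cdisc_compact.
have := saks_C_sequential (bloch_norm_is_norm E v_gt0) tau_co_saks_system kG.
apply => _ [S Sc <-].
have [rho /andP[rho0 rho1] Srho] := compact_cdisc Sc.
exists (Num.truncn (1 - rho)^-1).+1 => n Nn f; apply: bloch_seminormS => // z /Srho zr.
apply: le_trans zr _; rewrite ler_pdivlMr ?ltr0n//.
have r1 : 0 < 1 - rho by rewrite subr_gt0.
have : (1 - rho)^-1 < n%:R.
  by apply: lt_le_trans (truncnS_gt _) _; rewrite ler_nat.
rewrite -[_^-1]mul1r ltr_pdivrMr// -natr1; lra.
Qed.

End compact_open.

Section bloch_limits.
Variables (R : realType) (v : disc R -> R) (E : normedModType R[i]).
Hypothesis v_continuous : continuous v.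
Hypothesis v_gt0 : forall z, 0 < v z.
Local Notation B := (bloch_space v E).
Notation ext f := ('valL_0 f : R[i]^o -> E).
Implicit Types (f g : B) (S K : set (disc R)).

(** The common end of Montel's theorem and of completeness: both define [G] and [dG] pointwise and
    differ in how the derivatives are shown to converge locally uniformly. The bound [M] puts the
    limit in the Bloch space. *)
Lemma bloch_limit (U : set_system B) (G dG : R[i]^o -> E) (M : R) : ProperFilter U ->
  (forall rho e : R, rho < 1 -> 0 < e -> U [set f | forall z : R[i]^o,
    rnorm z < rho -> rnorm ('D_1 (ext f) z - dG z) <= e]) ->
  (forall (z : R[i]^o) (e : R), rnorm z < 1 -> 0 < e ->
    U [set f | rnorm (ext f z - G z) <= e]) ->
  (forall z, rnorm (dG (val z)) * v z <= M) ->
  exists g : B, U --> (g : withtop (tau_co v E)).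
Proof.
move=> UF UdG UG dGM.
have Gd (c : R[i]^o) : rnorm c < 1 -> is_derive c 1 G (dG c).
  move=> c1; pose r := (1 - rnorm c) / 2; have r0 : 0 < r by rewrite /r; lra.
  have cr z : rnorm (z - c) < r -> rnorm z < (1 + rnorm c) / 2.
    move=> zc; rewrite -[z](subrK c); apply: le_lt_trans (rnormD _ _) _.
    by move: zc; rewrite /r; lra.
  have s1 : (1 + rnorm c) / 2 < 1 by lra.
  have id f (z : R[i]^o) : rnorm (z - c) < r -> is_derive z 1 (ext f) ('D_1 (ext f) z).
    by move=> /cr zc; apply: bloch_is_derive; exact: lt_trans zc s1.
  apply: (uniform_limit_derive UF r0 id) => [e e0|z zc e e0].
    by apply: filterS (UdG _ e s1 e0) => f fP z /cr; exact: fP.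
  by apply: UG => //; apply: lt_trans s1; exact: cr.
pose gf (z : disc R) := G (val z).
have gd (z : R[i]^o) : rnorm z < 1 -> is_derive z 1 (ext gf) (dG z).
  by move=> z1; apply: (is_derive_ext z1 _ (Gd z z1)).
have [gh gder] := is_derive_holomorphic gd.
have gB : gf \in bloch_pred v E.
  apply/asboolP; split=> //; exists M => _ [z _ <-]; rewrite gder; exact: dGM.
pose g : B := BlochSpace gB.
exists g.
apply: (generated_cvg (tau_co_generated v_continuous v_gt0)).
move=> _ r [S Sc <-] r0.
have [rho /andP[rho0 rho1] Srho] := compact_cdisc Sc.
have [C C0 CP] := compact_upper_bound v_continuous (cdisc_compact rho1).
have C1 : 0 < 1 + C by rewrite addr_gt0.
pose e := r / 2 / (1 + C); have e0 : 0 < e by rewrite !divr_gt0.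
have s1 : (1 + rho) / 2 < 1 by lra.
have z1 : rnorm (0 : R[i]^o) < 1 by rewrite rnorm0.
apply: filterS (filterI (UG 0 e z1 e0) (UdG _ e s1 e0)) => f [f0 fd].
change (is_true (bloch_seminorm v S (f - g : B) < r)).
have h0 : rnorm ((f - g : B) (disc0 R)) <= e.
  by rewrite bloch_funB -[f _]ext_val.
apply: (@le_lt_trans _ _ (r / 2)); last by rewrite ltr_pdivrMr// mulr_natr mulr2n ltrDl.
have eE : e + e * C = r / 2.
  by rewrite -[X in X + _]mulr1 -mulrDr /e divfK// gt_eqF.
apply: bloch_seminorm_le => // [|z /Srho zr].
  by apply: le_trans h0 _; rewrite -eE lerDl mulr_ge0// ltW.
rewrite -eE; apply: lerD => //; apply: ler_pM; rewrite ?rnorm_ge0//.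
- exact: ltW.
- have -> : cderive (f - g : B) z = 'D_1 (ext f) (val z) - dG (val z).
    by rewrite /cderive (dextB _ _ (disc_lt1 z)) -gder.
  by apply: fd; apply: (le_lt_trans zr); lra.
- by apply/ltW/CP.
Qed.

End bloch_limits.

(** * Montel's theorem *)

Section montel.
Variables (R : realType) (v : disc R -> R).
Hypothesis v_continuous : continuous v.
Hypothesis v_gt0 : forall z, 0 < v z.
Local Notation B := (bloch_space v R[i]^o).
Notation ext f := ('valL_0 f : R[i]^o -> R[i]^o).
Implicit Types (f g : B).

Lemma bloch_ball_compact (M : R) :
  compact ([set f | bloch_norm v R[i]^o f <= M] : set (withtop (tau_co v R[i]^o))).
Proof.
rewrite compact_ultra => U UU UM; have UF : ProperFilter U by exact: ultra_proper.
pose bal := [set f : B | bloch_norm v R[i]^o f <= M].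
have dbound f z : bal f -> rnorm (cderive f z) <= M / v z.
  move=> fM; rewrite ler_pdivlMr//.
  have H : rnorm (f (disc0 R)) + rnorm (cderive f z) * v z <= M.
    by apply: le_trans fM; exact: bloch_seminorm_ge.
  by apply: le_trans H; rewrite lerDr rnorm_ge0.
have /choice[dG dGP] (z : R[i]^o) : exists l : R[i]^o, rnorm z < 1 ->
    forall e : R, 0 < e -> U [set f : B | rnorm ('D_1 (ext f) z - l) < e].
  have [z1|z1] := pselect (rnorm z < 1); last by exists 0.
  have [|l lP] := @ultra_bounded_complex R B U (fun f => 'D_1 (ext f) z) (M / v (disc_point z1)) UU.
    by apply: filterS UM => f fM; exact: (dbound f (disc_point z1)).
  by exists l.
have vb (rho : R) : 0 < rho < 1 -> exists2 C : R, 0 < C & forall f (z : R[i]^o),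
    bal f -> rnorm z < rho -> rnorm (ext f z) <= C /\ rnorm ('D_1 (ext f) z) <= C.
  move=> rho01; have rho1 : rho < 1 by case/andP: rho01.
  have [C C0 CP] := bloch_value_bound R[i]^o v_continuous v_gt0 rho01.
  have [D D0 DP] := bloch_derivative_bound R[i]^o v_continuous v_gt0 rho1.
  have M1 : 0 < `|M| + 1 by rewrite ltr_wpDl.
  exists ((C + D) * (`|M| + 1)) => [|f z fM zr]; first by rewrite mulr_gt0// addr_gt0.
  have qM : bloch_seminorm v (cdisc rho) f <= `|M| + 1.
    have qn : bloch_seminorm v (cdisc rho) f <= M.
      by apply: le_trans _ (fM : bloch_norm v R[i]^o f <= M); exact: bloch_seminormS.
    by apply: le_trans qn _; have := ler_norm M; lra.
  split.
    apply: le_trans (CP f z zr) _; apply: (le_trans (ler_wpM2l (ltW C0) qM)).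
    by rewrite ler_pM2r// lerDl ltW.
  apply: le_trans (DP f z (ltW zr)) _; apply: (le_trans (ler_wpM2l (ltW D0) qM)).
  by rewrite ler_pM2r// lerDr ltW.
have mid (r : R) : r < 1 -> 0 <= r -> 0 < (1 + r) / 2 < 1.
  by move=> r1 r0; apply/andP; split; lra.
have /choice[G GP] (z : R[i]^o) : exists l : R[i]^o, rnorm z < 1 ->
    forall e : R, 0 < e -> U [set f : B | rnorm (ext f z - l) < e].
  have [z1|z1] := pselect (rnorm z < 1); last by exists 0.
  have [C C0 CP] := vb _ (mid _ z1 (rnorm_ge0 _)).
  have [|l lP] := @ultra_bounded_complex R B U (fun f => ext f z) C UU.
    have zr : rnorm z < (1 + rnorm z) / 2 by move: z1; lra.
    by apply: filterS UM => f fM; have [] := CP f z fM zr.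
  by exists l.
have dGM z : rnorm (dG (val z)) * v z <= M.
  rewrite -ler_pdivlMr//; apply: (filter_limit_le UF (dGP _ (disc_lt1 z))).
  by apply: filterS UM => f fM; exact: dbound.
have [||g Ug] := @bloch_limit R v R[i]^o v_continuous v_gt0 U G dG M UF _ _ dGM.
- move=> rho e rho1 e0.
  (* Equicontinuity turns pointwise into uniform convergence: derivatives of functions in the ball
     share local Lipschitz constants, and the compactness of the disc enters through near
     coverings. *)
  have : \forall f \near U, cdisc rho `<=` (fun z => bal f -> rnorm ('D_1 (ext f) (val z) - dG (val z)) <= e).
    apply: (compact_near_coveringP (cdisc rho)).1; first exact: cdisc_compact.
    move=> x _; have x1 := disc_lt1 x.
    pose s := (1 + rnorm (val x : R[i]^o)) / 2.
    have s01 := mid _ x1 (rnorm_ge0 _); have s1 : s < 1 by case/andP: s01.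
    have [C C0 CP] := vb _ s01.
    pose r := (1 - rnorm (val x : R[i]^o)) / 2; have r0 : 0 < r by rewrite /r; lra.
    (* One third for the derivative of [f] between [z] and [x], one for its distance to [dG] at [x],
       and one for [dG] between [x] and [z], which inherits the Lipschitz bound in the limit. *)
    have e3 : 0 < e / 3 by rewrite divr_gt0.
    pose L := 8 * C / r; have L0 : 0 < L by rewrite divr_gt0// mulr_gt0.
    pose d := Num.min (r / 2) (e / 3 / L).
    have d0 : 0 < d by rewrite lt_min; apply/andP; split; rewrite divr_gt0.
    have inb (z : R[i]^o) : rnorm (z - val x) < r -> rnorm z < s.
      move=> zx; rewrite -[z](subrK (val x)); apply: le_lt_trans (rnormD _ _) _.
      by move: zx; rewrite /r /s; lra.
    have lip f (z : R[i]^o) : bal f -> rnorm (z - val x) < d ->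
        rnorm ('D_1 (ext f) z - 'D_1 (ext f) (val x)) <= e / 3.
      move=> fM zd.
      have fd (w : R[i]^o) : rnorm (w - val x) < r -> is_derive w 1 (ext f) ('D_1 (ext f) w).
        by move=> /inb ws; apply: bloch_is_derive; exact: lt_trans ws s1.
      have dC (w : R[i]^o) : rnorm (w - val x) < r -> rnorm ('D_1 (ext f) w) <= C.
        by move=> /inb ws; have [] := CP f w fM ws.
      have zr : rnorm (z - val x) < r / 2 by apply: lt_le_trans zd _; rewrite ge_min lexx.
      have xr : rnorm ((val x : R[i]^o) - val x) < r / 2 by rewrite subrr rnorm0 divr_gt0.
      apply: le_trans (derivative_lipschitz fd dC zr xr) _.
      rewrite mulrC -ler_pdivlMr//; apply: le_trans (ltW zd) _.
      by rewrite ge_min lexx orbT.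
    have dlip (z : disc R) : rnorm ((val z : R[i]^o) - val x) < d ->
        rnorm (dG (val z) - dG (val x)) <= e / 3.
      move=> zd; have H a : 0 < a ->
          U [set f : B | rnorm (('D_1 (ext f) (val z) - 'D_1 (ext f) (val x)) - (dG (val z) - dG (val x))) < a].
        move=> a0; have a2 : 0 < a / 2 by rewrite divr_gt0.
        apply: (@filterS B U _ _ _ _ (filterI (dGP _ (disc_lt1 z) _ a2) (dGP _ x1 _ a2))) => f [/= f1 f2].
        rewrite opprD addrACA -opprD.
        apply: le_lt_trans (rnormD _ _) _; rewrite rnormN [a]splitr.
        exact: ltrD.
      apply: (filter_limit_le UF H); apply: filterS UM => f fM; exact: lip.
    exists ([set z | rnorm ((val z : R[i]^o) - val x) < d],
            [set f : B | rnorm ('D_1 (ext f) (val x) - dG (val x)) < e / 3]) => /=.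
      by split; [apply/nbhs_discP; exists d|exact: dGP].
    move=> [z f] /= [zd fx] fM.
    have -> : 'D_1 (ext f) (val z) - dG (val z) =
      ('D_1 (ext f) (val z) - 'D_1 (ext f) (val x)) +
      ('D_1 (ext f) (val x) - dG (val x)) - (dG (val z) - dG (val x)).
      by rewrite subrKA opprB addrA subrK.
    apply: le_trans (rnormD _ _) _; rewrite rnormN.
    have := rnormD ('D_1 (ext f) (val z) - 'D_1 (ext f) (val x)) ('D_1 (ext f) (val x) - dG (val x)).
    by have := lip f _ fM zd; have := dlip z zd; move: fx; lra.
  move=> Ud; apply: filterS (filterI UM Ud) => f [fM fd] z zr.
  have z1 := lt_trans zr rho1.
  exact: (fd (disc_point z1) (ltW zr) fM).
- move=> z e z1 e0; apply: filterS (GP z z1 e e0) => f; exact: ltW.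
exists g; split => //.
apply: (saks_ball_closed (tau_co_saks_system R[i]^o v_continuous v_gt0)) => A gA.
have [f [fM fA]] := filter_ex (filterI UM (Ug _ gA)).
by exists f.
Qed.

End montel.

(** * Completeness of Bloch spaces *)

Section completeness.
Variables (R : realType) (v : disc R -> R) (E : normedModType R[i]).
Hypothesis v_continuous : continuous v.
Hypothesis v_gt0 : forall z, 0 < v z.
Hypothesis E_banach : banach E.
Local Notation B := (bloch_space v E).
Notation ext f := ('valL_0 f : R[i]^o -> E).
Implicit Types (f g : B) (S : set (disc R)).

Lemma banach_filter_limit (T : Type) (F : set_system T) (h : T -> E) : ProperFilter F ->
  (forall e : R, 0 < e -> exists2 A, F A &
    forall x y, A x -> A y -> rnorm (h x - h y) < e) ->
  exists l, forall e : R, 0 < e -> F [set x | rnorm (h x - l) < e].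
Proof.
move=> FF hc; have /E_banach : cauchy (h @ F).
  move=> P /entourage_rnormP[e e0 eP]; have [A FA Ae] := hc e e0.
  exists (h @` A, h @` A).
    by split; apply: (@filterS T F _ A) => // x Ax; exists x.
  by move=> [_ _] [/= [x Ax <-] [y Ay <-]]; apply: eP; exact: Ae.
move=> /cvg_ex[l hl]; exists l => e e0.
have nl : nbhs l [set y | rnorm (y - l) < e] by apply/nbhs_rnormP; exists e.
exact: hl nl.
Qed.

Lemma bloch_complete :
  complete_topology (mixed_topology (bloch_norm v E) (tau_co v E)).
Proof.
have saks := tau_co_saks_system E v_continuous v_gt0.
have nN := bloch_norm_is_norm E v_gt0.
move=> F FF Fc.
have qcauchy S (e : R) : compact S -> 0 < e -> exists2 A, F A &
    forall f g, A f -> A g -> bloch_seminorm v S (f - g : B) < e.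
  move=> Sc e0; have := Fc [set f : B | bloch_seminorm v S f < e]; apply.
  apply: (saks_mixed_nbhs nN saks); apply/(tau_co_generated v_continuous v_gt0).
  exists (fun f : B => bloch_seminorm v S f), e; split => //; first by exists S.
  by move=> f; rewrite subr0.
have dcauchy (rho e : R) : rho < 1 -> 0 < e -> exists2 A, F A &
    forall f g, A f -> A g -> forall z : R[i]^o, rnorm z < rho ->
    rnorm ('D_1 (ext f) z - 'D_1 (ext g) z) < e.
  move=> rho1 e0; have [C C0 CP] := bloch_derivative_bound E v_continuous v_gt0 rho1.
  have eC : 0 < e / C by rewrite divr_gt0.
  have [A FA Ae] := qcauchy _ _ (cdisc_compact rho1) eC; exists A => // f g Af Ag z zr.
  rewrite -dextB; last exact: lt_trans zr rho1.
  apply: le_lt_trans (CP _ _ (ltW zr)) _; rewrite mulrC -ltr_pdivlMr//.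
  exact: Ae.
have fcauchy (z : R[i]^o) (e : R) : rnorm z < 1 -> 0 < e -> exists2 A, F A &
    forall f g, A f -> A g -> rnorm (ext f z - ext g z) < e.
  move=> z1 e0; have rho01 : 0 < (1 + rnorm z) / 2 < 1.
    by have := rnorm_ge0 z => ?; apply/andP; split; lra.
  have [C C0 CP] := bloch_value_bound E v_continuous v_gt0 rho01.
  have eC : 0 < e / C by rewrite divr_gt0.
  have rho1 : (1 + rnorm z) / 2 < 1 by case/andP: rho01.
  have [A FA Ae] := qcauchy _ _ (cdisc_compact rho1) eC; exists A => // f g Af Ag.
  have -> : ext f z - ext g z = ext (f - g : B) z by rewrite !(ext_disc _ z1).
  have zr : rnorm z < (1 + rnorm z) / 2 by lra.
  apply: le_lt_trans (CP _ _ zr) _; rewrite mulrC -ltr_pdivlMr//.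
  exact: Ae.
have /choice[dG dGP] (z : R[i]^o) : exists l, rnorm z < 1 ->
    forall e : R, 0 < e -> F [set f : B | rnorm ('D_1 (ext f) z - l) < e].
  have [z1|z1] := pselect (rnorm z < 1); last by exists 0.
  have [|l lP] := @banach_filter_limit B F (fun f => 'D_1 (ext f) z) FF; last by exists l.
  move=> e e0; have s1 : (1 + rnorm z) / 2 < 1 by lra.
  have [A FA Ae] := dcauchy _ _ s1 e0; exists A => // f g Af Ag; apply: Ae => //.
  by lra.
have /choice[G GP] (z : R[i]^o) : exists l, rnorm z < 1 ->
    forall e : R, 0 < e -> F [set f : B | rnorm (ext f z - l) < e].
  have [z1|z1] := pselect (rnorm z < 1); last by exists 0.
  have [|l lP] := @banach_filter_limit B F (fun f => ext f z) FF; last by exists l.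
  by move=> e e0; exact: fcauchy.
(* If not, there are points [z n] where [rnorm dG * v] exceeds [n.+1 ^ 2]. The Cauchy property for
   the supremum with weights [n.+1^-1] keeps [dG] so close to the derivative of a fixed [g] that
   only linear growth in [n] is possible. *)
have [M dGM] : exists M : R, forall z, rnorm (dG (val z)) * v z <= M.
  apply: contrapT => /forallNP unb.
  have /choice[z zP] (n : nat) : exists z : disc R,
      n.+1%:R ^+ 2 < rnorm (dG (val z)) * v z.
    by have := unb (n.+1%:R ^+ 2); move=> /existsNP[z /negP]; rewrite -ltNge; exists z.
  pose q n (f : B) := bloch_seminorm v [set z n] f.
  have qS n : is_seminorm (q n) by exact: bloch_is_seminorm.
  have qle n f : q n f <= bloch_norm v E f by exact: bloch_seminormS.
  have a0 (n : nat) : 0 <= n.+1%:R^-1 :> R by rewrite invr_ge0.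
  have qt n (d : R) : 0 < d -> nbhs ((0 : B) : withtop (tau_co v E)) [set f | q n f < d].
    move=> d0; apply/(tau_co_generated v_continuous v_gt0).
    exists (q n), d; split => //; first by exists [set z n] => //; exact: compact_set1.
    by move=> f; rewrite subr0.
  have [A FA Ap] := Fc _ (weighted_sup_nbhs nN saks qS qle a0 (@cvg_harmonic R) qt ltr01).
  have [g Ag] := filter_ex FA.
  pose n := (Num.truncn (bloch_norm v E g)).+2.
  have gn : bloch_norm v E g + 1 < n%:R.
    by rewrite /n -natr1 ltrD2r; exact: truncnS_gt.
  have dbd : rnorm (dG (val (z n)) - cderive g (z n)) <= n.+1%:R / v (z n).
    apply: (@filter_limit_le R E B F (fun f => cderive f (z n) - cderive g (z n)) _ _ FF).
      move=> e e0; apply: filterS (dGP _ (disc_lt1 (z n)) e e0) => f /=.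
      by rewrite opprB addrA subrK.
    apply: filterS (FA) => f Af /=; have := Ap f g Af Ag => /= pfg.
    have := weighted_sup_ge qS qle a0 (@cvg_harmonic R) n (f - g : B).
    move=> /le_lt_trans /(_ pfg); rewrite ltr_pdivrMr ?ltr0n// mul1r => /ltW qn.
    have H : rnorm ((f - g : B) (disc0 R)) +
        rnorm (cderive (f - g : B) (z n)) * v (z n) <= n.+1%:R.
      by apply: le_trans qn; exact: bloch_seminorm_ge.
    rewrite ler_pdivlMr//; apply: le_trans H.
    have -> : cderive (f - g : B) (z n) = cderive f (z n) - cderive g (z n).
      exact: dextB (disc_lt1 _).
    by rewrite lerDr rnorm_ge0.
  have gM : rnorm (cderive g (z n)) * v (z n) <= bloch_norm v E g.
    have H : rnorm (g (disc0 R)) + rnorm (cderive g (z n)) * v (z n) <= bloch_norm v E g.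
      exact: bloch_seminorm_ge.
    by apply: le_trans H; rewrite lerDr rnorm_ge0.
  have vn := v_gt0 (z n); rewrite ler_pdivlMr// in dbd.
  have tri : rnorm (dG (val (z n))) <=
      rnorm (dG (val (z n)) - cderive g (z n)) + rnorm (cderive g (z n)).
    by apply: le_trans (rnormD _ _); rewrite subrK.
  have := ler_wpM2r (ltW vn) tri; rewrite mulrDl.
  have := zP n; have n0 : 0 <= n%:R :> R by [].
  have -> : n.+1%:R = n%:R + 1 :> R by rewrite -natr1.
  rewrite -natr1 in dbd; move: gn gM dbd n0 => gn gM dbd n0 zn tr.
  have : (n%:R + 1) ^+ 2 < n%:R + 1 + n%:R :> R by lra.
  by rewrite expr2; nra.
have UdG (rho e : R) : rho < 1 -> 0 < e -> F [set f : B | forall z : R[i]^o,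
    rnorm z < rho -> rnorm ('D_1 (ext f) z - dG z) <= e].
  move=> rho1 e0; have [A FA Ae] := dcauchy rho e rho1 e0.
  apply: filterS (FA) => f Af z zr; have z1 := lt_trans zr rho1.
  apply: (@filter_limit_le R E B F (fun g => 'D_1 (ext f) z - 'D_1 (ext g) z) _ _ FF).
    move=> d d0; apply: filterS (dGP z z1 d d0) => g gd /=.
    by rewrite opprB [X in rnorm X]addrC subrKA rnormBC.
  by apply: filterS FA => g Ag; exact/ltW/Ae.
have UG (z : R[i]^o) (e : R) : rnorm z < 1 -> 0 < e ->
    F [set f : B | rnorm (ext f z - G z) <= e].
  by move=> z1 e0; apply: filterS (GP z z1 e e0) => f; exact: ltW.
have [g Fg] := bloch_limit v_continuous v_gt0 FF UdG UG dGM.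
by exists g; exact: (mixed_cauchy_cvg nN saks FF Fc Fg).
Qed.

End completeness.

(** * Weakly Bloch functions *)

Section weak_bloch_space.
Variables (R : realType) (v : disc R -> R) (E : normedModType R[i]).
Hypothesis v_continuous : continuous v.
Hypothesis v_gt0 : forall z, 0 < v z.
Implicit Types (f : disc R -> E) (e : {linear E -> R[i]^o}).
Notation ext f := ('valL_0 f : R[i]^o -> E).
Notation cext f := ('valL_0 f : R[i]^o -> R[i]^o).

Lemma is_derive_functional e f (z : R[i]^o) d : continuous e -> rnorm z < 1 ->
  is_derive z 1 (ext f) d -> is_derive z 1 (cext (e \o f : disc R -> R[i]^o)) (e d).
Proof.
move=> /continuous_linear_bound[C _ eC] z1 fd.
have efd : is_derive z 1 (e \o ext f : R[i]^o -> R[i]^o) (e d).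
  exact: is_derive_linear eC fd.
apply: (is_derive_ext z1 _ efd) => w; exact: (congr1 (fun x => e x) (esym (ext_val f w))).
Qed.

Lemma bloch_weak f : bloch v f -> weak_bloch v E f.
Proof.
move=> [fh [M fM]] e ce; have [C C0 eC] := continuous_linear_bound ce.
have efd (z : R[i]^o) : rnorm z < 1 ->
    is_derive z 1 (cext (e \o f : disc R -> R[i]^o)) (e ('D_1 (ext f) z)).
  by move=> z1; apply: is_derive_functional => //; exact: holomorphic_is_derive.
have [efh efder] := is_derive_holomorphic efd.
split=> //; exists (C * M) => _ [z _ <-]; rewrite efder.
apply: (@le_trans _ _ (C * rnorm ('D_1 (ext f) (val z)) * v z)).
  by apply: ler_wpM2r; [exact: ltW|exact: eC].
by rewrite -mulrA; apply: ler_wpM2l; [exact: ltW|apply: fM; exists z].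
Qed.

Lemma bloch_local_bound (g : disc R -> R[i]^o) (rho : R) : rho < 1 -> bloch v g ->
  exists2 M : R, 0 <= M & forall z : R[i]^o, rnorm z < rho -> rnorm ('D_1 (cext g) z) <= M.
Proof.
move=> rho1 gB; have gP : g \in bloch_pred v R[i]^o by apply/asboolP.
have [C C0 CP] := bloch_derivative_bound R[i]^o v_continuous v_gt0 rho1.
exists (C * bloch_seminorm v (cdisc rho) (BlochSpace gP)) => [|z /ltW zr].
  apply: mulr_ge0; first exact: ltW.
  apply: le_trans (bloch_seminorm_ge0 v_gt0 (BlochSpace gP) (cdisc rho)); exact: rnorm_ge0.
exact: (CP (BlochSpace gP) z zr).
Qed.

Lemma weak_bloch_quotient f (z : R[i]^o) : weak_bloch v E f -> rnorm z < 1 ->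
  exists M r : R, 0 < r /\ forall h k : R[i]^o, h != 0 -> k != 0 ->
    rnorm h < r -> rnorm k < r ->
    rnorm (h^-1 *: (ext f (h + z) - ext f z) - k^-1 *: (ext f (k + z) - ext f z)) <=
      M * (rnorm h + rnorm k).
Proof.
move=> wf z1; pose s := (1 + rnorm z) / 2; have s1 : s < 1 by rewrite /s; lra.
pose r := (1 - rnorm z) / 2; have r0 : 0 < r by rewrite /r; lra.
have inb (w : R[i]^o) : rnorm (w - z) < r -> rnorm w < s.
  move=> wz; rewrite -[w](subrK z); apply: le_lt_trans (rnormD _ _) _.
  by move: wz; rewrite /r /s; lra.
pose Q (h : R[i]^o) := h^-1 *: (ext f (h + z) - ext f z).
(* After normalisation by [rnorm h + rnorm k], each functional is bounded on [S] by [second_order]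
   applied to its composition with [f]. Boundedness of [S] in norm is then the claimed estimate. *)
pose S := [set x | exists h k : R[i]^o, [/\ h != 0, k != 0, rnorm h < r / 4,
  rnorm k < r / 4 & x = ((rnorm h + rnorm k)^-1)%:C *: (Q h - Q k)]].
have [|M MP] := @weakly_bounded R E S.
  move=> e eC; have ce := bounded_linear_continuous eC.
  have [C C0 CP] := bloch_local_bound s1 (wf e ce).
  pose phi := cext (e \o f : disc R -> R[i]^o); pose dphi := 'D_1 phi.
  have phiE (w : R[i]^o) : rnorm w < 1 -> phi w = e (ext f w).
    by move=> w1; rewrite /phi !(ext_disc _ w1).
  have [eh _] := wf e ce.
  have phid (w : R[i]^o) : rnorm (w - z) < r -> is_derive w 1 phi (dphi w).
    by move=> /inb ws; apply: holomorphic_is_derive eh (lt_trans ws s1).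
  have phiC (w : R[i]^o) : rnorm (w - z) < r -> rnorm (dphi w) <= C.
    by move=> /inb ws; exact: CP.
  have so := second_order phid phiC.
  have eQ (h : R[i]^o) : h != 0 -> rnorm h < r / 4 ->
      rnorm (e (Q h) - dphi z) <= 16 * C / r * rnorm h.
    move=> h0 hr; have nh := rnorm_gt0 h0.
    have hz1 : rnorm (h + z) < 1.
      by apply: lt_trans s1; apply: inb; rewrite addrK; move: hr r0; lra.
    have := so h hr; rewrite !phiE// -linearB => H.
    rewrite -(ler_pM2l nh) -[X in X * rnorm (_ - _)]/(complex.Re `|h|) -rnormZ.
    have -> : h *: (e (Q h) - dphi z) = e (ext f (h + z) - ext f z) - h *: dphi z.
      by rewrite scalerBr /Q linearZ scalerA divff// scale1r.
    by apply: le_trans H _; rewrite [leRHS]mulrCA -expr2.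
  exists (16 * C / r) => _ [h [k [h0 k0 hr kr ->]]].
  have hk : 0 < rnorm h + rnorm k by rewrite addr_gt0 ?rnorm_gt0.
  rewrite linearZ rnormZ Re_normC gtr0_norm ?invr_gt0// ler_pdivrMl// linearB.
  rewrite -(subrKA (dphi z)); apply: le_trans (rnormD _ _) _.
  rewrite [X in _ + X]rnormBC mulrC mulrDr.
  by apply: lerD; exact: eQ.
exists M, (r / 4); split=> [|h k h0 k0 hr kr]; first by rewrite divr_gt0.
have hk : 0 < rnorm h + rnorm k by rewrite addr_gt0 ?rnorm_gt0.
have := MP (((rnorm h + rnorm k)^-1)%:C *: (Q h - Q k)).
rewrite rnormZ Re_normC gtr0_norm ?invr_gt0// ler_pdivrMl// [_ * M]mulrC.
by apply; exists h, k.
Qed.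

Lemma weak_bloch_bloch f : banach E -> weak_bloch v E f -> bloch v f.
Proof.
move=> Eb wf.
have fd (z : R[i]^o) : rnorm z < 1 -> is_derive z 1 (ext f) ('D_1 (ext f) z).
  move=> z1; have [M [r [r0 MP]]] := weak_bloch_quotient wf z1.
  pose Q (h : R[i]^o) := h^-1 *: (ext f (h + z) - ext f z).
  have [|l lP] := @banach_filter_limit R E Eb R[i]^o ((0 : R[i]^o)^') Q _.
    move=> e e0; have M1 : 0 < `|M| + 1 by rewrite ltr_wpDl.
    pose d := Num.min r (e / 2 / (`|M| + 1)).
    have d0 : 0 < d by rewrite lt_min r0 !divr_gt0.
    exists [set h : R[i]^o | h != 0 /\ rnorm h < d].
      apply/nbhs_rnormP; exists d => // h /=; rewrite subr0 => hd h0; split=> //.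
    move=> h k [h0 hd] [k0 kd].
    have hr : rnorm h < r by apply: lt_le_trans hd _; rewrite ge_min lexx.
    have kr : rnorm k < r by apply: lt_le_trans kd _; rewrite ge_min lexx.
    apply: le_lt_trans (MP h k h0 k0 hr kr) _.
    apply: (@le_lt_trans _ _ ((`|M| + 1) * (rnorm h + rnorm k))).
      apply: ler_wpM2r; first by rewrite addr_ge0 ?rnorm_ge0.
      by have := ler_norm M; lra.
    rewrite mulrC -ltr_pdivlMr// [ltRHS](_ : _ = e / 2 / (`|M| + 1) + e / 2 / (`|M| + 1)); last first.
      by rewrite -mulrDl -splitr.
    by apply: ltrD; [apply: lt_le_trans hd _|apply: lt_le_trans kd _];
      rewrite ge_min lexx orbT.
  have cQ : h^-1 *: (ext f (h *: (1 : R[i]^o) + z) - ext f z) @[h --> (0 : R[i]^o)^'] --> l.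
    move=> A /nbhs_rnormP[e e0 eA]; apply: filterS (lP e e0) => h /= hl.
    by apply: eA; rewrite [h *: (1 : R[i]^o)]mulr1.
  by apply: DeriveDef => //; apply/cvg_ex; exists l.
have [fh fder] := is_derive_holomorphic fd; split => //.
(* Weak boundedness is used a second time, for the weighted derivatives: each functional is bounded
   on them because its composition with [f] is a Bloch function. *)
have [|M MP] := @weakly_bounded R E [set (v z)%:C *: cderive f z | z in [set: disc R]].
  move=> e eC; have ce := bounded_linear_continuous eC.
  have [_ [M eM]] := wf e ce; exists M => _ [z _ <-].
  rewrite linearZ rnormZ Re_normC gtr0_norm// mulrC; apply: eM; exists z => //.
  congr (rnorm _ * _).
  by have [] := is_derive_functional ce (disc_lt1 z) (fd _ (disc_lt1 z)).
exists M => _ [z _ <-]; have := MP ((v z)%:C *: cderive f z).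
rewrite rnormZ Re_normC gtr0_norm// mulrC; apply; exists z => //.
Qed.

End weak_bloch_space.

Lemma finite_family (R : realType) : [/\ @finite_set (disc R) set0,
  forall z, @finite_set (disc R) [set z] &
  forall S T, @finite_set (disc R) S -> @finite_set (disc R) T ->
    @finite_set (disc R) (S `|` T)].
Proof.
by split=> [|z|S T Sf Tf]; rewrite ?finite_setU;
  [exact: finite_set0|exact: finite_set1|split].
Qed.

Theorem corollary4p10 (R : realType) (v : disc R -> R)
    (v_continuous : continuous v) (v_gt0 : forall z, 0 < v z)
    (E : normedModType R[i]) :
  [/\ C_sequential_saks_space (bloch_norm v E) (tau_co v E) /\
      same_topology (tau_co v E) (tau_family v E (@compact (disc R))),
      semi_montel_saks_space (bloch_norm v R[i]^o) (tau_co v R[i]^o) /\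
      (forall fam : set (set (disc R)),
        fam = @finite_set (disc R) \/ fam = @compact (disc R) ->
        is_submixed_topology (bloch_norm v R[i]^o) (tau_family v R[i]^o fam)
          (mixed_topology (bloch_norm v R[i]^o) (tau_co v R[i]^o))) &
      banach E ->
      [set f : disc R -> E | bloch v f] =
        [set f : disc R -> E | weak_bloch v E f] /\
      complete_saks_space (bloch_norm v E) (tau_co v E)].
Proof.
have [c0 c1 cU] := compact_family R; have [f0 f1 fU] := finite_family R.
have saks F := saks_system_space (bloch_norm_is_norm F v_gt0)
  (tau_co_saks_system F v_continuous v_gt0).
split.
- split; last exact: tau_co_same.
  by split; [exact: saks|exact: tau_co_C_sequential].
- have compact_ball := bloch_ball_compact v_continuous v_gt0.
  have saksC := tau_co_saks_system R[i]^o v_continuous v_gt0.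
  have normC := bloch_norm_is_norm R[i]^o v_gt0.
  split; first by split; [exact: saks|exact: saks_semi_montel saksC _].
  move=> fam famE.
  have [fam0 fam1 famU] : [/\ fam set0, forall z, fam [set z] &
      forall S T, fam S -> fam T -> fam (S `|` T)] by case: famE => ->.
  have fam_compact S : fam S -> compact S.
    by case: famE => ->//; exact: finite_compact.
  have famG := tau_family_generated (E := R[i]^o) v_gt0 fam0 famU.
  have fam_coarser : coarser (tau_family v R[i]^o fam) (tau_co v R[i]^o).
    apply/coarser_nbhs => f A /famG[_ [r [[S famS <-] r0 qA]]].
    apply: (proj2 (tau_co_generated v_continuous v_gt0 f A)).
    exists (fun g : bloch_space v R[i]^o => bloch_seminorm v S g), r.
    by split=> //; exists S => //; exact: fam_compact.
  (* Any [Gamma] is allowed because [mixed_submixed] takes an arbitrary Saks system of a coarser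
     topology; compactness of the balls is used for [tau_co]. *)
  split=> [|Gamma GammaS]; last exact: mixed_submixed normC saksC GammaS _ _.
  exact: saks_system_space normC (bloch_saks_system v_gt0 fam0 fam1 famU famG).
move=> E_banach; split; last by split; [exact: saks|exact: bloch_complete].
by apply/seteqP; split=> f; [exact: bloch_weak|exact: weak_bloch_bloch].
Qed.
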